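(* Let $k$ be a field, let $A$ be a finitely presented connected graded $k$-algebra, and let $M$ be a finitely presented graded right $A$-module. Suppose that $\mathrm{GK\text{-}dim}\,M=1$ and that at least one of the following conditions holds: (a) the field $k$ is finite; (b) the vector spaces $\mathrm{Tor}_2^A(M,k)$ and $\mathrm{Tor}_3^A(k,k)$ have finite dimensions. Then the Hilbert series $M(z)$ is rational, that is, the Hilbert function $f_M(n)=\dim_k M_n$ is periodic.
   Context: A connected graded algebra over $k$ is an associative algebra $A=\bigoplus_{i\ge 0}A_i$ with $A_0=k$; it is finitely presented if it has finitely many generators and finitely many relations. Modules are graded right modules, and $k=A/\bigoplus_{i\ge1}A_i$ is the trivial module. The Hilbert series of $M$ is $M(z)=\sum_i(\dim_k M_i)z^i$. For a finitely generated graded module the growth is that of $n\mapsto\sum_{i\le n}\dim_k M_i$. The condition $\mathrm{GK\text{-}dim}\,M\le 1$ is used synonymously with linear growth: there is a constant $C$ with $\sum_{i\le n}\dim_k M_i\le Cn$ for all $n\ge1$; $\mathrm{GK\text{-}dim}\,M=1$ means that $M$ is moreover infinite-dimensional. ''Periodic'' means eventually periodic: there are positive integers $d,N$ with $\dim_k M_n=\dim_k M_{n+d}$ for all $n\ge N$. *)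

(* Defs.v *)
From HB Require Import structures.
From mathcomp Require Import all_boot all_order all_algebra.
From mathcomp Require Import boolp classical_sets cardinality.
From mathcomp Require Import monalg.

Set Implicit Arguments.
Unset Strict Implicit.
Unset Printing Implicit Defensive.

Import Order.TTheory GRing.Theory Num.Theory.
Local Open Scope classical_set_scope.
Local Open Scope ring_scope.

(* Conventions.  The algebras and modules below are usually infinite
   dimensional, so [vectType] does not apply and dimensions are dimensions of
   subspaces of an [lmodType].  A right A-module is a left module over the
   converse ring, [M : lmodType A^c]: for [a : A^c] and [m : M], the element
   [a *: m] is what is usually written m.a. *)

Section Dimension.
Variables (k : fieldType) (V : lmodType k).

Definition has_dim (W : {pred V}) (n : nat) : Prop :=
  exists2 e : 'I_n -> V, (forall i, e i \in W) &
    forall v, v \in W -> exists! c : {ffun 'I_n -> k}, v = \sum_i c i *: e i.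

(* The value is 0 if [W] is infinite dimensional. *)
Definition dimk (W : {pred V}) : nat := xget 0%N [set n | has_dim W n].

(* dim_k (Z / B) is finite: Z is spanned, modulo B, by finitely many vectors. *)
Definition findim_quot (Z B : set V) : Prop :=
  exists (n : nat) (e : 'I_n -> V), (forall i, Z (e i)) /\
    forall z, Z z -> exists c : 'I_n -> k, B (z - \sum_i c i *: e i).

(* V is the internal direct sum of the subspaces G i. *)
Definition grading (I : eqType) (G : I -> {pred V}) : Prop :=
  [/\ forall i, submod_closed (G i),
      forall v, exists (s : seq I) (f : I -> V),
        (forall i, f i \in G i) /\ v = \sum_(i <- s) f i
    & forall (s : seq I) (f : I -> V), uniq s -> (forall i, f i \in G i) ->
        \sum_(i <- s) f i = 0 -> forall i, i \in s -> f i = 0].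

End Dimension.

Record cgAlgebra (k : fieldType) := CGAlgebra {
  cg_sort :> algType k;
  cg_piece : nat -> {pred cg_sort};
  cg_grading : grading cg_piece;
  cg_mul : forall i j a b,
    a \in cg_piece i -> b \in cg_piece j -> a * b \in cg_piece (i + j)%N;
  cg_connected : forall a, a \in cg_piece 0 <-> exists c : k, a = c%:A
}.
Arguments cg_piece {k} _ _.

(* The k-vector space underlying a right A-module. *)
Definition restr (k : fieldType) (A : algType k) (M : lmodType A^c) : Type := M.

Section Restriction.
Variables (k : fieldType) (A : algType k) (M : lmodType A^c).

HB.instance Definition _ := GRing.Zmodule.on (restr M).

Definition restr_scale (c : k) (m : restr M) : restr M := (c%:A : A^c) *: (m : M).

Fact restr_scaleA a b v : restr_scale a (restr_scale b v) = restr_scale (a * b) v.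
Proof.
rewrite /restr_scale scalerA; congr (_ *: _).
by rewrite {1}/GRing.mul /= -scalerAl mul1r scalerA mulrC.
Qed.

Fact restr_scale1 : left_id 1 restr_scale.
Proof. by move=> v; rewrite /restr_scale scale1r; exact: (@scale1r A^c M v). Qed.

Fact restr_scaleDr : right_distributive restr_scale +%R.
Proof. by move=> c u v; exact: (@scalerDr A^c M _ u v). Qed.

Fact restr_scaleDl v : {morph restr_scale^~ v : a b / a + b}.
Proof. by move=> a b; rewrite /restr_scale scalerDl; exact: (@scalerDl A^c M). Qed.

HB.instance Definition _ := GRing.Zmodule_isLmodule.Build k (restr M)
  restr_scaleA restr_scale1 restr_scaleDr restr_scaleDl.

End Restriction.

(* Graded modules are graded by the integers. *)
Record grModule (k : fieldType) (A : cgAlgebra k) := GRModule {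
  gm_sort :> lmodType A^c;
  gm_piece : int -> {pred restr gm_sort};
  gm_grading : grading gm_piece;
  gm_act : forall (i : int) (j : nat) (m : gm_sort) (a : A),
    m \in gm_piece i -> a \in cg_piece A j ->
    ((a : A^c) *: m) \in gm_piece (i + j%:Z)
}.
Arguments gm_piece {k A} _ _.

Section Augmentation.
Variables (k : fieldType) (A : cgAlgebra k).

(* The augmentation ideal: sums of homogeneous elements of positive degree. *)
Definition cg_plus : set A := [set a | exists2 s : seq A,
  (forall x, x \in s -> exists i : nat, x \in cg_piece A i.+1) &
  a = \sum_(x <- s) x].

Definition cg_aug (a : A) : k := xget 0 [set c | cg_plus (a - c%:A)].

Lemma cg_sub i : submod_closed (cg_piece A i).
Proof. by case: (cg_grading A). Qed.

Lemma cg_piece0 i : 0 \in cg_piece A i.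
Proof. by case: (cg_sub i). Qed.

Lemma cg_pieceD i x y :
  x \in cg_piece A i -> y \in cg_piece A i -> x + y \in cg_piece A i.
Proof. by case: (cg_sub i) => _ h hx hy; rewrite -[x]scale1r; apply: h. Qed.

Lemma cg_plusD x y : cg_plus x -> cg_plus y -> cg_plus (x + y).
Proof.
move=> [s hs ->] [t ht ->]; exists (s ++ t); last by rewrite big_cat.
by move=> z; rewrite mem_cat => /orP[/hs|/ht].
Qed.

Lemma cg_plus0 : cg_plus 0.
Proof. by exists [::] => //; rewrite big_nil. Qed.

Lemma cg_plus_hom i x : x \in cg_piece A i.+1 -> cg_plus x.
Proof.
by move=> hx; exists [:: x]; rewrite ?big_seq1 // => y; rewrite inE => /eqP->; exists i.
Qed.

Lemma cg_plus_sum (I : Type) (s : seq I) (F : I -> A) :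
  (forall i, cg_plus (F i)) -> cg_plus (\sum_(i <- s) F i).
Proof. by move=> h; elim/big_ind: _ => //; [exact: cg_plus0|exact: cg_plusD]. Qed.

Lemma cg_decomp a : exists (s : seq nat) (f : nat -> A),
  (forall i, f i \in cg_piece A i) /\ a = \sum_(i <- s) f i.
Proof. by case: (cg_grading A) => _ h _; exact: h. Qed.

Lemma cg_plus_mull a x : cg_plus x -> cg_plus (a * x).
Proof.
move=> [s hs ->]; rewrite mulr_sumr big_seq.
elim/big_ind: _ => [||y /hs[j hy]]; [exact: cg_plus0|exact: cg_plusD|].
have [t [f [hf ->]]] := cg_decomp a; rewrite mulr_suml.
apply: cg_plus_sum => i; apply: (@cg_plus_hom (i + j)).
by rewrite -addnS; apply: cg_mul.
Qed.

Lemma cg_plus_mulr a x : cg_plus x -> cg_plus (x * a).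
Proof.
move=> [s hs ->]; rewrite mulr_suml big_seq.
elim/big_ind: _ => [||y /hs[j hy]]; [exact: cg_plus0|exact: cg_plusD|].
have [t [f [hf ->]]] := cg_decomp a; rewrite mulr_sumr.
apply: cg_plus_sum => i; apply: (@cg_plus_hom (j + i)).
by rewrite -addSn; apply: cg_mul.
Qed.

Lemma cg_plus_fun x : cg_plus x -> exists (n : nat) (f : nat -> A),
  (forall i, f i \in cg_piece A i.+1) /\ x = \sum_(i < n) f i.
Proof.
move=> [s hs ->]; elim: s hs => [|y s ih] hs.
  exists 0%N, (fun=> 0); split=> [i|]; first exact: cg_piece0.
  by rewrite big_nil big_ord0.
have [|n [f [hf e]]] := ih; first by move=> z hz; apply: hs; rewrite inE hz orbT.
have [j hj] := hs y (mem_head _ _).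
exists (maxn n j.+1).
exists (fun i => (if (i < n)%N then f i else 0) + (if i == j then y else 0)).
split=> [i|].
  apply: cg_pieceD; first by case: ifP => // _; exact: cg_piece0.
  by case: eqP => [->//|_]; exact: cg_piece0.
rewrite big_cons e addrC big_split /=; congr (_ + _).
  rewrite (big_ord_widen _ f (leq_maxl n j.+1)) big_mkcond /=.
  by apply: eq_bigr.
have ltj : (j < maxn n j.+1)%N by rewrite leq_max leqnn orbT.
rewrite (bigD1 (Ordinal ltj)) //= eqxx big1 ?addr0 // => i.
by rewrite -val_eqE /= => /negbTE->.
Qed.

Lemma cg_plus_scalar (c : k) : cg_plus (c%:A : A) -> c = 0.
Proof.
move=> /cg_plus_fun[n [f [hf e]]].
have [_ _ indep] := cg_grading A.
have hg i : (if i is j.+1 then f j else (- c)%:A) \in cg_piece A i.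
  by case: i => [|i] //; apply/cg_connected; exists (- c).
have /(_ _ 0%N) := indep (iota 0 n.+1) _ (iota_uniq _ _) hg.
rewrite /= big_cons -[1%N]addn0 iotaDl big_map /= -[n in iota 0 n]subn0.
rewrite -/(index_iota 0 n) big_mkord -e -scalerDl addNr scale0r.
move=> /(_ erefl (mem_head _ _)) /eqP.
by rewrite scaler_eq0 oner_eq0 orbF oppr_eq0 => /eqP.
Qed.

Lemma cg_augP a : cg_plus (a - (cg_aug a)%:A).
Proof.
apply: (@xgetPex _ 0 [set c | cg_plus (a - c%:A)]) => /=.
have [s [f [hf ->]]] := cg_decomp a.
elim: s => [|i s [c hc]].
  by exists 0; rewrite big_nil scale0r subr0; exact: cg_plus0.
rewrite big_cons; case: i => [|i].
  have [d hd] := (cg_connected (f 0)).1 (hf 0).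
  exists (d + c); rewrite hd scalerDl opprD addrACA subrr add0r.
  exact: hc.
by exists c; rewrite -addrA; apply: cg_plusD => //; apply: cg_plus_hom (hf _).
Qed.

Lemma cg_augE a (c : k) : cg_plus (a - c%:A) -> cg_aug a = c.
Proof.
move=> hc; apply/eqP; rewrite -subr_eq0; apply/eqP/cg_plus_scalar.
have := cg_plusD (cg_plus_mull (-1) (cg_augP a)) hc.
by rewrite mulN1r opprB addrA subrK -scalerBl.
Qed.

Lemma cg_aug1 : cg_aug 1 = 1.
Proof. by apply: cg_augE; rewrite scale1r subrr; exact: cg_plus0. Qed.

Lemma cg_augD : {morph cg_aug : a b / a + b}.
Proof.
move=> a b; apply: cg_augE; rewrite scalerDl opprD addrACA.
exact: cg_plusD (cg_augP _) (cg_augP _).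
Qed.

Lemma cg_augM : {morph cg_aug : a b / a * b}.
Proof.
move=> a b; apply: cg_augE.
have := cg_plusD (cg_plus_mulr b (cg_augP a))
                 (cg_plus_mull (cg_aug a)%:A (cg_augP b)).
by rewrite mulrBl mulrBr addrA subrK -scalerAl mul1r scalerA.
Qed.

End Augmentation.

(* The trivial module k = A / A_+, as a right and as a left module. *)
Definition trivR (k : fieldType) (A : cgAlgebra k) : Type := k.
Definition trivL (k : fieldType) (A : cgAlgebra k) : Type := k.

Section Trivial.
Variables (k : fieldType) (A : cgAlgebra k).

HB.instance Definition _ := GRing.Zmodule.on (trivR A).
HB.instance Definition _ := GRing.Zmodule.on (trivL A).

Definition trivR_scale (a : A^c) (x : trivR A) : trivR A := cg_aug (a : A) * (x : k).
Definition trivL_scale (a : A) (x : trivL A) : trivL A := cg_aug a * (x : k).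

Fact trivR_scaleA a b x : trivR_scale a (trivR_scale b x) = trivR_scale (a * b) x.
Proof.
rewrite /trivR_scale [a * b](erefl : _ = (b : A) * (a : A)) cg_augM.
by rewrite [cg_aug b * cg_aug a]mulrC mulrA.
Qed.

Fact trivR_scale1 : left_id 1 trivR_scale.
Proof. by move=> x; rewrite /trivR_scale cg_aug1 mul1r. Qed.

Fact trivR_scaleDr : right_distributive trivR_scale +%R.
Proof. by move=> a x y; rewrite /trivR_scale; exact: (mulrDr (cg_aug (a : A))). Qed.

Fact trivR_scaleDl x : {morph trivR_scale^~ x : a b / a + b}.
Proof. by move=> a b; rewrite /trivR_scale cg_augD mulrDl. Qed.

HB.instance Definition _ := GRing.Zmodule_isLmodule.Build A^c (trivR A)
  trivR_scaleA trivR_scale1 trivR_scaleDr trivR_scaleDl.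

Fact trivL_scaleA a b x : trivL_scale a (trivL_scale b x) = trivL_scale (a * b) x.
Proof. by rewrite /trivL_scale mulrA cg_augM. Qed.

Fact trivL_scale1 : left_id 1 trivL_scale.
Proof. by move=> x; rewrite /trivL_scale cg_aug1 mul1r. Qed.

Fact trivL_scaleDr : right_distributive trivL_scale +%R.
Proof. by move=> a x y; rewrite /trivL_scale; exact: (mulrDr (cg_aug a)). Qed.

Fact trivL_scaleDl x : {morph trivL_scale^~ x : a b / a + b}.
Proof. by move=> a b; rewrite /trivL_scale cg_augD mulrDl. Qed.

HB.instance Definition _ := GRing.Zmodule_isLmodule.Build A (trivL A)
  trivL_scaleA trivL_scale1 trivL_scaleDr trivL_scaleDl.

End Trivial.

Section FinitePresentation.

(* The two-sided ideal generated by r_1, ..., r_m. *)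
Definition ideal_gen (R : nzRingType) (m : nat) (r : 'I_m -> R) : set R :=
  [set x | exists s : seq (R * 'I_m * R),
    x = \sum_(t <- s) t.1.1 * r t.1.2 * t.2].

(* [{malg k[{fmonom 'I_n}]}] is the free associative algebra k<x_1, ..., x_n>. *)
Definition fp_algebra (k : fieldType) (A : algType k) : Prop :=
  exists (n m : nat) (r : 'I_m -> {malg k[{fmonom 'I_n}]})
         (phi : {lrmorphism {malg k[{fmonom 'I_n}]} -> A}),
    (forall a, exists p, a = phi p) /\
    (forall p, phi p = 0 <-> ideal_gen r p).

(* An exact sequence A^q -> A^p -> M -> 0. *)
Definition fp_module (k : fieldType) (A : algType k) (M : lmodType A^c) : Prop :=
  exists (p q : nat) (g : {linear 'rV[A^c]_p -> M})
         (h : {linear 'rV[A^c]_q -> 'rV[A^c]_p}),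
    (forall x, exists v, x = g v) /\
    (forall v, g v = 0 <-> exists w, v = h w).

End FinitePresentation.

Section Tor.
Variables (k : fieldType) (A : algType k).

Definition projective (P : lmodType A^c) : Prop :=
  forall (X Y : lmodType A^c) (g : {linear X -> Y}) (f : {linear P -> Y}),
    (forall y, exists x, y = g x) ->
    exists h : {linear P -> X}, forall p, g (h p) = f p.

Record proj_resolution (M : lmodType A^c) := ProjResolution {
  pr_mod : nat -> lmodType A^c;
  pr_diff : forall n, {linear pr_mod n.+1 -> pr_mod n};
  pr_eps : {linear pr_mod 0 -> M};
  pr_proj : forall n, projective (pr_mod n);
  pr_surj : forall x, exists p, x = pr_eps p;
  pr_exact0 : forall p, pr_eps p = 0 <-> exists q, p = pr_diff 0 q;
  pr_exact : forall n p, pr_diff n p = 0 <-> exists q, p = pr_diff n.+1 q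
}.

Definition balanced (P : lmodType A^c) (N : lmodType A) (W : lmodType k)
    (b : P -> N -> W) : Prop :=
  [/\ forall p p' x, b (p + p') x = b p x + b p' x,
      forall p x x', b p (x + x') = b p x + b p x',
      forall p (a : A) x, b ((a : A^c) *: p) x = b p (a *: x)
    & forall p (c : k) x, b p (c%:A *: x) = c *: b p x].

(* The tensor product of P and N over A, up to its universal property. *)
Record tensor_product (P : lmodType A^c) (N : lmodType A) := TensorProduct {
  tp_mod :> lmodType k;
  tp_map : P -> N -> tp_mod;
  tp_balanced : balanced tp_map;
  tp_exists : forall (W : lmodType k) (b : P -> N -> W), balanced b ->
    exists f : {linear tp_mod -> W}, forall p x, f (tp_map p x) = b p x;
  tp_unique : forall (W : lmodType k) (f g : {linear tp_mod -> W}),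
    (forall p x, f (tp_map p x) = g (tp_map p x)) -> f =1 g
}.

(* The complex obtained from a projective resolution of M by tensoring
   with N over A. *)
Record tor_complex (M : lmodType A^c) (N : lmodType A) := TorComplex {
  tc_res : proj_resolution M;
  tc_mod : forall n, tensor_product (pr_mod tc_res n) N;
  tc_diff : forall n, {linear tc_mod n.+1 -> tc_mod n};
  tc_diffE : forall n p x,
    tc_diff n (tp_map (tc_mod n.+1) p x) =
    tp_map (tc_mod n) (pr_diff tc_res n p) x
}.

Definition tc_cycle (M : lmodType A^c) (N : lmodType A) (C : tor_complex M N)
    (i : nat) : set (tc_mod C i) :=
  match i with
  | 0 => setT
  | j.+1 => [set z | tc_diff C j z = 0]
  end.

Definition tc_boundary (M : lmodType A^c) (N : lmodType A)
    (C : tor_complex M N) (i : nat) : set (tc_mod C i) :=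
  range (tc_diff C i).

(* dim_k Tor_i^A(M, N) is finite.  Up to isomorphism the homology does not
   depend on the resolution nor on the tensor products chosen, so quantifying
   over all choices is the same as making one. *)
Definition findim_Tor (i : nat) (M : lmodType A^c) (N : lmodType A) : Prop :=
  forall C : tor_complex M N, findim_quot (@tc_cycle M N C i) (@tc_boundary M N C i).

End Tor.

Section Hilbert.
Variables (k : fieldType) (A : cgAlgebra k) (M : grModule A).

Definition hilbert (n : int) : nat := dimk (gm_piece M n).

(* The sum of dim M_i over all integers i <= n is at most C n: every partial
   sum going down from n is. *)
Definition linear_growth : Prop :=
  exists C : nat, forall n : nat, (0 < n)%N -> forall m : nat,
    (\sum_(i < m) hilbert (n%:Z - i%:Z)%R <= C * n)%N.

Definition GKdim1 : Prop :=
  linear_growth /\ ~ (exists n, has_dim (predT : {pred restr M}) n).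

End Hilbert.

(* The power series sum_n f n z^n is the expansion of p / q. *)
Definition rational_series (f : nat -> nat) : Prop :=
  exists p q : {poly rat}, q != 0 /\
    forall n, \sum_(i < n.+1) q`_i * (f (n - i)%N)%:R = p`_n.

(* The Laurent series sum_n f n z^n is z^s times a rational power series. *)
Definition rational_Laurent (f : int -> nat) : Prop :=
  exists s : int, (forall n, n < s -> f n = 0%N) /\
    rational_series (fun n => f (s + n%:Z)).

Definition eventually_periodic (f : int -> nat) : Prop :=
  exists d N : nat, [/\ (0 < d)%N, (0 < N)%N &
    forall n : nat, (N <= n)%N -> f n%:Z = f (n + d)%:Z].

(* Main.v *)
(* Linear growth gives, for every d, infinitely many n such that the window
   M_n, ..., M_(n+d-1) has the same dimensions, bounded by a constant.  As A and
   M are finitely presented, Tor_1^A(k,k), Tor_2^A(k,k), Tor_0^A(M,k) and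
   Tor_1^A(M,k) live in finitely many degrees; hence for large d and n the
   truncation M_(>=n) is presented in degrees n, ..., n+d-1, and all dim M_(n+I)
   are determined by the structure constants p_n of the action of A_1, ..., A_d
   on the window: dim M_(n+I) is N - rank E_I(p_n), where the entries of the
   matrix E_I are polynomials in p_n and N is independent of n.  If k is finite,
   then p_n = p_m for some n < m, and dim M_(n+I) = dim M_(m+I) for all I.

   Under (b) also Tor_2 of M_(>=n) lives in the window, and dim M_(n+I) becomes
   in addition rank E'_I(p_n) plus a number determined by the dimensions in
   degrees less than n+I.  By Hilbert's basis theorem infinitely many p_n form
   an irreducible family.  By induction on I the sum rank E_I + rank E'_I is
   constant on this family; both ranks being lower semicontinuous, each of them
   is constant, and so is dim M_(n+I).

   Tor is handled dually: its vanishing in a degree says that every homogeneous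
   multilinear cocycle of that degree on the bar complex is a coboundary. *)

Require Import Defs.
From HB Require Import structures.
From mathcomp Require Import all_boot all_order all_algebra.
From mathcomp Require Import boolp classical_sets cardinality.
From mathcomp Require Import finmap monalg zify ring.

Set Implicit Arguments.
Unset Strict Implicit.
Unset Printing Implicit Defensive.

Import Order.TTheory GRing.Theory Num.Theory.
Local Open Scope classical_set_scope.
Local Open Scope ring_scope.

(** * Irreducible families of points *)

(** Neither finiteness hypothesis is graded: the relations of [A] may be inhomogeneous, its
    generators may have nonzero augmentation, and the resolutions defining Tor carry no degrees.
    What the argument needs is vanishing in single internal degrees. The bridge is that the
    obstruction of a cocycle lies in a fixed [k^N] (its values on N relations, or on N
    representatives of homology) and is linear in the cocycle, so that obstructed cocycles cannot
    occur in infinitely many degrees. A cocycle given in one degree is first extended by zero to all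
    degrees. The second formula for the dimension of M_(n+I), under (b), comes from an exact
    sequence: the dual of M_(n+I) injects into the dual of the sum of M_(n+i) (x) A_(I-i) over i <
    I, and the quotient is the space of window 2-cocycles of degree I, whose dimension is a number
    of unknowns minus rank E'_I. The middle term involves only degrees below n+I. So the dimension
    is a constant minus one rank and, given the lower degrees, a constant plus another rank; a
    single formula would bound it on one side only. Equal window dimensions put all p_n into one
    affine space and give all matrices E_I(p_n) the same size. *)

Section Noetherian.
Variable R : comNzRingType.

Definition is_ideal (J : set R) : Prop :=
  [/\ J 0, forall x y, J x -> J y -> J (x + y) & forall a x, J x -> J (a * x)].

(** An intersection of ideals: to prove something about a member it suffices to exhibit the desired
    property as an ideal containing [P], without writing linear combinations. *)
Definition ideal_hull (P : set R) : set R :=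
  [set x | forall J, is_ideal J -> P `<=` J -> J x].

Lemma ideal_hull_ideal P : is_ideal (ideal_hull P).
Proof.
split=> [J [] //|x y hx hy J hJ PJ|a x hx J hJ PJ].
  by have [_ hD _] := hJ; apply: hD; [exact: hx|exact: hy].
by have [_ _ hM] := hJ; apply: hM; exact: hx.
Qed.

Lemma ideal_hull_sub P : P `<=` ideal_hull P.
Proof. by move=> x Px J _; apply. Qed.

(** The ascending chain condition for initial segments of a sequence, in the form that applies
    directly to sequences produced by repeated choice. *)
Definition noetherian : Prop :=
  forall u : nat -> R, exists n, ideal_hull (u @` [set i | (i < n)%N]) (u n).

End Noetherian.

Lemma noetherian_field (k : fieldType) : noetherian k.
Proof.
move=> u; have [u0|u0] := eqVneq (u 0%N) 0.
  by exists 0%N; rewrite u0; case: (ideal_hull_ideal (u @` [set i | (i < 0)%N])).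
exists 1%N; rewrite -(divfK u0 (u 1%N)).
have [_ _ hM] := ideal_hull_ideal (u @` [set i | (i < 1)%N]).
by apply: hM; apply: ideal_hull_sub; exists 0%N.
Qed.

Section HilbertBasis.
Variable R : comNzRingType.
Hypothesis noethR : noetherian R.

(* Hilbert's argument: choose f_n of least degree outside the ideal of the
   previous ones; the leading coefficient of some f_n is the coefficient of the
   same degree of an element of that ideal, and subtracting it lowers the
   degree. *)
Lemma noetherian_poly : noetherian {poly R}.
Proof.
move=> u; apply: contrapT => /forallNP hu.
pose I : set {poly R} := [set p | exists n, ideal_hull (u @` [set i | (i < n)%N]) p].
have hI : is_ideal I.
  have mono m n p : (m <= n)%N -> ideal_hull (u @` [set i | (i < m)%N]) p ->
      ideal_hull (u @` [set i | (i < n)%N]) p.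
    move=> le hp J hJ PJ; apply: hp => // _ [i /= hi <-]; apply: PJ.
    by exists i => //=; exact: leq_trans le.
  split=> [|x y [m hx] [n hy]|a x [n hx]].
  - by exists 0%N; case: (ideal_hull_ideal (u @` [set i | (i < 0)%N])).
  - exists (maxn m n); have [_ hD _] := ideal_hull_ideal (u @` [set i | (i < maxn m n)%N]).
    by apply: hD; [apply: mono hx; exact: leq_maxl|apply: mono hy; exact: leq_maxr].
  - by exists n; have [_ _ hM] := ideal_hull_ideal (u @` [set i | (i < n)%N]); exact: hM.
have step (s : seq {poly R}) : (forall p, p \in s -> I p) -> exists f,
    [/\ I f, ~ ideal_hull [set p | p \in s] f
      & forall g, I g -> ~ ideal_hull [set p | p \in s] g -> (size f <= size g)%N].
  move=> sI.
  have [g [gI gs]] : exists g, I g /\ ~ ideal_hull [set p | p \in s] g.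
    (* Finitely many elements of [I] already lie in the ideal of some initial segment of [u]; the
       next term [u n] is then outside, by [hu]. *)
    have [n hn] : exists n, forall p, p \in s -> ideal_hull (u @` [set i | (i < n)%N]) p.
      elim: s sI => [|q s ih] sI; first by exists 0%N.
      have [|n hn] := ih; first by move=> p ps; apply: sI; rewrite inE ps orbT.
      have [m hm] := sI q (mem_head _ _).
      exists (maxn m n) => p; rewrite inE => /orP[/eqP->|ps] J hJ PJ.
        apply: hm => // _ [i /= hi <-]; apply: PJ; exists i => //=.
        by rewrite leq_max hi.
      apply: (hn p ps) => // _ [i /= hi <-]; apply: PJ; exists i => //=.
      by rewrite leq_max hi orbT.
    exists (u n); split.
      by exists n.+1; apply: ideal_hull_sub; exists n => /=.
    move=> hs; apply: (hu n); apply: hs => [|p ps]; first exact: ideal_hull_ideal.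
    exact: hn.
  pose P m := `[< exists f, [/\ I f, ~ ideal_hull [set p | p \in s] f & size f = m] >].
  have exP : exists m, P m by exists (size g); apply/asboolP; exists g.
  case: (ex_minnP exP) => m /asboolP[f [fI fs fm]] hm.
  exists f; split=> // h hI1 hs; rewrite fm; apply: hm.
  by apply/asboolP; exists h.
have /choice[F FP] (s : seq {poly R}) : exists f, (forall p, p \in s -> I p) ->
    [/\ I f, ~ ideal_hull [set p | p \in s] f
      & forall g, I g -> ~ ideal_hull [set p | p \in s] g -> (size f <= size g)%N].
  have [/step[f hf]|] := pselect (forall p, p \in s -> I p); first by exists f.
  by exists 0.
pose L := fix L (n : nat) : seq {poly R} := if n is m.+1 then rcons (L m) (F (L m)) else [::].
have LI n p : p \in L n -> I p.
  elim: n p => [|n ih] p //=; rewrite mem_rcons inE => /orP[/eqP->|]; last exact: ih.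
  by case: (FP _ ih).
pose f n := F (L n).
have fP n : [/\ I (f n), ~ ideal_hull [set p | p \in L n] (f n)
      & forall g, I g -> ~ ideal_hull [set p | p \in L n] g -> (size (f n) <= size g)%N].
  exact: FP (LI n).
have Lf i n : (i < n)%N -> f i \in L n.
  elim: n => // n ih; rewrite ltnS leq_eqVlt /= mem_rcons inE => /orP[/eqP->|/ih->].
    by rewrite eqxx.
  by rewrite orbT.
have Lf' n p : p \in L n -> exists2 i, (i < n)%N & p = f i.
  elim: n => //= n ih; rewrite mem_rcons inE => /orP[/eqP->|/ih[i hi ->]].
    by exists n.
  by exists i => //; exact: ltnW.
have fmono i n : (i < n)%N -> (size (f i) <= size (f n))%N.
  move=> hin; have [fI fs _] := fP n; have [_ _ hmin] := fP i; apply: hmin => // hs.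
  apply: fs; apply: hs => [|p /= /Lf'[j hj ->]]; first exact: ideal_hull_ideal.
  by apply: ideal_hull_sub; apply: Lf; exact: ltn_trans hin.
have [n hn] := noethR (fun i => lead_coef (f i)).
have [fI fs fmin] := fP n.
pose H := ideal_hull [set p | p \in L n].
have [H0 HD HM] : is_ideal H := ideal_hull_ideal _.
have fn0 : f n != 0 by apply/eqP => fn0; apply: fs; rewrite fn0.
have [g [gH gs gc]] : exists g, [/\ H g, (size g <= size (f n))%N
    & g`_(size (f n)).-1 = lead_coef (f n)].
  (* The hull containing [lead_coef (f n)] is tested on one ideal of [R]: the coefficients in the
     top position of [f n] of those elements of [H] that are not longer than [f n]. It contains the
     earlier leading coefficients after a shift by a power of ['X]. *)
  apply: (hn [set a | exists g, [/\ H g, (size g <= size (f n))%N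
    & g`_(size (f n)).-1 = a]]); first split=> /=.
  - by exists 0; rewrite size_poly0 coef0.
  - move=> x y [g [g1 g2 g3]] [h [h1 h2 h3]]; exists (g + h); split.
    + exact: HD.
    + by rewrite (leq_trans (size_polyD _ _)) // geq_max g2.
    + by rewrite coefD g3 h3.
  - move=> a x [g [g1 g2 g3]]; exists (a%:P * g); split.
    + exact: HM.
    + by rewrite mul_polyC (leq_trans (size_scale_leq _ _)).
    + by rewrite coefCM g3.
  - move=> _ [i /= hi <-]; have le := fmono i n hi.
    have fi0 : f i != 0.
      by have [_ hs _] := fP i; apply/eqP => e; apply: hs; rewrite e;
         case: (ideal_hull_ideal [set p | p \in L i]).
    exists ('X^(size (f n) - size (f i)) * f i); split.
    + by apply: HM; apply: ideal_hull_sub; exact: Lf.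
    + by rewrite mulrC (leq_trans (size_polyMleq _ _)) // size_polyXn addnS /= subnKC.
    + rewrite coefXnM ifF; last first.
        apply: negbTE; rewrite -leqNgt -subn1 leq_sub2l //.
        by rewrite lt0n size_poly_eq0.
      rewrite lead_coefE; congr _`_ _.
      move: le (polySpred fi0) (polySpred fn0); move: (size (f i)) (size (f n)) => a b; lia.
have gP : I (f n - g) /\ ~ H (f n - g).
  have [I0 ID IM] := hI; split.
    apply: ID => //; rewrite -mulN1r; apply: IM.
    apply: gH => // p /= /Lf'[i _ ->]; by have [] := fP i.
  by move=> h; apply: fs; rewrite -[f n](subrK g); exact: HD.
have := fmin _ gP.1 gP.2; apply/negP; rewrite -ltnNge.
rewrite (polySpred fn0) ltnS; apply/leq_sizeP => j hj.
rewrite coefB; move: hj; rewrite leq_eqVlt => /orP[/eqP<-|hj].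
  by rewrite gc lead_coefE subrr.
have hj' : (size (f n) <= j)%N by rewrite (polySpred fn0).
by rewrite !nth_default ?subrr // (leq_trans gs).
Qed.

End HilbertBasis.

(* R is the polynomial ring in L variables, and ev is evaluation at p. *)
Lemma noetherian_mpoly (k : fieldType) (L : nat) :
  exists (R : comNzRingType) (X : 'I_L -> R) (C : k -> R), noetherian R /\
    forall p : 'I_L -> k, exists ev : {rmorphism R -> k},
      (forall i, ev (X i) = p i) /\ (forall a, ev (C a) = a).
Proof.
elim: L => [|L [R [X [C [hR ih]]]]].
  exists k, (fun=> 0), id; split=> [|p]; first exact: noetherian_field.
  by exists idfun; split=> // -[].
exists {poly R}, (fun i => if unlift ord0 i is Some j then (X j)%:P else 'X),
  (fun a => (C a)%:P).
split=> [|p]; first exact: noetherian_poly.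
have [ev [evX evC]] := ih (fun j => p (lift ord0 j)).
have cfu : commr_rmorph ev (p ord0) by move=> x; exact: mulrC.
exists (horner_morph cfu); split=> [i|a].
  by case: unliftP => [j ->|->] /=; rewrite ?horner_morphC ?horner_morphX.
by rewrite /= horner_morphC.
Qed.

Definition unbounded (T : set nat) : Prop :=
  forall N, exists2 n, T n & (N <= n)%N.

Lemma unboundedU (T S1 S2 : set nat) :
  unbounded T -> T `<=` S1 `|` S2 -> unbounded (T `&` S1) \/ unbounded (T `&` S2).
Proof.
move=> hT sub; apply: contrapT => /not_orP[/existsNP[N1 h1] /existsNP[N2 h2]].
have [n Tn hn] := hT (maxn N1 N2).
case: (sub n Tn) => Sn; [apply: h1|apply: h2]; exists n => //;
  by rewrite (leq_trans _ hn) // ?leq_maxl ?leq_maxr.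
Qed.

Lemma unbounded_pigeonhole (T : set nat) (I : finType) (f : nat -> I) :
  unbounded T -> exists i, unbounded (T `&` [set n | f n = i]).
Proof.
move=> hT; suff H (s : seq I) S : unbounded S -> (forall n, S n -> f n \in s) ->
    exists i, unbounded (S `&` [set n | f n = i]).
  by apply: (H (enum I)) => // n _; rewrite mem_enum.
elim: s S => [|i s ih] S hS hs; first by have [n /hs] := hS 0%N.
have [|?|h] := @unboundedU S [set n | f n = i] [set n | f n \in s] hS.
- by move=> n /hs /=; rewrite inE => /orP[/eqP->|]; [left|right].
- by exists i.
have [|j hj] := ih _ h; first by move=> n [].
by exists j => N; have [n [[Sn _] /= fn] hn] := hj N; exists n.
Qed.

Section Irreducible.
Variables (k : fieldType) (R : comNzRingType) (ev : nat -> {rmorphism R -> k}).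

(** Every unbounded part of [T] is Zariski dense in the family. If [T] is unbounded and covered by
    two zero sets, one of them meets it unboundedly and so contains it. Indices rather than points
    are counted, so repeated points are harmless. *)
Definition irreducible_family (T : set nat) : Prop :=
  forall f, unbounded (T `&` [set n | ev n f = 0]) -> forall n, T n -> ev n f = 0.

(** Otherwise [T] can be cut down forever by polynomials [F (Q n)] that vanish at unboundedly many
    indices of [Q n] but not at all of them. No term of this sequence is in the ideal of the earlier
    ones. *)
Lemma irreducible_subfamily (T : set nat) : noetherian R -> unbounded T ->
  exists S, [/\ S `<=` T, unbounded S & irreducible_family S].
Proof.
move=> hR hT; apply: contrapT => /forallNP hS.
have step S : S `<=` T -> unbounded S -> exists f,
    unbounded (S `&` [set n | ev n f = 0]) /\ exists2 n, S n & ev n f <> 0.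
  move=> ST uS; apply: contrapT => /forallNP h; apply: (hS S); split=> // f uf n Sn.
  by apply: contrapT => ne; apply: (h f); split=> //; exists n.
have /choice[F FP] S : exists f, S `<=` T -> unbounded S ->
    unbounded (S `&` [set n | ev n f = 0]) /\ exists2 n, S n & ev n f <> 0.
  have [ST|] := pselect (S `<=` T); last by exists 0.
  have [uS|] := pselect (unbounded S); last by exists 0.
  by have [f hf] := step S ST uS; exists f.
pose Q := fix Q n := if n is m.+1 then Q m `&` [set i | ev i (F (Q m)) = 0] else T.
have QP n : Q n `<=` T /\ unbounded (Q n).
  elim: n => [|n [ih1 ih2]]; first by split.
  by have [] := FP _ ih1 ih2; split=> // i [/ih1].
have Qmono i n m : (i < n)%N -> Q n m -> ev m (F (Q i)) = 0.
  elim: n => // n ih; rewrite ltnS leq_eqVlt /= => /orP[/eqP->|/ih h] [q1 q2] //.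
  exact: h.
have [n hn] := hR (fun n => F (Q n)).
have [h1 h2] := QP n; have [_ [m Qm]] := FP _ h1 h2; apply.
(* The earlier polynomials all vanish at the point [m] of [Q n], so membership in their ideal would
   make [F (Q n)] vanish there too. *)
apply: (hn [set f | ev m f = 0]); first split=> /=.
- by rewrite rmorph0.
- by move=> x y hx hy; rewrite rmorphD hx hy addr0.
- by move=> a x hx; rewrite rmorphM hx mulr0.
- by move=> _ [i /= hi <-]; exact: Qmono Qm.
Qed.

Definition polynomial_mx (m n : nat) (E : nat -> 'M[k]_(m, n)) : Prop :=
  forall i j, exists f, forall t, E t i j = ev t f.

(** Lower semicontinuity of the rank: [f] is the determinant of a maximal minor that is invertible
    at [t], with rows and columns fixed. Wherever [f] is nonzero that minor is still invertible. *)
Lemma rank_minor (m n : nat) (E : nat -> 'M[k]_(m, n)) (t : nat) :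
  polynomial_mx E -> exists2 f, ev t f <> 0 &
    forall s, ev s f <> 0 -> (\rank (E t) <= \rank (E s))%N.
Proof.
move=> hE.
have /choice[D hD] i : exists D : 'I_n -> R, forall j s, E s i j = ev s (D j).
  by have /choice[D hD] := hE i; exists D.
pose B := \matrix_(i, j) D i j.
have EB s : E s = map_mx (ev s) B by apply/matrixP => i j; rewrite !mxE.
pose A := rowsub (maxrankfun (E t)) (E t).
have fA : row_full A^T by rewrite /row_full mxrank_tr; exact: maxrowsub_free (E t).
pose g := maxrankfun (E t); pose h := fullrankfun fA.
have mxE' s : mxsub g h (E s) = map_mx (ev s) (mxsub g h B).
  by rewrite map_mxsub; congr mxsub; exact: EB.
exists (\det (mxsub g h B)) => [|s].
  rewrite -det_map_mx -mxE'; have := fullrowsub_unit fA.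
  rewrite unitmxE -det_tr unitfE => /eqP; congr (\det _ <> 0).
  by apply/matrixP => i j; rewrite !mxE.
rewrite -det_map_mx -mxE' => /eqP; rewrite -unitfE -unitmxE => hu.
rewrite -(mxrank_unit hu) [mxsub _ _ _](_ : _ = rowsub g (colsub h (E s))); last first.
  by apply/matrixP => i j; rewrite !mxE.
rewrite rowsubE (leq_trans (mxrankM_maxr _ _)) // -mxrank_tr -[leqRHS]mxrank_tr.
rewrite [(colsub _ _)^T](_ : _ = rowsub h (E s)^T); last by apply/matrixP => i j; rewrite !mxE.
by rewrite rowsubE mxrankM_maxr.
Qed.

End Irreducible.

Section RankConstant.
Variables (k : fieldType) (R : comNzRingType) (ev : nat -> {rmorphism R -> k}).

(* Both ranks are lower semicontinuous, so their sum can only be constant on an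
   irreducible family if both are. *)
Lemma rank_constant (T : set nat) (m1 n1 m2 n2 : nat)
    (E1 : nat -> 'M[k]_(m1, n1)) (E2 : nat -> 'M[k]_(m2, n2)) :
  unbounded T -> irreducible_family ev T ->
  polynomial_mx ev E1 -> polynomial_mx ev E2 ->
  (forall s t, T s -> T t ->
     \rank (E1 s) + \rank (E2 s) = \rank (E1 t) + \rank (E2 t))%N ->
  forall s t, T s -> T t -> \rank (E1 s) = \rank (E1 t).
Proof.
move=> uT iT p1 p2 sum.
suff H s t : T s -> T t -> (\rank (E1 t) <= \rank (E1 s))%N.
  by move=> s t Ts Tt; apply/eqP; rewrite eqn_leq !H.
move=> Ts Tt; have [f ft hf] := rank_minor t p1; have [g gs hg] := rank_minor s p2.
(* At [u] both ranks are at least those of [E1 t] and [E2 s]. Since the sum at [u] equals the sum at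
   [s], rank [E1 u] is at most rank [E1 s]. *)
have [u [Tu fu gu]] : exists u, [/\ T u, ev u f <> 0 & ev u g <> 0].
  apply: contrapT => /forallNP h.
  have [||] := @unboundedU T [set n | ev n f = 0] [set n | ev n g = 0] uT.
  - move=> n Tn /=; have [|fn] := pselect (ev n f = 0); [by left|right].
    by apply: contrapT => gn; apply: (h n).
  - by move=> /iT/(_ t Tt).
  - by move=> /iT/(_ s Ts).
have := sum u s Tu Ts; have := hf u fu; have := hg u gu; lia.
Qed.

End RankConstant.

Lemma sum_enum_val (V : nmodType) (U : finType) (F : U -> V) :
  \sum_(i < #|U|) F (enum_val i) = \sum_u F u.
Proof. by rewrite -big_enum_val. Qed.

(** * Solution spaces and obstructions *)

Section LinearSystem.
Variables (k : fieldType) (U E : finType).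

(** Unknowns index the rows and equations the columns, so that the solutions form the left kernel
    [kermx]. *)
Definition system_mx (c : E -> U -> k) : 'M[k]_(#|U|, #|E|) :=
  \matrix_(i, j) c (enum_val j) (enum_val i).

Definition solution (c : E -> U -> k) (x : U -> k) : Prop :=
  forall e, \sum_u c e u * x u = 0.

End LinearSystem.

(* G is a linear map onto the solution space, with kernel freely spanned by F. *)
Lemma rank_solution (k : fieldType) (U E W : finType) (c : E -> U -> k)
    (G : W -> U -> k) (h : nat) (F : 'I_h -> W -> k) :
  (forall w, solution c (G w)) ->
  (forall x, solution c x -> exists y : W -> k, forall u, x u = \sum_w y w * G w u) ->
  (forall i u, \sum_w F i w * G w u = 0) ->
  (forall y, (forall u, \sum_w y w * G w u = 0) ->
     exists s : 'I_h -> k, forall w, y w = \sum_i s i * F i w) ->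
  (forall s : 'I_h -> k, (forall w, \sum_i s i * F i w = 0) -> forall i, s i = 0) ->
  (#|W| + \rank (system_mx c) = #|U| + h)%N.
Proof.
move=> Gs Gsurj FG Gker Ffree.
pose FM := \matrix_(i < h, j < #|W|) F i (enum_val j).
pose GM := \matrix_(i < #|W|, j < #|U|) G (enum_val i) (enum_val j).
have rF : \rank FM = h.
  apply/eqP; rewrite -/(row_free FM) -kermx_eq0; apply/rowV0P => v /sub_kermxP hv.
  apply/rowP => i; rewrite mxE; apply: (Ffree (v 0)) => w.
  have /rowP/(_ (enum_rank w)) := hv; rewrite !mxE => e; rewrite -[RHS]e.
  by apply: eq_bigr => j _; rewrite mxE enum_rankK.
have kG : (FM :=: kermx GM)%MS.
  apply/eqmxP/andP; split.
    apply/sub_kermxP/matrixP => i j; rewrite !mxE -[RHS](FG i (enum_val j)).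
    by rewrite -[RHS]sum_enum_val; apply: eq_bigr => l _; rewrite !mxE.
  apply/rV_subP => v /sub_kermxP hv.
  have [|s hs] := Gker (fun w => v 0 (enum_rank w)).
    move=> u; have /rowP/(_ (enum_rank u)) := hv; rewrite !mxE => e; rewrite -[RHS]e.
    rewrite -[LHS]sum_enum_val; apply: eq_bigr => j _.
    by rewrite mxE enum_rankK enum_valK.
  apply/submxP; exists (\row_i s i); apply/rowP => j.
  rewrite mxE -[j in LHS]enum_valK hs.
  by apply: eq_bigr => i _; rewrite !mxE.
have kC : (GM :=: kermx (system_mx c))%MS.
  apply/eqmxP/andP; split.
    apply/sub_kermxP/matrixP => i j; rewrite !mxE -[RHS](Gs (enum_val i) (enum_val j)).
    by rewrite -[RHS]sum_enum_val; apply: eq_bigr => l _; rewrite !mxE mulrC.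
  apply/rV_subP => v /sub_kermxP hv.
  have [|y hy] := Gsurj (fun w => v 0 (enum_rank w)).
    move=> e; have /rowP/(_ (enum_rank e)) := hv; rewrite !mxE => he; rewrite -[RHS]he.
    rewrite -[LHS]sum_enum_val; apply: eq_bigr => j _.
    by rewrite mxE enum_rankK enum_valK mulrC.
  apply/submxP; exists (\row_i y (enum_val i)); apply/rowP => j.
  rewrite mxE -[j in LHS]enum_valK hy -[LHS]sum_enum_val.
  by apply: eq_bigr => i _; rewrite !mxE.
(* The rank of [GM] is computed twice: from its kernel it is [#|W| - h], and as a kernel it has rank
   [#|U|] minus that of the system. *)
have := mxrank_ker GM; rewrite -kG rF; have := mxrank_ker (system_mx c); rewrite -kC.
have := rank_leq_row GM; have := rank_leq_row (system_mx c).
lia.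
Qed.

(** * Linear functionals on spaces of arbitrary dimension *)

Section Functionals.
Variable k : fieldType.

Definition lin (V : lmodType k) (f : V -> k) : Prop :=
  forall c x y, f (c *: x + y) = c * f x + f y.

Section Lin.
Variables (V : lmodType k) (f : V -> k).
Hypothesis hf : lin f.

Lemma linD x y : f (x + y) = f x + f y.
Proof. by rewrite -[x]scale1r hf mul1r scale1r. Qed.

Lemma lin0 : f 0 = 0.
Proof. by apply: (addrI (f 0)); rewrite -linD !addr0. Qed.

Lemma linZ c x : f (c *: x) = c * f x.
Proof. by rewrite -[c *: x]addr0 hf lin0 addr0. Qed.

Lemma linN x : f (- x) = - f x.
Proof. by rewrite -scaleN1r linZ mulN1r. Qed.

Lemma linB x y : f (x - y) = f x - f y.
Proof. by rewrite linD linN. Qed.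

Lemma lin_sum (I : Type) (s : seq I) (P : pred I) (F : I -> V) :
  f (\sum_(i <- s | P i) F i) = \sum_(i <- s | P i) f (F i).
Proof. by apply: (big_morph f linD lin0). Qed.

End Lin.

Lemma lin_cst0 (V : lmodType k) : lin (fun _ : V => 0).
Proof. by move=> c x y; rewrite mulr0 addr0. Qed.

Lemma lin_add (V : lmodType k) (f g : V -> k) : lin f -> lin g -> lin (fun x => f x + g x).
Proof. by move=> hf hg c x y; rewrite hf hg mulrDr addrACA. Qed.

Lemma lin_scale (V : lmodType k) (a : k) (f : V -> k) : lin f -> lin (fun x => a * f x).
Proof. by move=> hf c x y; rewrite hf mulrDr mulrCA. Qed.

Lemma lin_opp (V : lmodType k) (f : V -> k) : lin f -> lin (fun x => - f x).
Proof. by move=> hf c x y; rewrite hf opprD mulrN. Qed.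

Lemma lin_sub (V : lmodType k) (f g : V -> k) : lin f -> lin g -> lin (fun x => f x - g x).
Proof. by move=> hf hg; apply: lin_add => //; exact: lin_opp. Qed.

Lemma lin_big (V : lmodType k) (I : Type) (s : seq I) (P : pred I) (F : I -> V -> k) :
  (forall i, P i -> lin (F i)) -> lin (fun x => \sum_(i <- s | P i) F i x).
Proof.
move=> hF c x y; elim: s => [|i s ih]; first by rewrite !big_nil mulr0 addr0.
rewrite !big_cons; case: ifP => // Pi; rewrite ih hF //.
by rewrite mulrDr addrACA.
Qed.

(** On the image of [phi] the functional is forced; Zorn's lemma, applied to graphs of partial
    functionals, extends it to all of [W]. *)
Lemma lin_factor (V W : lmodType k) (phi : V -> W) (s : V -> k) :
  (forall c x y, phi (c *: x + y) = c *: phi x + phi y) -> lin s -> (forall v, phi v = 0 -> s v = 0) ->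
  exists2 g : W -> k, lin g & forall v, s v = g (phi v).
Proof.
move=> hphi hs ks.
have phi0 : phi 0 = 0 by have := hphi (-1) 0 0; rewrite scaler0 addr0 scaleN1r addNr.
pose G0 : set (W * k) := [set p | exists v, p = (phi v, s v)].
pose P : set (set (W * k)) := [set G | [/\ G !=set0 -> G0 `<=` G,
   (* The preceding clause is conditional because the union of the empty chain must also satisfy
      [P]. A maximal [A] is nonempty since [G0] itself satisfies [P]. *)
   forall c x y a b, G (x, a) -> G (y, b) -> G (c *: x + y, c * a + b)
 & forall a, G (0, a) -> a = 0]].
have PG0 : P G0.
  split=> [_ //|c x y a b [v [-> ->]] [w [-> ->]]|a [v [e ->]]]; last by rewrite ks.
  by exists (c *: v + w); rewrite hphi hs.
have [|A [[A1 A2 A3] Amax]] := @Zorn_bigcup _ P.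
  move=> F FP Ftot; split=> [[p [G FG Gp]] q G0q|c x y a b [G FG Gx] [H FH Hy]|a [G FG Ga]].
  - by exists G => //; have [h _ _] := FP G FG; apply: h => //; exists p.
  - have [GH|HG] := Ftot G H FG FH; [exists H|exists G] => //.
      by have [_ h _] := FP H FH; apply: h => //; exact: GH.
    by have [_ h _] := FP G FG; apply: h => //; exact: HG.
  - by have [_ _ h] := FP G FG; apply: h.
have A0 : G0 `<=` A.
  apply: A1; apply: contrapT => /set0P/negP/negPn/eqP A0.
  apply: (Amax G0 _ PG0); rewrite A0; split=> [p //|/(_ (0, 0))]; apply.
  by exists 0; rewrite phi0 lin0.
have A00 : A (0, 0) by apply: A0; exists 0; rewrite phi0 lin0.
have Atot x : exists a, A (x, a).
  apply: contrapT => /forallNP hx.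
  (* The extension takes the value 0 at [x]. It stays single-valued because [y + c *: x = 0] with
     [c] nonzero would put [x] in the domain of [A]. *)
  pose B : set (W * k) := [set p | exists y b c, A (y, b) /\ p = (y + c *: x, b)].
  have AB : A `<=` B by move=> [y b] Ay; exists y, b, 0; rewrite scale0r addr0.
  apply: (Amax B).
    split=> // /(_ (x, 0)) h; apply: (hx 0); apply: h.
    by exists 0, 0, 1; rewrite scale1r add0r.
  split=> [_ p /A0/AB //|c x1 y1 a1 b1 [y [b [d [Ay [-> ->]]]]] [z [b' [d' [Az [-> ->]]]]]|a].
    exists (c *: y + z), (c * b + b'), (c * d + d'); split; first exact: A2.
    by rewrite scalerDr scalerA scalerDl addrACA.
  move=> [y [b [c [Ay [e ->]]]]]; have [c0|c0] := eqVneq c 0.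
    by apply: A3; move: e; rewrite c0 scale0r addr0 => ->.
  exfalso; apply: (hx (- c^-1 * b + 0)).
  suff -> : x = - c^-1 *: y + 0 by apply: A2.
  have -> : y = - (c *: x) by apply/eqP; rewrite -addr_eq0 -e.
  by rewrite addr0 scalerN scaleNr opprK scalerA mulVf // scale1r.
have /choice[g hg] := Atot.
have uniq_val x a : A (x, a) -> g x = a.
  move=> Ax; apply/eqP; rewrite -subr_eq0; apply/eqP/A3.
  have := A2 (-1) _ _ _ _ Ax (hg x); rewrite scaleN1r mulN1r addNr addrC.
  by [].
exists g => [c x y|v]; first by apply: uniq_val; apply: A2.
by apply/esym/uniq_val/A0; exists v.
Qed.

Lemma dependent_family (N : nat) (o : 'I_N.+1 -> 'I_N -> k) :
  exists c : 'I_N.+1 -> k, (exists i, c i != 0) /\ forall l, \sum_i c i * o i l = 0.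
Proof.
pose A := \matrix_(i, l) o i l.
have /rowV0Pn[v /sub_kermxP hv nz] : kermx A != 0.
  rewrite -mxrank_eq0 mxrank_ker -lt0n subn_gt0 ltnS; exact: rank_leq_col.
exists (v 0); split.
  apply: contrapT => /forallNP h; move/eqP: nz; apply; apply/rowP => i; rewrite mxE.
  by apply/eqP/negPn/negP => e; apply: (h i).
move=> l; have /rowP/(_ l) := hv; rewrite !mxE => e; rewrite -[RHS]e.
by apply: eq_bigr => i _; rewrite mxE.
Qed.

(* A cocycle of degree j is a function vanishing on the arguments of every other
   degree; o is an obstruction in k^N to being a coboundary.  N + 1 cocycles of
   different degrees have a combination without obstruction, and each of them is
   a multiple of it in its own degree. *)
Lemma finitely_many_degrees (U : Type) (D : nat -> set U) (N : nat)
    (Z : set (U -> k)) (good : nat -> set (U -> k)) (o : (U -> k) -> 'I_N -> k) :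
  (forall n (f : 'I_n -> U -> k) c, (forall i, Z (f i)) ->
     Z (fun u => \sum_i c i * f i u) /\
     forall l, o (fun u => \sum_i c i * f i u) l = \sum_i c i * o (f i) l) ->
  (forall f j, Z f -> (forall l, o f l = 0) -> good j f) ->
  (forall j f g c, good j f -> (forall u, D j u -> g u = c * f u) -> good j g) ->
  exists j0, forall j f, (j0 <= j)%N -> Z f ->
    (forall i u, D i u -> i <> j -> f u = 0) -> good j f.
Proof.
move=> comb triv scal; apply: contrapT => /forallNP bad.
have {}bad j0 : exists j f, [/\ (j0 <= j)%N, Z f,
    forall i u, D i u -> i <> j -> f u = 0 & ~ good j f].
  apply: contrapT => h; apply: (bad j0) => j f hj Zf hf; apply: contrapT => ng.
  by apply: h; exists j, f.
have /choice[p hp] j0 : exists p, [/\ (j0 <= p.1)%N, Z p.2,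
    forall i u, D i u -> i <> p.1 -> p.2 u = 0 & ~ good p.1 p.2].
  by have [j [f h]] := bad j0; exists (j, f).
(* Each counterexample is sought beyond the degree of the previous one, so the chosen degrees are
   pairwise different. *)
pose q := fix q n := if n is m.+1 then (p (q m)).1.+1 else 0%N.
have qmono m n : (m < n)%N -> ((p (q m)).1 < (p (q n)).1)%N.
  have H i : (q i <= (p (q i)).1)%N by have [] := hp (q i).
  elim: n => // n ih; rewrite ltnS leq_eqVlt => /orP[/eqP->|/ih h].
    exact: (H n.+1).
  apply: leq_trans (H n.+1) => /=; exact: ltn_trans h _.
have qinj m n : (p (q m)).1 = (p (q n)).1 -> m = n.
  by move=> e; case: (ltngtP m n) => // /qmono; rewrite e ltnn.
pose f (i : 'I_N.+1) := (p (q i)).2.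
have [c [[i ci] hc]] := dependent_family (fun i => o (f i)).
have [Zf of_] := comb _ f c (fun i => let: And4 _ h _ _ := hp (q i) in h).
have [_ _ supp ng] := hp (q i); apply: ng.
apply: (scal _ (fun u => \sum_i c i * f i u) _ (c i)^-1).
  by apply: triv => // l; rewrite of_.
move=> u Du; rewrite (bigD1 i) //= big1 ?addr0 ?mulKf // => j ji.
have [_ _ h _] := hp (q j); rewrite /f (h _ _ Du) ?mulr0 // => e.
by move/eqP: ji; apply; apply/val_inj/qinj.
Qed.

End Functionals.

Lemma dep_choice (I : Type) (T : I -> Type) (P : forall i, T i -> Prop) :
  (forall i, exists x, P i x) -> exists f : forall i, T i, forall i, P i (f i).
Proof.
by move=> h; exists (fun i => projT1 (cid (h i))) => i; exact: projT2 (cid (h i)).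
Qed.

(** * Gradings and dimensions *)

Section Projections.
Variables (k : fieldType) (V : lmodType k) (I : eqType) (G : I -> {pred V}).
Hypothesis hG : grading G.

Lemma piece_sub i : submod_closed (G i).
Proof. by case: hG. Qed.

Lemma piece0 i : 0 \in G i.
Proof. by case: (piece_sub i). Qed.

Lemma pieceP i c x y : x \in G i -> y \in G i -> c *: x + y \in G i.
Proof. by case: (piece_sub i) => _ h hx hy; apply: h. Qed.

(** A normal form: the spanning clause of [grading] allows repeated indices, while here the list is
    duplicate-free and [f] vanishes off it, so [f] is unique. *)
Definition decomposition (v : V) (f : I -> V) : Prop :=
  (forall i, f i \in G i) /\ exists s : seq I,
    [/\ uniq s, forall i, i \notin s -> f i = 0 & v = \sum_(i <- s) f i].

Lemma sum_support (f : I -> V) (s t : seq I) : uniq s -> uniq t -> {subset s <= t} ->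
  (forall i, i \notin s -> f i = 0) -> \sum_(i <- t) f i = \sum_(i <- s) f i.
Proof.
move=> us ut st fs.
rewrite (bigID (fun i => i \in s)) /= [X in _ + X]big1 ?addr0 => [|i /fs //].
rewrite -big_filter; apply: perm_big; apply: uniq_perm; rewrite ?filter_uniq //.
move=> i; rewrite mem_filter; apply: andb_idr; exact: st.
Qed.

Lemma decomposition_lin c x y f g : decomposition x f -> decomposition y g ->
  decomposition (c *: x + y) (fun i => c *: f i + g i).
Proof.
move=> [hf [s [us fs ->]]] [hg [t [ut gt ->]]]; split=> [i|]; first exact: pieceP.
have sub1 : {subset s <= undup (s ++ t)} by move=> i h; rewrite mem_undup mem_cat h.
have sub2 : {subset t <= undup (s ++ t)}.
  by move=> i h; rewrite mem_undup mem_cat h orbT.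
exists (undup (s ++ t)); split=> [|i|]; first exact: undup_uniq.
  by rewrite mem_undup mem_cat negb_or => /andP[/fs-> /gt->]; rewrite scaler0 addr0.
rewrite big_split /= -scaler_sumr (sum_support _ _ sub1) ?undup_uniq //.
by rewrite (sum_support _ _ sub2) ?undup_uniq.
Qed.

Lemma decomposition_hom i v : v \in G i ->
  decomposition v (fun j => if j == i then v else 0).
Proof.
move=> hv; split=> [j|]; first by case: eqP => [->|_] //; exact: piece0.
exists [:: i]; split=> // [j|]; first by rewrite inE => /negbTE->.
by rewrite big_seq1 eqxx.
Qed.

Lemma decomposition0 : decomposition 0 (fun=> 0).
Proof. by split=> [i|]; [exact: piece0|exists [::]; rewrite big_nil]. Qed.

Lemma decomposition_ex v : exists f, decomposition v f.
Proof.
have [_ dec _] := hG; have [s [f [hf ->]]] := dec v.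
elim: s => [|i s [g hg]]; first by exists (fun=> 0); rewrite big_nil; exact: decomposition0.
exists (fun j => 1 *: (if j == i then f i else 0) + g j).
by rewrite big_cons -[f i]scale1r; apply: decomposition_lin => //; rewrite scale1r;
  exact: decomposition_hom.
Qed.

Lemma decomposition_uniq v f g : decomposition v f -> decomposition v g -> f =1 g.
Proof.
move=> hf hg; have := decomposition_lin (-1) hf hg; rewrite scaleN1r addNr.
move=> [h [s [us hs e]]] i; have [_ _ ind] := hG.
apply/eqP; rewrite -subr_eq0 -opprB oppr_eq0 addrC -scaleN1r; apply/eqP.
by have [si|/hs//] := boolP (i \in s); apply: (ind s _ us h (esym e)).
Qed.

Lemma projections : exists pr : I -> V -> V,
  [/\ forall v, decomposition v (pr^~ v),
      forall i c x y, pr i (c *: x + y) = c *: pr i x + pr i y,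
      forall i v, v \in G i -> pr i v = v
    & forall i j v, v \in G i -> j != i -> pr j v = 0].
Proof.
have /choice[p hp] := decomposition_ex.
exists (fun i v => p v i); split=> // [i c x y|i v hv|i j v hv ij].
- exact: (decomposition_uniq (hp _) (decomposition_lin c (hp x) (hp y)) i).
- by rewrite (decomposition_uniq (hp _) (decomposition_hom hv) i) eqxx.
- by rewrite (decomposition_uniq (hp _) (decomposition_hom hv) j) (negbTE ij).
Qed.

End Projections.

Section FiniteDimension.
Variables (k : fieldType) (V : lmodType k).

Lemma has_dim_intro (W : {pred V}) (n : nat) (e : 'I_n -> V) :
  (forall i, e i \in W) ->
  (forall v, v \in W -> exists c : 'I_n -> k, v = \sum_i c i *: e i) ->
  (forall c : 'I_n -> k, \sum_i c i *: e i = 0 -> forall i, c i = 0) ->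
  has_dim W n.
Proof.
move=> We sp fr; exists e => // v /sp[c ->]; exists [ffun i => c i]; split.
  by apply: eq_bigr => i _; rewrite ffunE.
move=> d hd; apply/ffunP => i; rewrite ffunE; apply/eqP; rewrite -subr_eq0; apply/eqP.
apply: (fr (fun i => c i - d i)).
by under eq_bigr do rewrite scalerBl; rewrite sumrB hd subrr.
Qed.

Lemma has_dim_basis (W : {pred V}) (n : nat) : submod_closed W -> has_dim W n ->
  exists e : 'I_n -> V, [/\ forall i, e i \in W,
    forall v, v \in W -> exists c : 'I_n -> k, v = \sum_i c i *: e i
  & forall c : 'I_n -> k, \sum_i c i *: e i = 0 -> forall i, c i = 0].
Proof.
move=> [W0 _] [e We he]; exists e; split=> // [v /he[c [-> _]]|c hc i]; first by exists c.
have [d [_ hd]] := he 0 W0.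
have <- : d i = 0.
  by rewrite (hd [ffun=> 0]) ?ffunE // big1 // => j _; rewrite ffunE scale0r.
rewrite (hd [ffun i => c i]) ?ffunE // -[LHS]hc.
by apply: eq_bigr => j _; rewrite ffunE.
Qed.

(** Induction on the number of spanning vectors. The part [W'] of [W] in the span of all but the
    first one has a basis; if [W] is larger, any vector of [W] outside [W'] has a nonzero first
    coefficient and completes that basis. *)
Lemma has_dim_span (N : nat) (e : 'I_N -> V) (W : {pred V}) : submod_closed W ->
  (forall w, w \in W -> exists c : 'I_N -> k, w = \sum_i c i *: e i) ->
  exists n, has_dim W n.
Proof.
elim: N e W => [|N ih] e W [W0 Wl] hW.
  exists 0%N; apply: (has_dim_intro (e := e)) => [[]|v /hW|c _ []] //.
pose e' i := e (lift ord0 i).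
pose W' : {pred V} := [pred w | (w \in W) && `[< exists c : 'I_N -> k, w = \sum_i c i *: e' i >]].
have W'P w : reflect (w \in W /\ exists c : 'I_N -> k, w = \sum_i c i *: e' i) (w \in W').
  by rewrite inE; apply: (iffP andP) => -[? /asboolP].
have subW' : submod_closed W'.
  split=> [|c x y /W'P[xW [cx ex]] /W'P[yW [cy ey]]]; apply/W'P; split=> //.
  - by exists (fun=> 0); rewrite big1 // => i _; rewrite scale0r.
  - exact: Wl.
  - exists (fun i => c * cx i + cy i); rewrite ex ey scaler_sumr -big_split /=.
    by apply: eq_bigr => i _; rewrite scalerA scalerDl.
have [|n hn] := ih e' W' subW'; first by move=> w /W'P[_].
have [b [bW' bsp bfr]] := has_dim_basis subW' hn.
have [sub|] := pselect (forall w, w \in W -> w \in W').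
  exists n; apply: (has_dim_intro (e := b)) => // [i|v /sub]; last exact: bsp.
  by have /W'P[] := bW' i.
move=> /existsNP[w /not_implyP[wW wW']].
have [c wc] := hW w wW.
have c0 : c ord0 != 0.
  apply/eqP => c0; apply: wW'; apply/W'P; split=> //; exists (fun i => c (lift ord0 i)).
  by rewrite wc big_ord_recl c0 scale0r add0r.
pose b' (i : 'I_n.+1) := if unlift ord0 i is Some j then b j else w.
have sum_b' (d : 'I_n.+1 -> k) :
    \sum_i d i *: b' i = d ord0 *: w + \sum_i d (lift ord0 i) *: b i.
  rewrite big_ord_recl /b' unlift_none; congr (_ + _).
  by apply: eq_bigr => i _; rewrite liftK.
exists n.+1; apply: (has_dim_intro (e := b')) => [i|v vW|d].
- by rewrite /b'; case: unliftP => [j _|_] //; have /W'P[] := bW' j.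
- have [d vd] := hW v vW; pose t := d ord0 / c ord0.
  have /bsp[f hf] : - t *: w + v \in W'.
    apply/W'P; split; first exact: Wl.
    exists (fun i => - t * c (lift ord0 i) + d (lift ord0 i)).
    rewrite wc vd !big_ord_recl scalerDr addrACA scalerA -scalerDl.
    rewrite /t mulNr divfK // addNr scale0r add0r scaler_sumr -big_split /=.
    by apply: eq_bigr => i _; rewrite scalerA scalerDl.
  exists (fun i => if unlift ord0 i is Some j then f j else t).
  rewrite sum_b' unlift_none; under eq_bigr do rewrite liftK.
  by rewrite -hf scaleNr addNKr.
- rewrite sum_b' => hd.
  have d0 : d ord0 = 0.
    apply/eqP/negPn/negP => d0; apply: wW'.
    have -> : w = - (d ord0)^-1 *: (\sum_i d (lift ord0 i) *: b i) + 0.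
      have -> : \sum_i d (lift ord0 i) *: b i = - (d ord0 *: w).
        by apply/eqP; rewrite -addr_eq0 addrC hd.
      by rewrite addr0 scalerN scaleNr opprK scalerA mulVf // scale1r.
    have [W'0 W'l] := subW'; apply: (W'l) => //.
    elim/big_ind: _ => // [x y hx hy|i _]; first by rewrite -[x]scale1r; exact: W'l.
    by rewrite -[_ *: _]addr0; exact: W'l.
  move: hd; rewrite d0 scale0r add0r => /bfr hd i.
  by have [j|] := unliftP ord0 i => ->.
Qed.

(** The vectors [e] need not lie in [W], which lets the property pass through sums and images;
    [spanned_has_dim] turns it back into a dimension. *)
Definition spanned (W : {pred V}) : Prop := exists (J : finType) (e : J -> V),
  forall w, w \in W -> exists c : J -> k, w = \sum_i c i *: e i.

Lemma spanned_has_dim (W : {pred V}) : submod_closed W -> spanned W ->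
  exists n, has_dim W n.
Proof.
move=> hW [J [e he]]; apply: (has_dim_span (e := fun i : 'I_#|J| => e (enum_val i)) hW).
move=> w /he[c ->]; exists (fun i => c (enum_val i)).
by rewrite -(sum_enum_val (fun i => c i *: e i)).
Qed.

Lemma has_dim_spanned (W : {pred V}) (n : nat) : has_dim W n -> spanned W.
Proof. by move=> [e _ he]; exists 'I_n, e => w /he[c [-> _]]; exists c. Qed.

Lemma spanned_sum (J : finType) (W : {pred V}) (U : J -> {pred V}) :
  (forall j, spanned (U j)) ->
  (forall w, w \in W -> exists u : J -> V, (forall j, u j \in U j) /\ w = \sum_j u j) ->
  spanned W.
Proof.
move=> hU hW.
have /choice[p hp] j : exists p : {N : finType & N -> V},
    forall w, w \in U j -> exists c, w = \sum_i c i *: projT2 p i.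
  by have [N [e he]] := hU j; exists (existT _ N e).
exists {j : J & projT1 (p j)}, (fun s => projT2 (p (tag s)) (tagged s)) => w.
move=> /hW[u [hu ->]].
have /dep_choice[c hc] j : exists c : projT1 (p j) -> k, u j = \sum_i c i *: projT2 (p j) i.
  by apply: hp.
exists (fun s => c (tag s) (tagged s)).
under eq_bigr do rewrite hc.
exact: sig_big_dep.
Qed.

End FiniteDimension.

Lemma spanned_image (k : fieldType) (V W : lmodType k) (U : {pred V}) (U' : {pred W})
    (phi : V -> W) : (forall c x y, phi (c *: x + y) = c *: phi x + phi y) -> spanned U ->
  (forall w, w \in U' -> exists2 u, u \in U & w = phi u) -> spanned U'.
Proof.
move=> hphi [J [e he]] hU; exists J, (fun j => phi (e j)) => w /hU[u /he[c ->] ->].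
have phi0 : phi 0 = 0 by have := hphi (-1) 0 0; rewrite scaler0 addr0 scaleN1r addNr.
exists c; elim/big_rec2: _ => [|j x y _ <-]; last exact: hphi.
exact: phi0.
Qed.

Section GradedBasis.
Variables (k : fieldType) (V : lmodType k) (G : nat -> {pred V}).

(** The coordinates [gc] are functionals on the whole space, zero on the other degrees, so cochains
    can be written as global formulas without restricting to pieces. *)
Record graded_basis := GradedBasis {
  gdim : nat -> nat;
  gb : forall i, 'I_(gdim i) -> V;
  gc : forall i, 'I_(gdim i) -> V -> k;
  gb_in : forall i r, @gb i r \in G i;
  gc_lin : forall i r, lin (@gc i r);
  gcE : forall i v, v \in G i -> v = \sum_r @gc i r v *: @gb i r;
  gc_ne : forall i j r v, v \in G j -> j <> i -> @gc i r v = 0;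
  gc_gb : forall i r s, @gc i r (@gb i s) = (r == s)%:R
}.
Arguments gb : clear implicits.
Arguments gc : clear implicits.

Lemma graded_basis_ex (h : nat -> nat) : grading G -> (forall i, has_dim (G i) (h i)) ->
  exists B : graded_basis, gdim B = h.
Proof.
move=> hG hh.
have [pr [pr_dec pr_lin pr_id pr_ne]] := projections hG.
have /dep_choice[b hb] i : exists b : 'I_(h i) -> V, [/\ forall r, b r \in G i,
    forall v, v \in G i -> exists c : 'I_(h i) -> k, v = \sum_r c r *: b r
  & forall c : 'I_(h i) -> k, \sum_r c r *: b r = 0 -> forall r, c r = 0].
  exact: has_dim_basis (piece_sub hG i) (hh i).
have /dep_choice[c hc] i : exists c : V -> 'I_(h i) -> k,
    forall v, pr i v = \sum_r c v r *: b i r.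
  have /choice[c hc] v : exists c : 'I_(h i) -> k, pr i v = \sum_r c r *: b i r.
    by have [_ + _] := hb i; apply; have [] := pr_dec v.
  by exists c.
have fr i (x y : 'I_(h i) -> k) : \sum_r x r *: b i r = \sum_r y r *: b i r -> x =1 y.
  move=> e r; apply/eqP; rewrite -subr_eq0; apply/eqP.
  have [_ _ /(_ (fun r => x r - y r))] := hb i; apply.
  by under eq_bigr do rewrite scalerBl; rewrite sumrB e subrr.
have bi i : forall r, b i r \in G i by have [] := hb i.
unshelve eexists (@GradedBasis h b (fun i r v => c i v r) _ _ _ _ _) => //.
- move=> i r a x y.
  apply: (fr i (c i (a *: x + y)) (fun r => a * c i x r + c i y r)).
  rewrite -hc pr_lin !hc scaler_sumr -big_split /=.
  by apply: eq_bigr => s _; rewrite scalerA scalerDl.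
- by move=> i v hv; rewrite -hc pr_id.
- move=> i j r v hv ij; apply: (fr i (c i v) (fun=> 0)).
  rewrite -hc (pr_ne j) //; last by apply/eqP => e; apply: ij.
  by rewrite big1 // => s _; rewrite scale0r.
- move=> i r s; apply: (fr i (c i (b i s)) (fun r => (r == s)%:R)).
  rewrite -hc pr_id // (bigD1 s) //= eqxx scale1r big1 ?addr0 // => t /negbTE->.
  by rewrite scale0r.
Qed.

Variable B : graded_basis.

Lemma lin_gcE (f : V -> k) i v : lin f -> v \in G i ->
  f v = \sum_r gc B i r v * f (gb B i r).
Proof.
move=> hf /(gcE B) {1}->; rewrite lin_sum //.
by apply: eq_bigr => r _; rewrite linZ.
Qed.

Definition gpr i v := \sum_r gc B i r v *: gb B i r.

Lemma gpr_id i v : v \in G i -> gpr i v = v.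
Proof. by move=> hv; apply/esym; exact: gcE. Qed.

Lemma gpr_ne i j v : v \in G j -> j <> i -> gpr i v = 0.
Proof. by move=> hv ij; rewrite /gpr big1 // => r _; rewrite (gc_ne _ hv ij) ?scale0r. Qed.

Lemma gpr_linear i c x y : gpr i (c *: x + y) = c *: gpr i x + gpr i y.
Proof.
rewrite /gpr scaler_sumr -big_split /=; apply: eq_bigr => r _.
by rewrite gc_lin scalerDl scalerA.
Qed.

Lemma lin_gpr (f : V -> k) i : lin f -> lin (fun v => f (gpr i v)).
Proof. by move=> hf c x y; rewrite gpr_linear hf. Qed.

End GradedBasis.

Arguments gb {k V G} _ i r.
Arguments gc {k V G} _ i r v.

(** * Cocycles of the bar complex and truncations *)

Section Multilinear.
Variable k : fieldType.
Implicit Types X Y Z : lmodType k.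

Definition bilin X Y (f : X -> Y -> k) : Prop :=
  (forall y, lin (fun x => f x y)) /\ (forall x, lin (f x)).

Definition trilin X Y Z (f : X -> Y -> Z -> k) : Prop :=
  [/\ forall y z, lin (fun x => f x y z), forall x z, lin (fun y => f x y z)
    & forall x y, lin (f x y)].

Lemma lin_mulr X (f : X -> k) a : lin f -> lin (fun x => f x * a).
Proof. by move=> hf c x y; rewrite hf mulrDl mulrA. Qed.

End Multilinear.

Section AlgebraExactness.
Variables (k : fieldType) (A : cgAlgebra k).
Local Notation "'P_ i" := (cg_piece A i) (at level 8, i at level 2, format "''P_' i").

Lemma lin_mulAl (f : A -> k) a : lin f -> lin (fun x => f (a * x)).
Proof. by move=> hf c x y; rewrite mulrDr -scalerAr hf. Qed.

Lemma lin_mulAr (f : A -> k) a : lin f -> lin (fun x => f (x * a)).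
Proof. by move=> hf c x y; rewrite mulrDl -scalerAl hf. Qed.

(* [alg_exact p t]: in internal degree t, Tor_p^A(k,k) vanishes; it is stated
   on cochains of the bar complex of A_+. *)
Definition alg_exact1 (t : nat) : Prop := forall f : A -> k, lin f ->
  (forall i j a b, (0 < i)%N -> (0 < j)%N -> (i + j)%N = t ->
     a \in 'P_i -> b \in 'P_j -> f (a * b) = 0) ->
  forall a, a \in 'P_t -> f a = 0.

Definition alg_exact2 (t : nat) : Prop := forall f : A -> A -> k, bilin f ->
  (forall i j l a b c, (0 < i)%N -> (0 < j)%N -> (0 < l)%N -> (i + j + l)%N = t ->
     a \in 'P_i -> b \in 'P_j -> c \in 'P_l -> f (a * b) c = f a (b * c)) ->
  exists2 g : A -> k, lin g & forall i j a b, (0 < i)%N -> (0 < j)%N ->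
    (i + j)%N = t -> a \in 'P_i -> b \in 'P_j -> f a b = g (a * b).

Definition alg_exact3 (t : nat) : Prop := forall f : A -> A -> A -> k, trilin f ->
  (forall i j l m a b c d, (0 < i)%N -> (0 < j)%N -> (0 < l)%N -> (0 < m)%N ->
     (i + j + l + m)%N = t ->
     a \in 'P_i -> b \in 'P_j -> c \in 'P_l -> d \in 'P_m ->
     f (a * b) c d - f a (b * c) d + f a b (c * d) = 0) ->
  exists2 g : A -> A -> k, bilin g & forall i j l a b c,
    (0 < i)%N -> (0 < j)%N -> (0 < l)%N -> (i + j + l)%N = t ->
    a \in 'P_i -> b \in 'P_j -> c \in 'P_l -> f a b c = g (a * b) c - g a (b * c).

(** Common interface for [A] acting on itself and for a module over [A], with degrees shifted to
    start at 0. *)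
Record graded_action := GradedAction {
  ga_sort :> lmodType k;
  ga_piece : nat -> {pred ga_sort};
  act : ga_sort -> A -> ga_sort;
  actl : forall a c x y, act (c *: x + y) a = c *: act x a + act y a;
  actr : forall x c a b, act x (c *: a + b) = c *: act x a + act x b;
  actM : forall x a b, act (act x a) b = act x (a * b);
  act_in : forall i j x a, x \in ga_piece i -> a \in 'P_j -> act x a \in ga_piece (i + j)%N
}.

Section ModuleExactness.
Variable V : graded_action.
Local Notation G := (@ga_piece V).
Variables (BV : graded_basis G) (BA : graded_basis (cg_piece A)).

Lemma lin_actl (f : V -> k) a : lin f -> lin (fun x => f (act x a)).
Proof. by move=> hf c x y; rewrite actl hf. Qed.

Lemma lin_actr (f : V -> k) x : lin f -> lin (fun a => f (act x a)).
Proof. by move=> hf c a b; rewrite actr hf. Qed.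

(* [mod_exact p n j]: the same for Tor_p of the truncation of the module to
   degrees at least n, in internal degree j. *)
Definition mod_exact0 (n j : nat) : Prop := forall s : V -> k, lin s ->
  (forall i u m a, (n <= i)%N -> (0 < u)%N -> (i + u)%N = j ->
     m \in G i -> a \in 'P_u -> s (act m a) = 0) ->
  forall m, m \in G j -> s m = 0.

Definition mod_exact1 (n j : nat) : Prop := forall f : V -> A -> k, bilin f ->
  (forall i u w m a b, (n <= i)%N -> (0 < u)%N -> (0 < w)%N -> (i + u + w)%N = j ->
     m \in G i -> a \in 'P_u -> b \in 'P_w -> f (act m a) b = f m (a * b)) ->
  exists2 s : V -> k, lin s & forall i u m a, (n <= i)%N -> (0 < u)%N ->
    (i + u)%N = j -> m \in G i -> a \in 'P_u -> f m a = s (act m a).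

Definition mod_exact2 (n j : nat) : Prop := forall f : V -> A -> A -> k, trilin f ->
  (forall i u w z m a b c, (n <= i)%N -> (0 < u)%N -> (0 < w)%N -> (0 < z)%N ->
     (i + u + w + z)%N = j ->
     m \in G i -> a \in 'P_u -> b \in 'P_w -> c \in 'P_z ->
     f (act m a) b c - f m (a * b) c + f m a (b * c) = 0) ->
  exists2 g : V -> A -> k, bilin g & forall i u w m a b, (n <= i)%N ->
    (0 < u)%N -> (0 < w)%N -> (i + u + w)%N = j ->
    m \in G i -> a \in 'P_u -> b \in 'P_w -> f m a b = g (act m a) b - g m (a * b).

(* Passing from the truncation at n to the one at n + 1 only involves
   M_n (x) Tor_{p+1}(k,k): a cocycle on the smaller module extends to the
   larger one. *)
Lemma truncate0 n j : (n <= j)%N -> alg_exact1 (j - n) ->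
  mod_exact0 n j -> mod_exact0 n.+1 j.
Proof.
move=> nj hT hM s hs cs; apply: hM => // i u m a hi hu e mi au.
move: hi; rewrite leq_eqVlt => /orP[/eqP ni|]; last by move=> hi; exact: (cs i u).
rewrite -ni in e mi; apply: (hT (fun a => s (act m a))); first exact: lin_actr.
  move=> i' j' b c hi' hj' e' bi cj; rewrite -actM.
  by apply: (cs (n + i')%N j') => //; [lia|lia|exact: act_in].
by have <- : u = (j - n)%N by lia.
Qed.

Lemma truncate1 n j : (n <= j)%N -> alg_exact2 (j - n) ->
  mod_exact1 n j -> mod_exact1 n.+1 j.
Proof.
move=> nj hT hM f [fl fr] cf.
have /choice[g hg] r : exists g : A -> k, lin g /\ forall i l a b, (0 < i)%N -> (0 < l)%N ->
    (i + l)%N = (j - n)%N -> a \in 'P_i -> b \in 'P_l -> f (act (gb BV n r) a) b = g (a * b).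
  have [||g gl hg] := hT (fun a b => f (act (gb BV n r) a) b).
  - split=> [b|a]; last exact: fr.
    by apply: (lin_actr _ (f := fun x => f x b)).
  - move=> i i' l a b c hi hi' hl e ai bi' cl; rewrite -actM.
    by apply: (cf (n + i)%N i' l) => //; [lia|lia|apply: act_in => //; exact: gb_in].
  by exists g.
(* [f] is overwritten in module degree [n]: the value at the basis vector m_r becomes [g r], which
   is what the cocycle identity at (m_r, a, b) demands, as f (m_r a) b = g_r (a b). *)
pose f' m b := f m b - f (gpr BV n m) b + \sum_r gc BV n r m * g r b.
have f'E i m b : i <> n -> m \in G i -> f' m b = f m b.
  move=> ni mi; rewrite /f' (gpr_ne _ mi) // (lin0 (fl b)) subr0.
  by rewrite big1 ?addr0 // => r _; rewrite (gc_ne _ mi) // mul0r.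
have f'n m b : m \in G n -> f' m b = \sum_r gc BV n r m * g r b.
  by move=> mn; rewrite /f' gpr_id // subrr add0r.
have [||s sl hs] := hM f'.
- split=> [b|m].
    apply: lin_add; first by apply: lin_sub => //; exact: (lin_gpr BV n (fl b)).
    by apply: lin_big => r _; apply: lin_mulr; exact: gc_lin.
  apply: lin_add; first exact: lin_sub.
  by apply: lin_big => r _; apply: lin_scale; case: (hg r).
- move=> i u w m a b hi hu hw e mi au bw.
  rewrite (f'E (i + u)%N); [|lia|exact: act_in].
  move: hi; rewrite leq_eqVlt => /orP[/eqP ni|]; last first.
    by move=> hi; rewrite (f'E i) //; [exact: (cf i u w)|lia].
  rewrite -ni in e mi; rewrite f'n //.
  rewrite (lin_gcE BV (lin_actl a (fl b)) mi); apply: eq_bigr => r _; congr (_ * _).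
  by have [_ h] := hg r; apply: (h u w) => //; lia.
- exists s => // i u m a hi hu e mi au; rewrite -(hs i u) //; last exact: ltnW.
  by rewrite (f'E i) //; lia.
Qed.

Lemma truncate2 n j : (n <= j)%N -> alg_exact3 (j - n) ->
  mod_exact2 n j -> mod_exact2 n.+1 j.
Proof.
move=> nj hT hM f [f1 f2 f3] cf.
have /choice[g hg] r : exists g : A -> A -> k, bilin g /\ forall i l o a b c,
    (0 < i)%N -> (0 < l)%N -> (0 < o)%N -> (i + l + o)%N = (j - n)%N ->
    a \in 'P_i -> b \in 'P_l -> c \in 'P_o ->
    f (act (gb BV n r) a) b c = g (a * b) c - g a (b * c).
  have [||g gl hg] := hT (fun a b c => f (act (gb BV n r) a) b c).
  - split=> [b c|a c|a b]; [|exact: f2|exact: f3].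
    by apply: (lin_actr _ (f := fun x => f x b c)).
  - move=> i i' l o a b c d hi hi' hl ho e ai bi' cl dO; rewrite -actM.
    by apply: (cf (n + i)%N i' l o) => //; [lia|lia|apply: act_in => //; exact: gb_in].
  by exists g.
(* In degree [n] the new values are the primitives [g r]; the cocycle identity there is the equation
   f (m_r a) b c = g_r (a b) c - g_r a (b c). *)
pose f' m b c := f m b c - f (gpr BV n m) b c + \sum_r gc BV n r m * g r b c.
have f'E i m b c : i <> n -> m \in G i -> f' m b c = f m b c.
  move=> ni mi; rewrite /f' (gpr_ne _ mi) // (lin0 (f1 b c)) subr0.
  by rewrite big1 ?addr0 // => r _; rewrite (gc_ne _ mi) // mul0r.
have f'n m b c : m \in G n -> f' m b c = \sum_r gc BV n r m * g r b c.
  by move=> mn; rewrite /f' gpr_id // subrr add0r.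
have [||s sl hs] := hM f'.
- split=> [b c|m c|m b].
  + apply: lin_add; first by apply: lin_sub => //; exact: (lin_gpr BV n (f1 b c)).
    by apply: lin_big => r _; apply: lin_mulr; exact: gc_lin.
  + apply: lin_add; first exact: lin_sub.
    by apply: lin_big => r _; apply: lin_scale; case: (hg r) => -[].
  + apply: lin_add; first exact: lin_sub.
    by apply: lin_big => r _; apply: lin_scale; case: (hg r) => -[].
- move=> i u w z m a b c hi hu hw hz e mi au bw cz.
  rewrite (f'E (i + u)%N); [|lia|exact: act_in].
  move: hi; rewrite leq_eqVlt => /orP[/eqP ni|]; last first.
    by move=> hi; rewrite !(f'E i) //; [exact: (cf i u w z)|lia|lia].
  rewrite -ni in e mi; rewrite !f'n //.
  rewrite (lin_gcE BV (lin_actl a (f1 b c)) mi) -sumrB -big_split big1 //= => r _.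
  have [_ h] := hg r; rewrite (h u w z) //; last lia.
  by rewrite mulrBr; ring.
- exists s => // i u w m a b hi hu hw e mi au bw.
  by rewrite -(hs i u w) //; [rewrite (f'E i) //; lia|exact: ltnW].
Qed.

(** The bound [n + d <= j] keeps [j - i >= d] for every truncation degree [i] passed on the way from
    0 to [n]. *)
Lemma truncate (P : nat -> nat -> Prop) (Q : nat -> Prop) (d n j : nat) :
  (forall n j, (n <= j)%N -> Q (j - n)%N -> P n j -> P n.+1 j) ->
  (forall t, (d <= t)%N -> Q t) -> P 0%N j -> (n + d <= j)%N -> P n j.
Proof.
move=> step hQ P0; elim: n => // n ih h; apply: step; [lia|apply: hQ; lia|apply: ih; lia].
Qed.

(** * From the window to the whole truncation *)

Section Window.
Variables (n d : nat).
Hypothesis ex0 : forall j, (n + d <= j)%N -> mod_exact0 n j.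

(** By [ex0] it suffices to treat products [act m a]. If [m] is beyond the window, the induction
    applies to the functional [x |-> s (act x a)] in the smaller degree of [m]. *)
Lemma window_generates I (s : V -> k) : (d <= I)%N -> lin s ->
  (forall i u v a, (i < d)%N -> (0 < u)%N -> (i + u)%N = I ->
     v \in G (n + i) -> a \in 'P_u -> s (act v a) = 0) ->
  forall m, m \in G (n + I) -> s m = 0.
Proof.
elim/ltn_ind: I s => I ih s dI hs cs.
apply: (ex0 _ hs); first lia.
move=> i u m a hi hu e mi au; have [h|h] := ltnP (i - n) d.
  by apply: (cs (i - n)%N u) => //; [lia|rewrite subnKC].
have mi' : m \in G (n + (i - n)) by rewrite subnKC.
apply: (ih (i - n)%N _ (fun x => s (act x a))) mi' => //; [lia|exact: lin_actl|].
move=> i' u' v b hi' hu' e' vi bu; rewrite actM.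
by apply: (cs i' (u' + u)%N) => //; [lia|lia|exact: cg_mul].
Qed.

Hypothesis ex1 : forall j, (n + d <= j)%N -> mod_exact1 n j.

(** A cochain satisfying the cocycle identity inside the window only is extended to a cocycle of the
    whole truncation, to which [ex1] applies. *)
Lemma window_presents I (f : V -> A -> k) : (d <= I)%N -> bilin f ->
  (forall i u w v a b, (0 < u)%N -> (0 < w)%N -> (i + u < d)%N -> (i + u + w)%N = I ->
     v \in G (n + i) -> a \in 'P_u -> b \in 'P_w -> f (act v a) b = f v (a * b)) ->
  exists2 s : V -> k, lin s & forall i u v a, (i < d)%N -> (i + u)%N = I ->
    v \in G (n + i) -> a \in 'P_u -> f v a = s (act v a).
Proof.
elim/ltn_ind: I f => I ih f dI [fl fr] cf.
(* [phi] is the extension in module degree [n + i]. Beyond the window, each basis element x of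
   A_(I-i) gives the window cocycle (v, a) |-> f v (a x) of degree [i]; by induction it is S_x (v
   a), and S_x is the value of the extension at x. *)
have ext i : exists phi : V -> A -> k, (i < I)%N -> [/\ bilin phi,
    (i < d)%N -> forall v b, phi v b = f v b
  & forall i' u v a b, (i' < d)%N -> (0 < u)%N -> (i' + u)%N = i ->
    v \in G (n + i') -> a \in 'P_u -> b \in 'P_(I - i) -> phi (act v a) b = f v (a * b)].
  have [id|di] := ltnP i d.
    exists f => iI; split=> // i' u v a b hi' hu e vi au bi.
    by apply: (cf i' u (I - i)%N) => //; lia.
  have [iI|Ii] := ltnP i I; last by exists f; lia.
  have /choice[S hS] x : exists S : V -> k, lin S /\ forall i' u v a, (i' < d)%N ->
      (i' + u)%N = i -> v \in G (n + i') -> a \in 'P_u ->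
      f v (a * gb BA (I - i) x) = S (act v a).
    have [||S Sl hS] := ih i iI (fun v a => f v (a * gb BA (I - i) x)) di; last by exists S.
    + split=> [a|v]; first exact: fl.
      exact: (lin_mulAr _ (fr v)).
    + move=> i' u w v a b hu hw h e vi au bw; rewrite -mulrA.
      apply: (cf i' u (w + (I - i))%N) => //; [lia|lia|].
      by apply: cg_mul => //; exact: gb_in.
  exists (fun v b => \sum_x gc BA (I - i) x b * S x v) => _; split=> //.
    split=> [b|v]; apply: lin_big => x _; first by apply: lin_scale; case: (hS x).
    by apply: lin_mulr; exact: gc_lin.
  move=> i' u v a b hi' hu e vi au bi; rewrite (lin_gcE BA (lin_mulAl a (fr v)) bi).
  by apply: eq_bigr => x _; have [_ h] := hS x; rewrite (h i' u).
have /choice[phi hphi] := ext.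
pose F m b := \sum_(i < I) phi i (gpr BV (n + i) m) (gpr BA (I - i) b).
have FE i m b : (i < I)%N -> m \in G (n + i) -> b \in 'P_(I - i) -> F m b = phi i m b.
  move=> iI mi bi; rewrite /F (bigD1 (Ordinal iI)) //= !gpr_id // big1 ?addr0 // => j ji.
  have [[hl _] _ _] := hphi j (ltn_ord j).
  rewrite (gpr_ne _ mi); first by rewrite (lin0 (hl _)).
  by move=> e; move/eqP: ji; apply; apply: val_inj => /=; lia.
have [|||s sl hs] := ex1 (j := (n + I)%N) _ (f := F); first lia.
- split=> [b|m]; apply: lin_big => i _; have [[hl hr] _ _] := hphi i (ltn_ord i).
    exact: (lin_gpr BV (n + i) (hl _)).
  exact: (lin_gpr BA (I - i) (hr _)).
- move=> i u w m a b ni hu hw e mi au bw.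
  pose i0 := (i - n)%N; have ei : i = (n + i0)%N by rewrite subnKC.
  rewrite ei in mi e.
  have bw' : b \in 'P_(I - (i0 + u)) by have <- : w = (I - (i0 + u))%N by lia.
  have abw : a * b \in 'P_(I - i0).
    by have -> : (I - i0 = u + w)%N; [lia|exact: cg_mul].
  have mai : act m a \in G (n + (i0 + u)) by rewrite addnA; exact: act_in.
  rewrite (FE (i0 + u)%N) ?(FE i0) //; try lia.
  have iI : (i0 < I)%N by lia.
  have iuI : (i0 + u < I)%N by lia.
  have [_ _ h2] := hphi _ iuI; have [[hl _] h1 h3] := hphi _ iI.
  have [id|di] := ltnP i0 d.
    by rewrite (h2 i0 u) // h1.
  apply/eqP; rewrite -subr_eq0; apply/eqP.
  have [[hl' _] _ _] := hphi _ iuI.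
  (* Beyond the window both sides are functionals of [m], so they are compared on products v x with
     v in the window; there both equal f v (x a b). *)
  apply: (window_generates (I := i0)
    (s := fun m => phi (i0 + u)%N (act m a) b - phi i0 m (a * b))) => //.
    by apply: lin_sub => //; exact: (lin_actl a (hl' b)).
  move=> i' u' v x hi' hu' e' vi xu.
  have xau : x * a \in 'P_(u' + u) by exact: cg_mul.
  have e2 := h2 i' (u' + u)%N v (x * a) b hi' _ _ vi xau bw'.
  by rewrite actM e2 ?(h3 i' u' v x) // ?mulrA ?subrr //; clear -hu' e'; lia.
- exists s => // i u v a id e vi au.
  rewrite -(hs (n + i)%N u) //; [|lia..].
  rewrite (FE i) //; [|lia|by have <- : u = (I - i)%N by lia].
  have iI : (i < I)%N by lia.
  by have [_ h _] := hphi _ iI; rewrite h.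
Qed.

(** Beyond the window the value at (v a, b, c) is forced to be f v (a b) c - f v a (b c). For fixed
    [b] and [c] this is a window cocycle in (v, a), hence a functional of v a by
    [window_presents]. *)
Lemma window_extends_cocycle I (f : V -> A -> A -> k) : trilin f ->
  (forall i u w z v a b c, (0 < u)%N -> (0 < w)%N -> (0 < z)%N -> (i + u < d)%N ->
     (i + u + w + z)%N = I ->
     v \in G (n + i) -> a \in 'P_u -> b \in 'P_w -> c \in 'P_z ->
     f (act v a) b c = f v (a * b) c - f v a (b * c)) ->
  exists2 F : V -> A -> A -> k, trilin F &
    (forall i w z v b c, (i < d)%N -> (0 < w)%N -> (0 < z)%N -> (i + w + z)%N = I ->
      v \in G (n + i) -> b \in 'P_w -> c \in 'P_z -> F v b c = f v b c) /\
    (forall i u w z m a b c, (n <= i)%N -> (0 < u)%N -> (0 < w)%N -> (0 < z)%N ->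
     (i + u + w + z)%N = (n + I)%N ->
     m \in G i -> a \in 'P_u -> b \in 'P_w -> c \in 'P_z ->
     F (act m a) b c - F m (a * b) c + F m a (b * c) = 0).
Proof.
move=> [f1 f2 f3] cf.
have ext (p : nat * nat) : exists phi : V -> A -> A -> k, [/\ trilin phi,
    (p.1 < d)%N -> forall v b c, phi v b c = f v b c
  & forall i' u z v a b c, (i' < d)%N -> (0 < u)%N -> (i' + u)%N = p.1 ->
    (0 < p.2)%N -> (0 < z)%N -> (p.1 + p.2 + z)%N = I ->
    v \in G (n + i') -> a \in 'P_u -> b \in 'P_p.2 -> c \in 'P_z ->
    phi (act v a) b c = f v (a * b) c - f v a (b * c)].
  case: p => i w /=; have [id|di] := ltnP i d.
    exists f; split=> // i' u z v a b c hi' hu e hw hz e' vi au bi ci.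
    by apply: (cf i' u w z) => //; lia.
  (* When there is no room for a third argument of positive degree the condition is void and [f] is
     a placeholder. *)
  have [wz|wz] := ltnP (i + w) I; last by exists f; split=> //; lia.
  have [w0|w0] := ltnP 0 w; last by exists f; split=> //; lia.
  pose z := (I - i - w)%N.
  have /choice[S hS] (xy : 'I_(gdim BA w) * 'I_(gdim BA z)) : exists S : V -> k, lin S /\
      forall i' u v a, (i' < d)%N -> (i' + u)%N = i -> v \in G (n + i') -> a \in 'P_u ->
      f v (a * gb BA w xy.1) (gb BA z xy.2) - f v a (gb BA w xy.1 * gb BA z xy.2)
      = S (act v a).
    case: xy => x y /=.
    have [||S Sl hS] := window_presents di (f := fun v a =>
      f v (a * gb BA w x) (gb BA z y) - f v a (gb BA w x * gb BA z y)); last by exists S.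
    + split=> [a|v]; first by apply: lin_sub; exact: f1.
      by apply: lin_sub => //; exact: (lin_mulAr _ (f2 v _)).
    + move=> i' u w' v a b hu hw h e vi au bw.
      have Xw := gb_in x; have Yz := gb_in y.
      rewrite (cf i' u (w' + w)%N z v a _ _) //; try by rewrite /z; lia.
        rewrite (cf i' u w' (w + z)%N v a b _) //; try by rewrite /z; lia.
          by rewrite !mulrA; ring.
        exact: cg_mul.
      exact: cg_mul.
  exists (fun v b c => \sum_xy gc BA w xy.1 b * gc BA z xy.2 c * S xy v); split; [|by move=> h; exfalso; lia|].
    split=> [b c|v c|v b]; apply: lin_big => xy _.
    + by apply: lin_scale; case: (hS xy).
    + by do 2!apply: lin_mulr; exact: gc_lin.
    + by apply: lin_mulr; apply: lin_scale; exact: gc_lin.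
  move=> i' u z' v a b c hi' hu e _ hz' e' vi au bi.
  have -> : z' = z by rewrite /z; lia.
  move=> ci; apply/esym => /=.
  have e1 := lin_gcE BA (lin_sub (lin_mulAl a (f2 v c)) (lin_mulAr c (f3 v a))) bi.
  have e2 x := lin_gcE BA (lin_sub (f3 v (a * gb BA w x)) (lin_mulAl (gb BA w x) (f3 v a))) ci.
  transitivity (\sum_x \sum_y gc BA w x b * (gc BA z y c * S (x, y) (act v a))).
    rewrite [LHS]e1; apply: eq_bigr => x _; rewrite -mulr_sumr; congr (_ * _).
    rewrite [LHS]e2; apply: eq_bigr => y _; congr (_ * _).
    by have [_ h] := hS (x, y); exact: (h i' u).
  by rewrite pair_big /=; apply: eq_bigr => -[x y] _; rewrite mulrA.
have /choice[phi hphi] := ext.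
pose F m b c := \sum_(i < I.+1) \sum_(w < I.+1)
  phi (i : nat, w : nat) (gpr BV (n + i) m) (gpr BA w b) (gpr BA (I - i - w) c).
have FE i w z m b c : (i + w + z)%N = I -> m \in G (n + i) -> b \in 'P_w ->
    c \in 'P_z -> F m b c = phi (i, w) m b c.
  move=> e mi bw cz.
  have iI : (i < I.+1)%N by lia.
  have wI : (w < I.+1)%N by lia.
  rewrite /F (bigD1 (Ordinal iI)) //= [X in _ + X]big1 ?addr0 => [|j ji]; last first.
    apply: big1 => w' _; have [[hl _ _] _ _] := hphi (j : nat, w' : nat).
    rewrite (gpr_ne _ mi) ?(lin0 (hl _ _)) // => ee.
    by move/eqP: ji; apply; apply: val_inj => /=; lia.
  rewrite (bigD1 (Ordinal wI)) //= [X in _ + X]big1 ?addr0 => [|j ji]; last first.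
    have [[_ hl _] _ _] := hphi (i, j : nat).
    rewrite (gpr_ne _ bw) ?(lin0 (hl _ _)) // => ee.
    by move/eqP: ji; apply; apply: val_inj => /=; lia.
  by rewrite !gpr_id //; have -> : (I - i - w)%N = z by lia.
exists F; first split=> [b c|m c|m b].
- apply: lin_big => i _; apply: lin_big => w _; have [[h _ _] _ _] := hphi (i : nat, w : nat).
  exact: (lin_gpr BV (n + i) (h _ _)).
- apply: lin_big => i _; apply: lin_big => w _; have [[_ h _] _ _] := hphi (i : nat, w : nat).
  exact: (lin_gpr BA w (h _ _)).
- apply: lin_big => i _; apply: lin_big => w _; have [[_ _ h] _ _] := hphi (i : nat, w : nat).
  exact: (lin_gpr BA _ (h _ _)).
split=> [i w z v b c id hw hz e vi bw cz|i u w z m a b c ni hu hw hz e mi au bw cz].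
  rewrite (FE i w z) //; have [_ h _] := hphi (i, w); exact: h.
pose i0 := (i - n)%N; have ei : i = (n + i0)%N by rewrite subnKC.
rewrite ei in mi e.
have mai : act m a \in G (n + (i0 + u)) by rewrite addnA; exact: act_in.
have abw : a * b \in 'P_(u + w) by exact: cg_mul.
have bcw : b * c \in 'P_(w + z) by exact: cg_mul.
rewrite (FE (i0 + u)%N w z (act m a)) ?(FE i0 (u + w)%N z m (a * b)) ?(FE i0 u (w + z)%N m a) //;
  try lia.
have [[k1 _ _] _ h1] := hphi (i0 + u, w)%N.
have [[k2 _ _] g2 h2] := hphi (i0, u + w)%N.
have [[k3 _ _] g3 h3] := hphi (i0, u)%N.
have [id|di] := ltnP i0 d.
  have e1 := h1 i0 u z m a b c id hu erefl hw hz _ mi au bw cz.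
  by rewrite e1 /=; [rewrite g2 // g3 //; ring|lia].
apply: (window_generates (I := i0) (s := fun m => phi (i0 + u, w)%N (act m a) b c
  - phi (i0, u + w)%N m (a * b) c + phi (i0, u)%N m a (b * c))) => //.
  by apply: lin_add => //; apply: lin_sub => //; exact: (lin_actl a (k1 b c)).
move=> i' u' v x hi' hu' e' vi xu.
have xau : x * a \in 'P_(u' + u) by exact: cg_mul.
have e1 := h1 i' (u' + u)%N z v (x * a) b c hi'.
have e2 := h2 i' u' z v x (a * b) c hi' hu' e'.
have e3 := h3 i' u' (w + z)%N v x a (b * c) hi' hu' e'.
rewrite actM e1 ?e2 ?e3 //=; try by clear -hu hw hz hu' e e'; lia.
by rewrite !mulrA; ring.
Qed.

End Window.
End ModuleExactness.
End AlgebraExactness.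

Lemma sum_sigma (V : nmodType) (I : finType) (J : I -> finType) (F : forall i, J i -> V) :
  \sum_(s : {i : I & J i}) F (tag s) (tagged s) = \sum_i \sum_j F i j.
Proof. exact/esym/sig_big_dep. Qed.

Lemma sum_pair (V : nmodType) (I J : finType) (F : I * J -> V) :
  \sum_u F u = \sum_i \sum_j F (i, j).
Proof. by rewrite pair_bigA; apply: eq_bigr => -[]. Qed.

Lemma lin_if (k : fieldType) (V : lmodType k) (b : bool) (f : V -> k) :
  lin f -> lin (fun x => if b then f x else 0).
Proof. by case: b => // _; exact: lin_cst0. Qed.

(** * Window dimensions as ranks *)

Section LinearForms.
Variables (k : fieldType) (U : finType).

Definition linear_form (L : (U -> k) -> k) : Prop :=
  forall c x y, L (fun u => c * x u + y u) = c * L x + L y.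

Definition dirac (u : U) : U -> k := fun u' => (u' == u)%:R.

(** Lets the equations be stated as linear forms: their matrix entries are the values at
    [dirac u]. *)
Lemma linear_formE L x : linear_form L -> \sum_u L (dirac u) * x u = L x.
Proof.
move=> hL.
have L0 : L (fun=> 0) = 0.
  have := hL 1 (fun=> 0) (fun=> 0).
  rewrite (_ : (fun u => _) = fun=> 0); last by apply: funext => u; rewrite mulr0 addr0.
  by rewrite mul1r => /esym/eqP; rewrite -subr_eq0 addrK => /eqP.
suff H (s : seq U) : \sum_(u <- s) L (dirac u) * x u = L (fun u' => \sum_(u <- s) x u * dirac u u').
  rewrite H; congr L; apply: funext => u'.
  rewrite (bigD1 u') //= /dirac eqxx mulr1 big1 ?addr0 // => u /negbTE ne.
  by rewrite eq_sym ne mulr0.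
elim: s => [|u s ih]; first by rewrite big_nil -[LHS]L0; congr L; apply: funext => u; rewrite big_nil.
rewrite big_cons ih mulrC -hL; congr L; apply: funext => u'.
by rewrite big_cons.
Qed.

End LinearForms.

Section Counting.
Variables (k : fieldType) (A : cgAlgebra k).
Local Notation "'P_ i" := (cg_piece A i) (at level 8, i at level 2, format "''P_' i").
Variable BA : graded_basis (cg_piece A).
Variables (d : nat) (v : 'I_d -> nat).

(* The basis of the window, and that of the part of A in degrees 1, ..., I. *)
Definition wbasis : finType := {i : 'I_d & 'I_(v i)}.
Definition abasis (I : nat) : finType := {u : 'I_I & 'I_(gdim BA u.+1)}.

Definition wdeg (s : wbasis) : nat := tag s.
Definition adeg I (x : abasis I) : nat := (tag x).+1.
Definition aelt I (x : abasis I) : A := gb BA (tag x).+1 (tagged x).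
Definition acoef I (x : abasis I) : A -> k := gc BA (tag x).+1 (tagged x).

Lemma aelt_in I (x : abasis I) : aelt x \in 'P_(adeg x).
Proof. exact: gb_in. Qed.

Lemma adeg_gt0 I (x : abasis I) : (0 < adeg x)%N.
Proof. by []. Qed.

Lemma acoef_lin I (x : abasis I) : lin (acoef x).
Proof. exact: gc_lin. Qed.

Lemma acoef_aelt I (x y : abasis I) : acoef x (aelt y) = (x == y)%:R.
Proof.
have [e|ne] := eqVneq (tag x) (tag y); last first.
  rewrite /acoef (gc_ne _ (gb_in (tagged y))); last by move=> [] /val_inj e; rewrite e eqxx in ne.
  by case: eqP => // e; rewrite e eqxx in ne.
case: x y e => [u r] [u' r'] /= e; subst u'.
by rewrite /acoef /aelt /= gc_gb -tag_eqE /tag_eq /= eqxx tagged_asE.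
Qed.

(** [h] may depend on the degree, so that functionals cut off by a degree test are expanded in one
    sum over the whole basis. *)
Lemma sum_acoef I (h : nat -> A -> k) u a : (forall j, lin (h j)) -> (0 < u <= I)%N ->
  a \in 'P_u -> \sum_(x : abasis I) acoef x a * h (adeg x) (aelt x) = h u a.
Proof.
move=> hl; case: u => // u uI au.
rewrite (sum_sigma (fun (j : 'I_I) (r : 'I_(gdim BA j.+1)) =>
  gc BA j.+1 r a * h j.+1 (gb BA j.+1 r))) /=.
rewrite (bigD1 (Ordinal uI)) //= [X in _ + X]big1 ?addr0 => [|j ji].
  by rewrite -(lin_gcE BA (hl _) au).
apply: big1 => r _; rewrite (gc_ne _ au) ?mul0r // => -[e].
by move/eqP: ji; apply; exact: val_inj.
Qed.

Lemma abasis_eq0 I (f : A -> k) u a : lin f -> (0 < u <= I)%N -> a \in 'P_u ->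
  (forall x : abasis I, adeg x = u -> f (aelt x) = 0) -> f a = 0.
Proof.
move=> fl uI au h.
have := sum_acoef (h := fun j a => if j == u then f a else 0) (fun j => lin_if _ fl) uI au.
rewrite eqxx => <-; apply: big1 => x _; case: eqP => [/h->|_]; exact: mulr0.
Qed.

(** The type depends on the dimension vector [v] but not on [n]: windows of equal dimensions give
    points of the same affine space. *)
Definition structure_const := wbasis -> abasis d -> wbasis -> k.

(* Linear forms whose common zeros are the window cocycles of degree I. *)
Definition eqn1 (I : nat) (p : structure_const)
    (e : (wbasis * abasis I) + (wbasis * abasis d * abasis I))
    (t : wbasis * abasis I -> k) : k :=
  match e with
  | inl (s, y) => if (wdeg s + adeg y == I)%N then 0 else t (s, y)
  | inr (s, x, y) =>
    if (wdeg s + adeg x < d)%N && (wdeg s + adeg x + adeg y == I)%N then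
      \sum_s' p s x s' * t (s', y) - \sum_y' acoef y' (aelt x * aelt y) * t (s, y')
    else 0
  end.

Lemma eqn1_linear I p e : linear_form (@eqn1 I p e).
Proof.
move=> c t t'; case: e => [[s y]|[[s x] y]] /=; case: ifP => _; rewrite ?mulr0 ?addr0 //.
rewrite mulrBr !mulr_sumr addrACA -opprD -!big_split /=.
by congr (_ - _); apply: eq_bigr => i _; rewrite mulrDr mulrCA.
Qed.

Definition widen_abasis I (dI : (d <= I)%N) (x : abasis d) : abasis I :=
  Tagged (fun u : 'I_I => 'I_(gdim BA u.+1)) (i := widen_ord dI (tag x)) (tagged x).

(** The analogue of [eqn1] for cochains with two algebra arguments. The element [x] of degree at
    most [d] also occurs as an argument of the unknown, which ranges over degrees up to [I]; hence
    [widen_abasis]. *)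
Definition eqn2 (I : nat) (dI : (d <= I)%N) (p : structure_const)
    (e : (wbasis * abasis I * abasis I) + (wbasis * abasis d * abasis I * abasis I))
    (t : wbasis * abasis I * abasis I -> k) : k :=
  match e with
  | inl (s, y, z) => if (wdeg s + adeg y + adeg z == I)%N then 0 else t (s, y, z)
  | inr (s, x, y, z) =>
    if (wdeg s + adeg x < d)%N && (wdeg s + adeg x + adeg y + adeg z == I)%N then
      \sum_s' p s x s' * t (s', y, z) - \sum_y' acoef y' (aelt x * aelt y) * t (s, y', z)
      + \sum_z' acoef z' (aelt y * aelt z) * t (s, widen_abasis dI x, z')
    else 0
  end.

Lemma eqn2_linear I dI p e : linear_form (@eqn2 I dI p e).
Proof.
move=> c t t'; case: e => [[[s y] z]|[[[s x] y] z]] /=; case: ifP => _;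
  rewrite ?mulr0 ?addr0 //.
have E (J : finType) (f g h : J -> k) : \sum_j f j * (c * g j + h j) =
    c * (\sum_j f j * g j) + \sum_j f j * h j.
  by rewrite mulr_sumr -big_split; apply: eq_bigr => j _ /=; rewrite mulrDr mulrCA.
by rewrite !E; ring.
Qed.

Section FixedModule.
Variable V : graded_action A.
Local Notation G := (@ga_piece _ _ V).
Variable BV : graded_basis G.
Variable n : nat.
Hypothesis hv : forall i : 'I_d, v i = gdim BV (n + i).

Definition welt (s : wbasis) : V := gb BV (n + tag s) (cast_ord (hv (tag s)) (tagged s)).
Definition wcoef (s : wbasis) : V -> k := gc BV (n + tag s) (cast_ord (hv (tag s)) (tagged s)).
Definition wconst : structure_const := fun s x s' => wcoef s' (act (welt s) (aelt x)).

Lemma welt_in s : welt s \in G (n + wdeg s).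
Proof. exact: gb_in. Qed.

Lemma wcoef_lin s : lin (wcoef s).
Proof. exact: gc_lin. Qed.

Lemma wcoef_welt s t : wcoef s (welt t) = (s == t)%:R.
Proof.
have [e|ne] := eqVneq (tag s) (tag t); last first.
  rewrite /wcoef (gc_ne _ (welt_in t)).
    by case: eqP => // e; rewrite e eqxx in ne.
  by move=> /addnI/val_inj e; rewrite e eqxx in ne.
case: s t e => [u r] [u' r'] /= e; subst u'.
rewrite /wcoef /welt /= gc_gb -tag_eqE /tag_eq /= eqxx tagged_asE.
by rewrite (inj_eq (@cast_ord_inj _ _ _)).
Qed.

Lemma sum_wcoef (h : nat -> V -> k) i m : (forall j, lin (h j)) -> (i < d)%N ->
  m \in G (n + i) -> \sum_(s : wbasis) wcoef s m * h (wdeg s) (welt s) = h i m.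
Proof.
move=> hl id mi.
rewrite (sum_sigma (fun (j : 'I_d) (r : 'I_(v j)) =>
  gc BV (n + j) (cast_ord (hv j) r) m * h j (gb BV (n + j) (cast_ord (hv j) r)))) /=.
rewrite (bigD1 (Ordinal id)) //= [X in _ + X]big1 ?addr0 => [|j ji].
  rewrite (lin_gcE BV (hl _) mi).
  have bij : bijective (cast_ord (hv (Ordinal id))).
    by exists (cast_ord (esym (hv (Ordinal id)))) => x; rewrite ?cast_ordK ?cast_ordKV.
  by rewrite (reindex (cast_ord (hv (Ordinal id)))) //; exact: onW_bij.
apply: big1 => r _; rewrite (gc_ne _ mi) ?mul0r // => /addnI e.
by move/eqP: ji; apply; exact: val_inj.
Qed.

Lemma wbasis_eq0 (f : V -> k) i m : lin f -> (i < d)%N -> m \in G (n + i) ->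
  (forall s, wdeg s = i -> f (welt s) = 0) -> f m = 0.
Proof.
move=> fl id mi h.
have := sum_wcoef (h := fun j a => if j == i then f a else 0) (fun j => lin_if _ fl) id mi.
rewrite eqxx => <-; apply: big1 => s _; case: eqP => [/h->|_]; exact: mulr0.
Qed.

Hypothesis ex0 : forall j, (n + d <= j)%N -> mod_exact0 V n j.
Hypothesis ex1 : forall j, (n + d <= j)%N -> mod_exact1 V n j.

(** The solution space is the dual of M_(n+I): a functional S gives the cocycle S (v a), every
    window cocycle arises so by [window_presents], and S is determined by it by
    [window_generates]. *)
Lemma window_rank1 I : (d <= I)%N -> (0 < d)%N ->
  (gdim BV (n + I) + \rank (system_mx (fun e u => @eqn1 I wconst e (dirac k u)))
   = #|{: wbasis * abasis I}|)%N.
Proof.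
move=> dI d0; pose h := gdim BV (n + I).
pose c e u := @eqn1 I wconst e (dirac k u).
have solP x : solution c x <-> forall e, eqn1 wconst e x = 0.
  by split=> H e; have := H e; rewrite linear_formE //; exact: eqn1_linear.
pose val (S : V -> k) (u : wbasis * abasis I) :=
  if (wdeg u.1 + adeg u.2 == I)%N then S (act (welt u.1) (aelt u.2)) else 0.
have valE (S : V -> k) : lin S -> solution c (val S).
  move=> Sl; apply/solP => -[[s y]|[[s x] y]] /=; case: ifP => // ne.
    by rewrite /val /= ne.
  case/andP: ne => h1 /eqP h2.
  pose q j (m : V) := if (j + adeg y == I)%N then S (act m (aelt y)) else 0.
  have ql j : lin (q j).
    rewrite /q; apply: lin_if.
    exact: (lin_actl (V := V) (aelt y) Sl).
  have sx : act (welt s) (aelt x) \in G (n + (wdeg s + adeg x)).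
    by rewrite addnA; apply: act_in; [exact: welt_in|exact: aelt_in].
  pose q' j (a : A) := if (wdeg s + j == I)%N then S (act (welt s) a) else 0.
  have ql' j : lin (q' j).
    rewrite /q'; apply: lin_if.
    exact: (lin_actr (V := V) (welt s) Sl).
  have xyI : (0 < adeg x + adeg y <= I)%N.
    by apply/andP; split; [rewrite addn_gt0 adeg_gt0|move: h2; clear; lia].
  have xy := cg_mul (aelt_in x) (aelt_in y).
  have := sum_wcoef ql h1 sx; rewrite /wconst /val /= => ->.
  have := sum_acoef ql' xyI xy; rewrite /= => ->.
  by rewrite /q /q' addnA h2 eqxx actM subrr.
have lc (y : 'I_h -> k) : lin (fun m => \sum_r y r * gc BV (n + I) r m).
  by apply: lin_big => r _; apply: lin_scale; exact: gc_lin.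
have gcS (y : 'I_h -> k) r : \sum_r' y r' * gc BV (n + I) r' (gb BV (n + I) r) = y r.
  rewrite (bigD1 r) //= gc_gb eqxx mulr1 big1 ?addr0 // => r' /negbTE ne.
  by rewrite gc_gb ne mulr0.
have valS (y : 'I_h -> k) u : \sum_r y r * val (gc BV (n + I) r) u =
    val (fun m => \sum_r y r * gc BV (n + I) r m) u.
  rewrite /val; case: ifP => // _; by rewrite big1 // => r _; rewrite mulr0.
have := @rank_solution k _ _ 'I_h c (fun r => val (gc BV (n + I) r)) 0 (fun _ _ => 0).
rewrite card_ord addn0 => ->; rewrite ?card_prod //.
- by move=> r; apply: valE; exact: gc_lin.
- move=> t /solP ht.
  (* The bilinear extension of a solution; the equations [inr] say that it is a window cocycle. *)
  pose f m a := \sum_u wcoef u.1 m * acoef u.2 a * t u.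
  have fE s y : f (welt s) (aelt y) = t (s, y).
    rewrite /f (bigD1 (s, y)) //= wcoef_welt acoef_aelt !eqxx !mul1r big1 ?addr0 //.
    move=> [s' y'] ne /=; rewrite wcoef_welt acoef_aelt -mulrA.
    by move: ne; rewrite xpair_eqE negb_and => /orP[/negbTE->|/negbTE->]; rewrite !(mul0r, mulr0).
  have fl : bilin f.
    split=> [a|m]; apply: lin_big => u _; apply: lin_mulr.
      by apply: lin_mulr; exact: wcoef_lin.
    by apply: lin_scale; exact: acoef_lin.
  have fs s a : f (welt s) a = \sum_y acoef y a * t (s, y).
    rewrite /f sum_pair /=.
    rewrite (bigD1 s) //= [X in _ + X]big1 ?addr0 => [|s' ne].
      by apply: eq_bigr => y _; rewrite wcoef_welt eqxx mul1r.
    by apply: big1 => y _; rewrite wcoef_welt (negbTE ne) !mul0r.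
  have fy m y : f m (aelt y) = \sum_s wcoef s m * t (s, y).
    rewrite /f sum_pair /=.
    apply: eq_bigr => s _; rewrite (bigD1 y) //= [X in _ + X]big1 ?addr0 => [|y' ne].
      by rewrite acoef_aelt eqxx mulr1.
    by rewrite acoef_aelt (negbTE ne) mulr0 mul0r.
  have [fL fR] := fl.
  have [|||S Sl hS] := window_presents BV BA ex0 ex1 (f := f) (I := I) => //.
    move=> i u w m a b u0 w0 iu e mi au bw.
    have id : (i < d)%N by lia.
    have rel s (x : abasis d) (y : abasis I) : (wdeg s + adeg x < d)%N -> (wdeg s + adeg x + adeg y)%N = I ->
        f (act (welt s) (aelt x)) (aelt y) - f (welt s) (aelt x * aelt y) = 0.
      move=> h1 h2; rewrite fy fs; have := ht (inr (s, x, y)).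
      by rewrite /= h1 h2 eqxx.
    apply/eqP; rewrite -subr_eq0; apply/eqP.
    apply: (wbasis_eq0 (f := fun m => f (act m a) b - f m (a * b)) _ id mi) => [|s es].
      by apply: lin_sub => //; exact: (lin_actl (V := V) a (fL b)).
    have ud : (0 < u <= d)%N by lia.
    apply: (abasis_eq0 (f := fun a => f (act (welt s) a) b - f (welt s) (a * b)) _ ud au).
      apply: lin_sub; first exact: (lin_actr (V := V) _ (fL b)).
      exact: (lin_mulAr b (fR _)).
    have wI : (0 < w <= I)%N by lia.
    move=> x ex; apply: (abasis_eq0 (f := fun b =>
      f (act (welt s) (aelt x)) b - f (welt s) (aelt x * b)) _ wI bw).
      by apply: lin_sub => //; exact: (lin_mulAl (aelt x) (fR _)).
    by move=> y ey; apply: rel; rewrite es ex ?ey.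
  exists (fun r => S (gb BV (n + I) r)) => -[s y].
  rewrite valS /val /=; case: eqP => [e|/eqP ne]; last first.
    by have := ht (inl (s, y)); rewrite /= (negbTE ne).
  have sI : act (welt s) (aelt y) \in G (n + I).
    by have := act_in (welt_in s) (aelt_in y); rewrite -addnA e.
  rewrite -fE (hS (wdeg s) (adeg y)) //; [|exact: ltn_ord|exact: welt_in|exact: aelt_in].
  by rewrite (lin_gcE BV Sl sI); apply: eq_bigr => r _; rewrite mulrC.
- by case.
- move=> y hy; exists (fun=> 0) => r; rewrite big_ord0.
  rewrite -(gcS y r).
  apply: (window_generates ex0 dI (lc y)); last exact: gb_in.
  move=> i u m a id u0 e mi au.
  apply: (wbasis_eq0 (lin_actl (V := V) a (lc y)) id mi) => s es.
  have uI : (0 < u <= I)%N by lia.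
  apply: (abasis_eq0 (lin_actr (V := V) _ (lc y)) uI au) => x ex.
  by have := hy (s, x); rewrite valS /val /= es ex e eqxx.
- by move=> s _ [].
Qed.

Hypothesis ex2 : forall j, (n + d <= j)%N -> mod_exact2 V n j.

(** Indexes a basis of the sum of M_(n+i) (x) A_(I-i) over i < I. Its size involves only degrees
    below [n + I], which makes an induction on [I] possible. *)
Definition cbasis (I : nat) : finType :=
  {i : 'I_I & ('I_(gdim BV (n + i)) * 'I_(gdim BA (I - i)))%type}.

Definition cfun I (psi : cbasis I -> k) (m : V) (a : A) : k :=
  \sum_(w : cbasis I) gc BV (n + tag w) (tagged w).1 m *
    gc BA (I - tag w) (tagged w).2 a * psi w.

Lemma cfun_bilin I (psi : cbasis I -> k) : bilin (cfun psi).
Proof.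
split=> [a|m]; apply: lin_big => w _; apply: lin_mulr.
  by apply: lin_mulr; exact: gc_lin.
by apply: lin_scale; exact: gc_lin.
Qed.

Lemma cfunE I (psi : cbasis I -> k) (g : V -> A -> k) i m a : bilin g -> (i < I)%N ->
  m \in G (n + i) -> a \in 'P_(I - i) ->
  (forall w, psi w = g (gb BV (n + tag w) (tagged w).1) (gb BA (I - tag w) (tagged w).2)) ->
  cfun psi m a = g m a.
Proof.
move=> [gl gr] iI mi ai hpsi; rewrite /cfun; under eq_bigr do rewrite hpsi.
rewrite (sum_sigma (fun (j : 'I_I) (rx : 'I_(gdim BV (n + j)) * 'I_(gdim BA (I - j))) =>
  gc BV (n + j) rx.1 m * gc BA (I - j) rx.2 a * g (gb BV (n + j) rx.1) (gb BA (I - j) rx.2))).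
rewrite (bigD1 (Ordinal iI)) //= [X in _ + X]big1 ?addr0 => [|j ji].
  rewrite sum_pair /= (lin_gcE BV (gl a) mi); apply: eq_bigr => r _.
  rewrite (lin_gcE BA (gr _) ai) mulr_sumr; apply: eq_bigr => x _.
  by rewrite mulrA.
apply: big1 => rx _; rewrite (gc_ne _ mi) ?mul0r // => /addnI e.
by move/eqP: ji; apply; exact: val_inj.
Qed.

(** Dimension count in an exact sequence: coboundaries of 1-cochains of degree [I] are all window
    2-cocycles ([window_extends_cocycle] and [ex2]), those with zero coboundary come from
    functionals on M_(n+I) ([ex1]), and the latter are detected on products ([window_generates]). *)
Lemma window_rank2 I (dI : (d <= I)%N) : (0 < d)%N ->
  (#|cbasis I| + \rank (system_mx (fun e u => eqn2 dI wconst e (dirac k u)))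
   = #|{: wbasis * abasis I * abasis I}| + gdim BV (n + I))%N.
Proof.
move=> d0; pose h := gdim BV (n + I).
pose c e u := eqn2 dI wconst e (dirac k u).
have solP x : solution c x <-> forall e, eqn2 dI wconst e x = 0.
  by split=> H e; have := H e; rewrite linear_formE //; exact: eqn2_linear.
pose val (g : V -> A -> k) (u : wbasis * abasis I * abasis I) :=
  if (wdeg u.1.1 + adeg u.1.2 + adeg u.2 == I)%N then
    g (act (welt u.1.1) (aelt u.1.2)) (aelt u.2) - g (welt u.1.1) (aelt u.1.2 * aelt u.2)
  else 0.
have valE (g : V -> A -> k) : bilin g -> solution c (val g).
  move=> [gl gr]; apply/solP => -[[[s y] z]|[[[s x] y] z]] /=; case: ifP => // ne.
    by rewrite /val /= ne.
  case/andP: ne => h1 /eqP h2.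
  pose q1 j (m : V) := if (j + adeg y + adeg z == I)%N then
    g (act m (aelt y)) (aelt z) - g m (aelt y * aelt z) else 0.
  have ql1 j : lin (q1 j).
    rewrite /q1; apply: lin_if; apply: lin_sub => //.
    exact: (lin_actl (V := V) (aelt y) (gl _)).
  have sx : act (welt s) (aelt x) \in G (n + (wdeg s + adeg x)).
    by rewrite addnA; apply: act_in; [exact: welt_in|exact: aelt_in].
  pose q2 j (a : A) := if (wdeg s + j + adeg z == I)%N then
    g (act (welt s) a) (aelt z) - g (welt s) (a * aelt z) else 0.
  have ql2 j : lin (q2 j).
    rewrite /q2; apply: lin_if; apply: lin_sub.
      exact: (lin_actr (V := V) (welt s) (gl _)).
    exact: (lin_mulAr _ (gr _)).
  have xyI : (0 < adeg x + adeg y <= I)%N.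
    by apply/andP; split; [rewrite addn_gt0 adeg_gt0|move: h2; clear; lia].
  pose q3 j (a : A) := if (wdeg s + adeg x + j == I)%N then
    g (act (welt s) (aelt x)) a - g (welt s) (aelt x * a) else 0.
  have ql3 j : lin (q3 j).
    rewrite /q3; apply: lin_if; apply: lin_sub => //.
    exact: (lin_mulAl _ (gr _)).
  have yzI : (0 < adeg y + adeg z <= I)%N.
    by apply/andP; split; [rewrite addn_gt0 adeg_gt0|move: h2; clear; lia].
  have := sum_wcoef ql1 h1 sx; rewrite /wconst /val /= => ->.
  have := sum_acoef ql2 xyI (cg_mul (aelt_in x) (aelt_in y)); rewrite /= => ->.
  have := sum_acoef ql3 yzI (cg_mul (aelt_in y) (aelt_in z)); rewrite /= => ->.
  by rewrite /q1 /q2 /q3 !addnA h2 eqxx actM !mulrA; ring.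
pose unit (w : cbasis I) (m : V) (a : A) :=
  gc BV (n + tag w) (tagged w).1 m * gc BA (I - tag w) (tagged w).2 a.
have unit_bilin (w : cbasis I) : bilin (unit w).
  split=> [a|m]; first by apply: lin_mulr; exact: gc_lin.
  by apply: lin_scale; exact: gc_lin.
have valS (psi : cbasis I -> k) u : \sum_w psi w * val (unit w) u = val (cfun psi) u.
  rewrite /val; case: ifP => [_|_]; last by apply: big1 => w _; rewrite mulr0.
  rewrite /cfun -sumrB; apply: eq_bigr => w _.
  by rewrite mulrBr ![psi w * _]mulrC.
(* A cochain whose coboundary vanishes on the window is a cocycle on the truncation, again by
   testing on products with window elements; then [ex1] applies. *)
have coc (g : V -> A -> k) : bilin g -> (forall u, val g u = 0) ->
    exists2 S : V -> k, lin S & forall i m a, (i < I)%N ->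
      m \in G (n + i) -> a \in 'P_(I - i) -> g m a = S (act m a).
  move=> gb_ g0; have [gl gr] := gb_.
  have [|||S Sl hS] := ex1 (j := (n + I)%N) _ (f := g) => //; first lia; last first.
    exists S => // i m a iI mi ai; apply: (hS (n + i)%N (I - i)%N) => //; lia.
  have rel i u w m a b : (i < d)%N -> (0 < u)%N -> (0 < w)%N -> (i + u + w)%N = I ->
      m \in G (n + i) -> a \in 'P_u -> b \in 'P_w ->
      g (act m a) b - g m (a * b) = 0.
    move=> id u0 w0 e mi au bw.
    apply: (wbasis_eq0 (f := fun m => g (act m a) b - g m (a * b)) _ id mi) => [|s es].
      by apply: lin_sub => //; exact: (lin_actl (V := V) a (gl b)).
    have uI : (0 < u <= I)%N by lia.
    apply: (abasis_eq0 (f := fun a => g (act (welt s) a) b - g (welt s) (a * b)) _ uI au).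
      apply: lin_sub; first exact: (lin_actr (V := V) _ (gl b)).
      exact: (lin_mulAr b (gr _)).
    have wI : (0 < w <= I)%N by lia.
    move=> x ex; apply: (abasis_eq0 (f := fun b =>
      g (act (welt s) (aelt x)) b - g (welt s) (aelt x * b)) _ wI bw).
      by apply: lin_sub => //; exact: (lin_mulAl (aelt x) (gr _)).
    by move=> y ey; have := g0 (s, x, y); rewrite /val /= es ex ey e eqxx.
  move=> i u w m a b ni u0 w0 e mi au bw.
  apply/eqP; rewrite -subr_eq0; apply/eqP.
  pose i0 := (i - n)%N; have ei : i = (n + i0)%N by rewrite subnKC.
  rewrite ei in mi e.
  have [id|di] := ltnP i0 d; first by apply: (rel i0 u w) => //; lia.
  apply: (window_generates ex0 di (s := fun m => g (act m a) b - g m (a * b))) mi.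
    by apply: lin_sub => //; exact: (lin_actl (V := V) a (gl b)).
  move=> i' u' v' x id' u0' e' vi xu.
  have r1 := rel i' (u' + u)%N w v' (x * a) b id' _ w0 _ vi (cg_mul xu au) bw.
  have r2 := rel i' u' (u + w)%N v' x (a * b) id' u0' _ _ vi xu (cg_mul au bw).
  rewrite actM (subr0_eq (r1 _ _)) ?(subr0_eq (r2 _ _)) ?mulrA ?subrr //; clear -u0 u0' w0 e e'; lia.
(* The coordinate functionals of M_(n+I), pulled back along multiplication; they will span the
   kernel. *)
pose F (r : 'I_h) (w : cbasis I) : k :=
  gc BV (n + I) r (act (gb BV (n + tag w) (tagged w).1) (gb BA (I - tag w) (tagged w).2)).
have lc (y : 'I_h -> k) : lin (fun m => \sum_r y r * gc BV (n + I) r m).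
  by apply: lin_big => r _; apply: lin_scale; exact: gc_lin.
have gcS (y : 'I_h -> k) r : \sum_r' y r' * gc BV (n + I) r' (gb BV (n + I) r) = y r.
  rewrite (bigD1 r) //= gc_gb eqxx mulr1 big1 ?addr0 // => r' /negbTE ne.
  by rewrite gc_gb ne mulr0.
have act_bilin (S : V -> k) : lin S -> bilin (fun m a => S (act m a)).
  by move=> Sl; split=> [a|m]; [exact: (lin_actl (V := V) a Sl)|exact: (lin_actr (V := V) m Sl)].
have unitIn (s : wbasis) (y z : abasis I) : (wdeg s + adeg y + adeg z)%N = I ->
    [/\ (wdeg s + adeg y < I)%N, act (welt s) (aelt y) \in G (n + (wdeg s + adeg y)),
        aelt z \in 'P_(I - (wdeg s + adeg y)), (wdeg s < I)%N
      & aelt y * aelt z \in 'P_(I - wdeg s)].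
  move=> e; have y0 := adeg_gt0 y; have z0 := adeg_gt0 z.
  split; [clear -e z0; lia| | |clear -e y0; lia|].
  - by rewrite addnA; apply: act_in; [exact: welt_in|exact: aelt_in].
  - have -> : (I - (wdeg s + adeg y))%N = adeg z by clear -e; lia.
    exact: aelt_in.
  - have -> : (I - wdeg s)%N = (adeg y + adeg z)%N by clear -e; lia.
    by apply: cg_mul; exact: aelt_in.
apply: (@rank_solution k _ _ (cbasis I) c (fun w => val (unit w)) h F).
- by move=> w; apply: valE.
- move=> t /solP ht.
  pose f m a b := \sum_u wcoef u.1.1 m * acoef u.1.2 a * acoef u.2 b * t u.
  have [f1 f2 f3] : trilin f.
    split=> [a b|m b|m a]; apply: lin_big => u _; apply: lin_mulr.
    + by do 2!apply: lin_mulr; exact: wcoef_lin.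
    + by apply: lin_mulr; apply: lin_scale; exact: acoef_lin.
    + by apply: lin_scale; exact: acoef_lin.
  have fy m y z : f m (aelt y) (aelt z) = \sum_s wcoef s m * t (s, y, z).
    rewrite /f !sum_pair /=; apply: eq_bigr => s _.
    rewrite (bigD1 y) //= [X in _ + X]big1 ?addr0 => [|y' ne]; last first.
      by apply: big1 => z' _; rewrite acoef_aelt (negbTE ne) !(mulr0, mul0r).
    rewrite (bigD1 z) //= [X in _ + X]big1 ?addr0 => [|z' ne]; last first.
      by rewrite [acoef z' _]acoef_aelt (negbTE ne) !(mulr0, mul0r).
    by rewrite !acoef_aelt !eqxx !mulr1.
  have fw s a b : f (welt s) a b = \sum_y \sum_z acoef y a * acoef z b * t (s, y, z).
    rewrite /f !sum_pair /= (bigD1 s) //= [X in _ + X]big1 ?addr0 => [|s' ne].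
      by apply: eq_bigr => y _; apply: eq_bigr => z _; rewrite wcoef_welt eqxx mul1r.
    apply: big1 => y _; apply: big1 => z _.
    by rewrite wcoef_welt (negbTE ne) !mul0r.
  have fwz s a z : f (welt s) a (aelt z) = \sum_y acoef y a * t (s, y, z).
    rewrite fw; apply: eq_bigr => y _.
    rewrite (bigD1 z) //= [X in _ + X]big1 ?addr0 => [|z' ne]; last first.
      by rewrite [acoef z' _]acoef_aelt (negbTE ne) !(mulr0, mul0r).
    by rewrite acoef_aelt eqxx mulr1.
  have fwy s y b : f (welt s) (aelt y) b = \sum_z acoef z b * t (s, y, z).
    rewrite fw (bigD1 y) //= [X in _ + X]big1 ?addr0 => [|y' ne]; last first.
      by apply: big1 => z _; rewrite acoef_aelt (negbTE ne) !(mulr0, mul0r).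
    by apply: eq_bigr => z _; rewrite acoef_aelt eqxx mul1r.
  have fE s y z : f (welt s) (aelt y) (aelt z) = t (s, y, z).
    rewrite fwy (bigD1 z) //= [X in _ + X]big1 ?addr0 => [|z' ne]; last first.
      by rewrite acoef_aelt (negbTE ne) !(mulr0, mul0r).
    by rewrite acoef_aelt eqxx mul1r.
  have [||F' F'l [F1 F2]] := window_extends_cocycle BV BA ex0 ex1 (I := I) (f := f).
  + by split.
  + move=> i u w z m a b e u0 w0 z0 iu eI mi au bw ez.
    have id : (i < d)%N by lia.
    apply/eqP; rewrite -subr_eq0 opprB addrA; apply/eqP.
    apply: (wbasis_eq0 (f := fun m => f (act m a) b e + f m a (b * e) - f m (a * b) e) _ id mi)
      => [|s es].
      apply: lin_sub => //; apply: lin_add => //.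
      exact: (lin_actl (V := V) a (f1 b e)).
    have ud : (0 < u <= d)%N by lia.
    apply: (abasis_eq0 (f := fun a => f (act (welt s) a) b e + f (welt s) a (b * e)
      - f (welt s) (a * b) e) _ ud au).
      apply: lin_sub; last exact: (lin_mulAr b (f2 _ _)).
      by apply: lin_add => //; exact: (lin_actr (V := V) _ (f1 b e)).
    move=> x ex; have wI : (0 < w <= I)%N by lia.
    apply: (abasis_eq0 (f := fun b => f (act (welt s) (aelt x)) b e
      + f (welt s) (aelt x) (b * e) - f (welt s) (aelt x * b) e) _ wI bw).
      apply: lin_sub; last exact: (lin_mulAl (aelt x) (f2 _ _)).
      by apply: lin_add => //; exact: (lin_mulAr e (f3 _ _)).
    move=> y ey; have zI : (0 < z <= I)%N by lia.
    apply: (abasis_eq0 (f := fun e => f (act (welt s) (aelt x)) (aelt y) e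
      + f (welt s) (aelt x) (aelt y * e) - f (welt s) (aelt x * aelt y) e) _ zI ez).
      apply: lin_sub => //; apply: lin_add => //.
      exact: (lin_mulAl (aelt y) (f3 _ _)).
    move=> z' ez'.
    have -> : aelt x = aelt (widen_abasis dI x) by [].
    rewrite fy fwz fwy.
    have := ht (inr (s, x, y, z')); rewrite /= es ex ey ez' iu eI eqxx /= => H.
    by rewrite -[RHS]H addrAC.
  have [|||g gb_ hg] := ex2 (j := (n + I)%N) _ (f := F') => //; first lia.
  exists (fun w : cbasis I => g (gb BV (n + tag w) (tagged w).1) (gb BA (I - tag w) (tagged w).2)).
  move=> -[[s y] z]; rewrite valS /val /=; case: eqP => [e|/eqP ne]; last first.
    by have := ht (inl (s, y, z)); rewrite /= (negbTE ne).
  have [i1 i2 i3 i4 i5] := unitIn s y z e.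
  rewrite (cfunE gb_ i1 i2 i3) // (cfunE gb_ i4 (welt_in s) i5) // -fE.
  rewrite -(F1 (wdeg s) (adeg y) (adeg z)) //;
    [|exact: ltn_ord|exact: welt_in|exact: aelt_in|exact: aelt_in].
  apply: (hg (n + wdeg s)%N (adeg y) (adeg z)) => //;
    [exact: leq_addr|clear -e; lia|exact: welt_in|exact: aelt_in|exact: aelt_in].
- move=> r [[s y] z]; rewrite valS /val /=; case: eqP => // e.
  have [i1 i2 i3 i4 i5] := unitIn s y z e.
  have ab := act_bilin _ (gc_lin (g := BV) (i := n + I) r).
  by rewrite (cfunE ab i1 i2 i3) // (cfunE ab i4 (welt_in s) i5) // actM subrr.
- move=> psi hpsi.
  have [|S Sl hS] := coc _ (cfun_bilin psi); first by move=> u; rewrite -valS.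
  exists (fun r => S (gb BV (n + I) r)) => w.
  have wI := ltn_ord (tag w).
  have wm : act (gb BV (n + tag w) (tagged w).1) (gb BA (I - tag w) (tagged w).2)
      \in G (n + I).
    have := act_in (gb_in (tagged w).1) (gb_in (tagged w).2).
    by rewrite -addnA subnKC // ltnW.
  have := hS (tag w) _ _ wI (gb_in (tagged w).1) (gb_in (tagged w).2).
  rewrite (lin_gcE BV Sl wm) => E.
  transitivity (cfun psi (gb BV (n + tag w) (tagged w).1) (gb BA (I - tag w) (tagged w).2)).
    rewrite /cfun (bigD1 w) //= !gc_gb !eqxx !mul1r big1 ?addr0 // => w' ne.
    have [et|nt] := eqVneq (tag w') (tag w); last first.
      rewrite (gc_ne _ (gb_in (tagged w).1)) ?mul0r // => /addnI/val_inj e.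
      by rewrite e eqxx in nt.
    clear -ne et; case: w w' et ne => [i [r x]] [i' [r' x']] /= et ne; subst i'.
    move: ne; rewrite -tag_eqE /tag_eq /= eqxx tagged_asE /= xpair_eqE negb_and !gc_gb.
    by case/orP => /negbTE->; rewrite !(mul0r, mulr0).
  by rewrite E; apply: eq_bigr => r _; rewrite mulrC.
- move=> y hy r; rewrite -(gcS y r).
  apply: (window_generates ex0 dI (lc y)); last exact: gb_in.
  move=> i u m a id u0 e mi au.
  have iI : (i < I)%N by lia.
  have ai : a \in 'P_(I - i) by have -> : (I - i = u)%N by lia.
  rewrite -(cfunE (psi := fun w => \sum_r y r * F r w) (act_bilin _ (lc y)) iI mi ai) //.
  by rewrite /cfun big1 // => w _; rewrite hy mulr0.
Qed.

End FixedModule.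
End Counting.

(** * Periodicity *)

Section PolynomialFunctions.
Variables (k : fieldType) (R : comNzRingType) (ev : nat -> {rmorphism R -> k}).

Definition polyfun (g : nat -> k) : Prop := exists f, forall m, g m = ev m f.

Lemma polyfunD g h : polyfun g -> polyfun h -> polyfun (fun m => g m + h m).
Proof. by move=> [f hf] [f' hf']; exists (f + f') => m; rewrite rmorphD hf hf'. Qed.

Lemma polyfunM g h : polyfun g -> polyfun h -> polyfun (fun m => g m * h m).
Proof. by move=> [f hf] [f' hf']; exists (f * f') => m; rewrite rmorphM hf hf'. Qed.

Lemma polyfun0 : polyfun (fun=> 0).
Proof. by exists 0 => m; rewrite rmorph0. Qed.

Lemma polyfun_sum (J : Type) (s : seq J) (g : J -> nat -> k) :
  (forall j, polyfun (g j)) -> polyfun (fun m => \sum_(j <- s) g j m).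
Proof.
move=> hg; elim: s => [|j s ih].
  by have [f hf] := polyfun0; exists f => m; rewrite big_nil.
by have [f hf] := polyfunD (hg j) ih; exists f => m; rewrite big_cons -hf.
Qed.

Lemma polyfun_if (b : bool) g h : polyfun g -> polyfun h ->
  polyfun (fun m => if b then g m else h m).
Proof. by case: b. Qed.

End PolynomialFunctions.

(** If every late block of length [d] had sum above [C * d], the partial sums would grow with slope
    larger than [C]. *)
Lemma unbounded_sparse (h : nat -> nat) (C d D : nat) :
  (forall n, (0 < n)%N -> (\sum_(i < n.+1) h i <= C * n)%N) -> (0 < d)%N ->
  unbounded [set n | (D <= n)%N /\ (\sum_(i < d) h (n + i) <= C * d)%N].
Proof.
move=> growth d0 N; apply: contrapT => hN.
have [N' N'0 big] : exists2 N', (0 < N')%N &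
    forall n, (N' <= n)%N -> (C * d < \sum_(i < d) h (n + i))%N.
  exists (maxn N D).+1 => // n hn; rewrite ltnNge; apply/negP => le.
  by apply: hN; exists n => /=; [split=> //; lia|lia].
have sum_big q : (q * (C * d).+1 <= \sum_(i < q * d) h (N' + i))%N.
  elim: q => // q ih; rewrite !mulSn addnC [(d + _)%N]addnC big_split_ord /= leq_add //.
  have le : (N' <= N' + q * d)%N by rewrite leq_addr.
  by apply: leq_trans (big _ le) _; apply: eq_leq; apply: eq_bigr => i _; rewrite addnA.
(* [q] blocks gain [q] over the slope [C]; this must exceed the head start [C * N']. *)
pose q := (C * N').+1.
have le : (\sum_(i < q * d) h (N' + i) <= \sum_(i < (N' + q * d).+1) h i)%N.
  move: (q * d)%N => e; rewrite [leqRHS]big_ord_recr /= big_split_ord /=.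
  by rewrite -addnA addnCA leq_addr.
have := leq_trans (sum_big q) (leq_trans le (growth _ (ltn_addr _ N'0))).
by rewrite mulnS mulnDr [(C * (q * d))%N]mulnCA leq_add2r ltnn.
Qed.

Section Periodicity.
Variables (k : fieldType) (A : cgAlgebra k) (V : graded_action A).
Variables (BV : graded_basis (@ga_piece _ _ V)) (BA : graded_basis (cg_piece A)).
Variables (C d D : nat).
Hypothesis d0 : (0 < d)%N.
Hypothesis growth : forall n, (0 < n)%N -> (\sum_(i < n.+1) gdim BV i <= C * n)%N.
Hypothesis T1 : forall t, (d <= t)%N -> alg_exact1 A t.
Hypothesis T2 : forall t, (d <= t)%N -> alg_exact2 A t.
Hypothesis M0 : forall j, (D <= j)%N -> mod_exact0 V 0 j.
Hypothesis M1 : forall j, (D <= j)%N -> mod_exact1 V 0 j.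

(** In a sparse window each dimension is at most [C * d], so only finitely many dimension vectors
    occur and one of them recurs unboundedly. *)
Lemma sparse_window_family : exists (v : 'I_d -> nat) (t : nat -> nat),
  forall m, [/\ (m <= t m)%N, (D <= t m)%N & forall i : 'I_d, v i = gdim BV (t m + i)].
Proof.
pose code n := [ffun i : 'I_d => inord (gdim BV (n + i)) : 'I_(C * d).+1].
have [c hc] := unbounded_pigeonhole code (unbounded_sparse D growth d0).
exists (fun i => c i : nat).
have /choice[t ht] m : exists n, [/\ (m <= n)%N, (D <= n)%N
    & forall i : 'I_d, c i = gdim BV (n + i) :> nat].
  have [n [[/= Dn le] cn] mn] := hc m; exists n; split=> // i.
  rewrite -cn ffunE inordK // ltnS; apply: leq_trans le.
  by rewrite (bigD1 i) //= leq_addr.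
by exists t.
Qed.

(** With [D <= n] every degree [j >= n + d] is in the range where the untruncated module is exact,
    and [truncate] passes to the truncation. *)
Lemma window_exact0 n j : (D <= n)%N -> (n + d <= j)%N -> mod_exact0 V n j.
Proof.
move=> Dn nj.
have Mj : mod_exact0 V 0 j by apply: M0; lia.
by apply: (truncate (Q := alg_exact1 A) (d := d)) nj => // *; exact: truncate0.
Qed.

Lemma window_exact1 n j : (D <= n)%N -> (n + d <= j)%N -> mod_exact1 V n j.
Proof.
move=> Dn nj.
have Mj : mod_exact1 V 0 j by apply: M1; lia.
by apply: (truncate (Q := alg_exact2 A) (d := d)) nj => // *; exact: (truncate1 BV).
Qed.

Lemma periodic_finite_field : finite_set [set: k] ->
  exists a b, (a < b)%N /\ forall I, gdim BV (a + I) = gdim BV (b + I).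
Proof.
move=> /finite_seqP[s hs]; have {}hs x : x \in s.
  by have : [set: k] x by []; rewrite hs.
have [v [t ht]] := sparse_window_family.
have hv m : forall i : 'I_d, v i = gdim BV (t m + i) by case: (ht m).
pose p m : structure_const BA v := wconst (hv m).
pose L : finType := (wbasis v * abasis BA d * wbasis v)%type.
pose code m := [ffun l : L => inord (index (p m l.1.1 l.1.2 l.2) s) : 'I_(size s).+1].
have uT : unbounded [set: nat] by move=> N; exists N.
have [c hc] := unbounded_pigeonhole code uT.
(* Since [t m2 >= m2 > t m1], the two windows with equal structure constants start in different
   degrees. *)
have [m1 [_ c1] _] := hc 0%N; have [m2 [_ c2] le] := hc (t m1).+1.
exists (t m1), (t m2); split; first by have [h _ _] := ht m2; exact: leq_trans h.
have ep : p m1 = p m2.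
  apply: funext => s1; apply: funext => x; apply: funext => s2.
  have /ffunP/(_ (s1, x, s2)) : code m1 = code m2 by rewrite c1 c2.
  rewrite !ffunE /= => /(congr1 val) /=.
  rewrite !inordK ?ltnS ?index_size // => /(congr1 (nth 0 s)).
  by rewrite !nth_index.
move=> I; have [Id|dI] := ltnP I d.
  by rewrite -(hv m1 (Ordinal Id)) -(hv m2 (Ordinal Id)).
have [_ D1 _] := ht m1; have [_ D2 _] := ht m2.
have r1 := window_rank1 BA (hv m1) (fun j => window_exact0 D1) (fun j => window_exact1 D1) dI d0.
have r2 := window_rank1 BA (hv m2) (fun j => window_exact0 D2) (fun j => window_exact1 D2) dI d0.
rewrite (ep : wconst (hv m1) = wconst (hv m2)) in r1.
exact: addIn (etrans r1 (esym r2)).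
Qed.

Hypothesis T3 : forall t, (d <= t)%N -> alg_exact3 A t.
Hypothesis M2 : forall j, (D <= j)%N -> mod_exact2 V 0 j.

Lemma window_exact2 n j : (D <= n)%N -> (n + d <= j)%N -> mod_exact2 V n j.
Proof.
move=> Dn nj.
have Mj : mod_exact2 V 0 j by apply: M2; lia.
by apply: (truncate (Q := alg_exact3 A) (d := d)) nj => // *; exact: (truncate2 BV).
Qed.

Lemma periodic_exact2 :
  exists a b, (a < b)%N /\ forall I, gdim BV (a + I) = gdim BV (b + I).
Proof.
have [v [t ht]] := sparse_window_family.
have hv m : forall i : 'I_d, v i = gdim BV (t m + i) by case: (ht m).
have Dt m : (D <= t m)%N by case: (ht m).
pose p m : structure_const BA v := wconst (hv m).
pose L : finType := (wbasis v * abasis BA d * wbasis v)%type.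
(* One variable for each structure constant; [ev m] below is evaluation at the point [p m]. *)
have [R [X [cst [noethR hev]]]] := noetherian_mpoly k #|L|.
have /choice[ev hev'] m : exists ev : {rmorphism R -> k},
    (forall s x s', ev (X (enum_rank ((s, x, s') : L))) = p m s x s') /\ (forall a, ev (cst a) = a).
  have [ev [e1 e2]] := hev (fun i => let l := enum_val i : L in p m l.1.1 l.1.2 l.2).
  by exists ev; split=> // s x s'; rewrite e1 enum_rankK.
have pp s x s' : polyfun ev (fun m => p m s x s').
  by exists (X (enum_rank ((s, x, s') : L))) => m; case: (hev' m) => ->.
have pc a : polyfun ev (fun=> a).
  by exists (cst a) => m; case: (hev' m) => _ ->.
have uT : unbounded [set: nat] by move=> N; exists N.
have [T [_ unbT irrT]] := irreducible_subfamily ev noethR uT.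
suff H I m1 m2 : T m1 -> T m2 -> gdim BV (t m1 + I) = gdim BV (t m2 + I).
  have [m1 Tm1 _] := unbT 0%N; have [m2 Tm2 le] := unbT (t m1).+1.
  exists (t m1), (t m2); split=> [|I]; last exact: H.
  by have [h _ _] := ht m2; exact: leq_trans h.
(* The hypothesis is kept for all pairs in [T], because the rank sum must be constant on the whole
   family before irreducibility can be used. *)
elim/ltn_ind: I m1 m2 => I ih m1 m2.
have [Id|dI] := ltnP I d.
  by rewrite -(hv m1 (Ordinal Id)) -(hv m2 (Ordinal Id)).
pose E1 m := system_mx (fun e u => @eqn1 k A BA d v I (p m) e (dirac k u)).
pose E2 m := system_mx (fun e u => @eqn2 k A BA d v I dI (p m) e (dirac k u)).
have r1 m := window_rank1 BA (hv m) (fun j => window_exact0 (Dt m))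
  (fun j => window_exact1 (Dt m)) dI d0.
have r2 m := window_rank2 BA (hv m) (fun j => window_exact0 (Dt m))
  (fun j => window_exact1 (Dt m)) (fun j => window_exact2 (Dt m)) dI d0.
have card m m' : T m -> T m' -> #|cbasis BA BV (t m) I| = #|cbasis BA BV (t m') I|.
  move=> Tm Tm'; rewrite /cbasis !card_tagged; congr (sumn _).
  by apply: eq_map => i; rewrite /= !card_prod !card_ord (ih i (ltn_ord i) m m').
have E1poly : polynomial_mx ev E1.
  move=> i j.
  suff [f hf] : polyfun ev (fun m => eqn1 (p m) (enum_val j) (dirac k (enum_val i))).
    by exists f => m; rewrite mxE hf.
  case: (enum_val j) => [[s y]|[[s x] y]] /=; apply: polyfun_if => //.
  apply: polyfunD; last exact: pc.
  by apply: polyfun_sum => s'; apply: polyfunM.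
have E2poly : polynomial_mx ev E2.
  move=> i j.
  suff [f hf] : polyfun ev (fun m => eqn2 dI (p m) (enum_val j) (dirac k (enum_val i))).
    by exists f => m; rewrite mxE hf.
  case: (enum_val j) => [[[s y] z]|[[[s x] y] z]] /=; apply: polyfun_if => //.
  apply: polyfunD; last exact: pc.
  apply: polyfunD; last exact: pc.
  by apply: polyfun_sum => s'; apply: polyfunM.
move=> Tm1 Tm2.
have e : \rank (E1 m1) = \rank (E1 m2).
  (* Adding the two counting formulas cancels the dimension in degree [I]; the sum of the ranks is a
     constant minus the size of [cbasis], which [card] shows to be the same for all members. *)
  apply: (rank_constant unbT irrT E1poly E2poly) => // s s' Ts Ts'.
  have a1 := r1 s; have a2 := r1 s'; have b1 := r2 s; have b2 := r2 s'.
  have cc := card s s' Ts Ts'; clear -a1 a2 b1 b2 cc.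
  rewrite -/(p _) -/(E1 s) in a1; rewrite -/(p _) -/(E1 s') in a2.
  rewrite -/(p _) -/(E2 s) in b1; rewrite -/(p _) -/(E2 s') in b2.
  by lia.
have a1 := r1 m1; rewrite -/(p m1) -/(E1 m1) e in a1.
exact: addIn (etrans a1 (esym (r1 m2))).
Qed.

End Periodicity.

(** * Finite presentation *)

Section AugmentationTheory.
Variables (k : fieldType) (A : cgAlgebra k).
Local Notation "'P_ i" := (cg_piece A i) (at level 8, i at level 2, format "''P_' i").

Lemma cg_aug_scalar (c : k) : cg_aug (c%:A : A) = c.
Proof. by apply: cg_augE; rewrite subrr; exact: cg_plus0. Qed.

Lemma cg_aug_lin : lin (@cg_aug k A).
Proof. by move=> c x y; rewrite cg_augD -mulr_algl cg_augM cg_aug_scalar. Qed.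

Lemma cg_aug_plus (a : A) : cg_plus a -> cg_aug a = 0.
Proof. by move=> ha; apply: cg_augE; rewrite scale0r subr0. Qed.

Definition aug_part (a : A) : A := a - (cg_aug a)%:A.

Lemma aug_part_plus a : cg_plus (aug_part a).
Proof. exact: cg_augP. Qed.

Lemma aug_part_id a : cg_plus a -> aug_part a = a.
Proof. by move=> /cg_aug_plus; rewrite /aug_part => ->; rewrite scale0r subr0. Qed.

Lemma aug_part1 : aug_part 1 = 0.
Proof. by rewrite /aug_part cg_aug1 scale1r subrr. Qed.

Lemma aug_partP c x y : aug_part (c *: x + y) = c *: aug_part x + aug_part y.
Proof.
by rewrite /aug_part cg_aug_lin scalerBr scalerDl -scalerA opprD addrACA.
Qed.

Lemma aug_partM a b : aug_part (a * b) = a * aug_part b + cg_aug b *: aug_part a.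
Proof.
rewrite /aug_part cg_augM mulrBr scalerBr scalerA [cg_aug b * _]mulrC addrA.
by rewrite -scalerAr mulr1 addrNK.
Qed.

Lemma aug_partM' a b : aug_part (a * b) = aug_part a * b + cg_aug a *: aug_part b.
Proof.
rewrite /aug_part cg_augM mulrBl scalerBr scalerA addrA.
by rewrite -scalerAl mul1r addrNK.
Qed.

Lemma lin_aug_part (f : A -> k) : lin f -> lin (fun a => f (aug_part a)).
Proof. by move=> hf c x y; rewrite aug_partP hf. Qed.

Lemma lin_plus_eq0 (f : A -> k) : lin f ->
  (forall i a, (0 < i)%N -> a \in 'P_i -> f a = 0) -> forall a, cg_plus a -> f a = 0.
Proof.
move=> fl h a [s hs ->]; rewrite lin_sum // big_seq big1 // => x /hs[i xi].
exact: (h i.+1).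
Qed.

End AugmentationTheory.

Lemma lin_grading_eq0 (k : fieldType) (V : lmodType k) (I : eqType) (G : I -> {pred V})
    (f : V -> k) : grading G -> lin f ->
  (forall i m, m \in G i -> f m = 0) -> forall m, f m = 0.
Proof.
move=> [_ dec _] fl h m; have [s [g [hg ->]]] := dec m.
by rewrite lin_sum // big1 // => i _; exact: h (hg i).
Qed.

Section Generators.
Variables (k : fieldType) (A : cgAlgebra k) (V : graded_action A).
Local Notation "'P_ i" := (cg_piece A i) (at level 8, i at level 2, format "''P_' i").
Local Notation G := (@ga_piece _ _ V).
Hypothesis gV : grading G.

Lemma act0l (a : A) : act (0 : V) a = 0.
Proof. by have := actl a (-1) (0 : V) 0; rewrite scaler0 addr0 scaleN1r addNr. Qed.

Lemma act0r (x : V) : act x 0 = 0.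
Proof. by have := actr x (-1) 0 0; rewrite scaler0 addr0 scaleN1r addNr. Qed.

Lemma actDl (a : A) (x y : V) : act (x + y) a = act x a + act y a.
Proof. by have := actl a 1 x y; rewrite !scale1r. Qed.

Lemma actDr (x : V) (a b : A) : act x (a + b) = act x a + act x b.
Proof. by have := actr x 1 a b; rewrite !scale1r. Qed.

Lemma act_suml (J : Type) (s : seq J) (F : J -> V) (a : A) :
  act (\sum_(j <- s) F j) a = \sum_(j <- s) act (F j) a.
Proof. exact: (big_morph (fun x => act x a) (actDl a) (act0l a)). Qed.

Lemma act_sumr (J : Type) (s : seq J) (F : J -> A) (x : V) :
  act x (\sum_(j <- s) F j) = \sum_(j <- s) act x (F j).
Proof. exact: (big_morph (act x) (actDr x) (act0r x)). Qed.

Variables (J : finType) (y : J -> V) (e : J -> nat).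
Hypothesis hy : forall j, y j \in G (e j).

(** Take the degree [d] part on both sides. For [d < e j] the truncated difference [d - e j] is 0,
    so the coefficient is set to 0 explicitly. *)
Lemma homogeneous_coefficients d m (a : J -> A) : m \in G d -> m = \sum_j act (y j) (a j) ->
  exists2 b : J -> A, (forall j, b j \in 'P_(d - e j) /\ ((d < e j)%N -> b j = 0)) &
    m = \sum_j act (y j) (b j).
Proof.
move=> md em.
have [pA [decA linA idA neA]] := projections (cg_grading A).
have [pV [decV linV idV neV]] := projections gV.
have pVD x z : pV d (x + z) = pV d x + pV d z by rewrite -[x]scale1r linV !scale1r.
have pV0 : pV d 0 = 0 by apply: idV; exact: piece0.
exists (fun j => if (e j <= d)%N then pA (d - e j)%N (a j) else 0).
  move=> j; case: leqP => h; last by split=> //; exact: (piece0 (cg_grading A)).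
  by split; [case: (decA (a j))|lia].
rewrite -[LHS](idV d) // em (big_morph _ pVD pV0); apply: eq_bigr => j _.
have [_ [s [us s0 ea]]] := decA (a j).
rewrite [in LHS]ea act_sumr (big_morph _ pVD pV0).
have term i : pV d (act (y j) (pA i (a j))) =
    if (e j + i == d)%N then act (y j) (pA i (a j)) else 0.
  have h : act (y j) (pA i (a j)) \in G (e j + i) by apply: act_in => //; case: (decA (a j)).
  case: eqP => [ed|ne]; first by apply: idV; rewrite -ed.
  by apply: (neV _ _ _ h); apply/eqP => ed; apply: ne.
under eq_bigr do rewrite term; case: leqP => h; last first.
  by rewrite act0r big1 // => i _; case: eqP => //; lia.
have [si|/s0 e0] := boolP ((d - e j)%N \in s).
  rewrite (bigD1_seq _ si us) /= subnKC // eqxx big1 ?addr0 // => i ne.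
  by case: eqP => // ed; move/eqP: ne; lia.
rewrite e0 act0r big_seq big1 // => i si; case: eqP => // ed.
have ei : i = (d - e j)%N by lia.
by rewrite ei e0 act0r.
Qed.

End Generators.

Section FinitelyGenerated.
Variables (k : fieldType) (A : cgAlgebra k).
Local Notation "'P_ i" := (cg_piece A i) (at level 8, i at level 2, format "''P_' i").

Definition regular_action : graded_action A :=
  @GradedAction k A (A : lmodType k) (cg_piece A) (fun x a => x * a)
    (fun a c x y => etrans (mulrDl _ _ _) (congr1 (+%R^~ _) (esym (scalerAl c x a))))
    (fun x c a b => etrans (mulrDr _ _ _) (congr1 (+%R^~ _) (esym (scalerAr c x a))))
    (fun x a b => esym (mulrA x a b))
    (@cg_mul k A).

(** Homogeneous generators of the augmentation ideal as a right ideal; the clause for [d < e j]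
    excludes scalar coefficients created by truncated subtraction. *)
Definition aug_generators (J : finType) (y : J -> A) (e : J -> nat) : Prop :=
  (forall j, (0 < e j)%N /\ y j \in 'P_(e j)) /\
  forall d a, (0 < d)%N -> a \in 'P_d ->
    exists2 b : J -> A, (forall j, b j \in 'P_(d - e j) /\ ((d < e j)%N -> b j = 0)) &
      a = \sum_j y j * b j.

Lemma fg_aug_generators (n : nat) (x : 'I_n -> A) :
  (forall a, exists b : 'I_n -> A, aug_part a = \sum_i aug_part (x i) * b i) ->
  exists (J : finType) (y : J -> A) (e : J -> nat), aug_generators y e.
Proof.
move=> gen.
have /choice[p hp] i : exists p : {N & nat -> A}, (forall l, projT2 p l \in 'P_l.+1) /\
    aug_part (x i) = \sum_(l < projT1 p) projT2 p l.
  have [N [f [hf e]]] := cg_plus_fun (aug_part_plus (x i)).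
  by exists (existT _ N f).
pose J : finType := {i : 'I_n & 'I_(projT1 (p i))}.
pose y (j : J) := projT2 (p (tag j)) (tagged j); pose e (j : J) := (tagged j : nat).+1.
have ye j : y j \in 'P_(e j) by have [h _] := hp (tag j); exact: h.
exists J, y, e; split=> [j|d a d0 ad]; first by split.
have ap : cg_plus a by case: d d0 ad => // d _; exact: cg_plus_hom.
have [b hb] := gen a; rewrite (aug_part_id ap) in hb.
apply: (@homogeneous_coefficients k A regular_action (cg_grading A) J y e ye d a
  (fun j => b (tag j)) ad) => /=.
rewrite hb /= (sum_sigma (fun i (l : 'I_(projT1 (p i))) => projT2 (p i) l * b i)).
by apply: eq_bigr => i _; have [_ ->] := hp i; rewrite mulr_suml.
Qed.

Variables (J : finType) (y : J -> A) (e : J -> nat).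
Hypothesis hy : aug_generators y e.

(** Above the largest generator degree every coefficient in [a = \sum_j y j * b j] has positive
    degree, so [a] is a sum of products. *)
Lemma aug_generators_exact1 : exists d, forall t, (d <= t)%N -> alg_exact1 A t.
Proof.
have [h1 h2] := hy; exists (\max_j e j).+1 => t ht f fl cf a at_.
have t0 : (0 < t)%N by lia.
have [b hb ->] := h2 t a t0 at_; rewrite lin_sum // big1 // => j _.
have le : (e j <= \max_j e j)%N by apply: leq_bigmax.
have [ej yj] := h1 j; have [bj _] := hb j.
by apply: (cf (e j) (t - e j)%N) => //; lia.
Qed.

(** Induction on the degree: A_i is the sum of the y_j A_(i - e_j), and every e_j is positive. *)
Lemma aug_generators_has_dim i : exists n, has_dim 'P_i n.
Proof.
apply: spanned_has_dim; first exact: cg_sub.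
have [h1 h2] := hy; elim/ltn_ind: i => i ih; have [i0|i0] := posnP i.
  exists 'I_1, (fun=> 1) => w; rewrite i0 => /cg_connected[c ->].
  by exists (fun=> c); rewrite big_ord1.
pose U j : {pred A} := fun w => `[< exists2 b : A, b \in 'P_(i - e j) & w = y j * b >].
apply: (spanned_sum (U := U)) => [j|w wi].
  have [ej yj] := h1 j.
  apply: (@spanned_image _ _ _ 'P_(i - e j) _ (fun b => y j * b)).
  - by move=> c u v; rewrite mulrDr scalerAr.
  - by apply: ih; lia.
  - by move=> w /asboolP.
have [b hb ->] := h2 i w i0 wi; exists (fun j => y j * b j); split=> // j.
by apply/asboolP; exists (b j) => //; case: (hb j).
Qed.

Variable V : graded_action A.
Local Notation G := (@ga_piece _ _ V).
Hypothesis gV : grading G.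
Variables (I : finType) (z : I -> V) (f : I -> nat).
Hypothesis hz : forall i, z i \in G (f i).
Hypothesis gen : forall m, exists a : I -> A, m = \sum_i act (z i) (a i).

Lemma generators_exact0 : exists D, forall j, (D <= j)%N -> mod_exact0 V 0 j.
Proof.
exists (\max_i f i).+1 => j hj s sl cs m mj.
have [a ea] := gen m.
have [b hb ->] := homogeneous_coefficients gV hz mj ea.
rewrite lin_sum // big1 // => i _.
have le : (f i <= \max_i f i)%N by apply: leq_bigmax.
have [bi _] := hb i.
by apply: (cs (f i) (j - f i)%N) => //; lia.
Qed.

Lemma generators_has_dim i : exists n, has_dim (G i) n.
Proof.
apply: spanned_has_dim; first exact: piece_sub.
pose U j : {pred V} := fun w => `[< exists2 b : A, b \in 'P_(i - f j) & w = act (z j) b >].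
apply: (spanned_sum (U := U)) => [j|w wi].
  apply: (@spanned_image _ _ _ 'P_(i - f j) _ (act (z j))).
  - by move=> c u v; rewrite actr.
  - by have [n] := aug_generators_has_dim (i - f j); exact: has_dim_spanned.
  - by move=> w /asboolP.
have [a ea] := gen w.
have [b hb ->] := homogeneous_coefficients gV hz wi ea.
exists (fun j => act (z j) (b j)); split=> // j.
by apply/asboolP; exists (b j) => //; case: (hb j).
Qed.

End FinitelyGenerated.

(** * Homogeneous components of cochains *)

Section Homogenization.
Variables (k : fieldType) (U V W : lmodType k).
Variables (GU : nat -> {pred U}) (GV : nat -> {pred V}) (GW : nat -> {pred W}).
Variables (BU : graded_basis GU) (BV : graded_basis GV) (BW : graded_basis GW).

(** The component of total degree [j]; [i < j] keeps the second argument in positive degree. It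
    turns a cochain known to be a cocycle in degree [j] only into a cocycle in all degrees. *)
Definition hom2 (f : V -> W -> k) (j : nat) (x : V) (y : W) : k :=
  \sum_(i < j) f (gpr BV i x) (gpr BW (j - i) y).

Lemma hom2_bilin f j : bilin f -> bilin (hom2 f j).
Proof.
move=> [fl fr]; split=> [y|x]; apply: lin_big => i _.
  exact: (lin_gpr BV i (fl _)).
exact: (lin_gpr BW _ (fr _)).
Qed.

Lemma hom2E f j i u x y : bilin f -> (0 < u)%N -> x \in GV i -> y \in GW u ->
  hom2 f j x y = if (i + u == j)%N then f x y else 0.
Proof.
move=> [fl fr] u0 xi yu; rewrite /hom2; case: eqP => [e|ne].
  have ij : (i < j)%N by lia.
  have ju : (j - i)%N = u by lia.
  rewrite (bigD1 (Ordinal ij)) //= ju !gpr_id // big1 ?addr0 // => l li.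
  rewrite (gpr_ne _ xi) ?(lin0 (fl _)) // => el.
  by move/eqP: li; apply; apply: val_inj.
apply: big1 => l _; have [el|nl] := eqVneq i l; last first.
  by rewrite (gpr_ne _ xi) ?(lin0 (fl _)) //; apply/eqP.
by rewrite (gpr_ne _ yu) ?(lin0 (fr _)) //; lia.
Qed.

Definition hom3 (f : U -> V -> W -> k) (j : nat) (x : U) : V -> W -> k :=
  fun y z => \sum_(i < j) hom2 (f (gpr BU i x)) (j - i) y z.

Lemma hom3_trilin f j : trilin f -> trilin (hom3 f j).
Proof.
move=> [f1 f2 f3]; have b x : bilin (f x) by split.
split=> [y z|x z|x y]; apply: lin_big => i _.
- by apply: lin_big => l _; exact: (lin_gpr BU i (f1 _ _)).
- by have [h _] := hom2_bilin (j - i) (b (gpr BU i x)).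
- by have [_ h] := hom2_bilin (j - i) (b (gpr BU i x)).
Qed.

Lemma hom3E f j i u w x y z : trilin f -> (0 < w)%N ->
  x \in GU i -> y \in GV u -> z \in GW w ->
  hom3 f j x y z = if (i + u + w == j)%N then f x y z else 0.
Proof.
move=> [f1 f2 f3] w0 xi yu zw; have b x' : bilin (f x') by split.
rewrite /hom3; under eq_bigr => l _ do rewrite (hom2E (j - l) (b _) w0 yu zw).
case: eqP => [e|ne].
  have ij : (i < j)%N by lia.
  have ju : (u + w)%N = (j - i)%N by lia.
  rewrite (bigD1 (Ordinal ij)) //= ju eqxx gpr_id // big1 ?addr0 // => l li.
  rewrite (gpr_ne _ xi); first by rewrite (lin0 (f1 _ _)); case: ifP.
  by move=> el; move/eqP: li; apply; apply: val_inj.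
apply: big1 => l _; have [el|nl] := eqVneq i l; last first.
  by rewrite (gpr_ne _ xi); [rewrite (lin0 (f1 _ _)); case: ifP|apply/eqP].
by case: eqP => // eu; lia.
Qed.

End Homogenization.

Lemma bilin_comb (k : fieldType) (V W : lmodType k) n (c : 'I_n -> k)
    (f : 'I_n -> V -> W -> k) : (forall i, bilin (f i)) ->
  bilin (fun x y => \sum_i c i * f i x y).
Proof.
by move=> hf; split=> [y|x]; apply: lin_big => i _; apply: lin_scale; case: (hf i).
Qed.

Lemma trilin_comb (k : fieldType) (U V W : lmodType k) n (c : 'I_n -> k)
    (f : 'I_n -> U -> V -> W -> k) : (forall i, trilin (f i)) ->
  trilin (fun x y z => \sum_i c i * f i x y z).
Proof.
by move=> hf; split=> [y z|x z|x y]; apply: lin_big => i _; apply: lin_scale; case: (hf i).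
Qed.

Section FinitePresentationModule.
Variables (k : fieldType) (A : cgAlgebra k) (V : graded_action A).
Local Notation "'P_ i" := (cg_piece A i) (at level 8, i at level 2, format "''P_' i").
Local Notation G := (@ga_piece _ _ V).
Hypothesis act1 : forall x : V, act x 1 = x.
Hypothesis gV : grading G.
Variables (BV : graded_basis G) (BA : graded_basis (cg_piece A)).

Lemma act_scale (x : V) (c : k) : act x (c%:A) = c *: x.
Proof.
by have := actr x c 1 0; rewrite act0r !addr0 act1 => ->.
Qed.

(** For scalar [a] the identity holds by bilinearity, so only the positive part of [a] needs the
    cocycle condition. *)
Lemma cocycle1_scalar (f : V -> A -> k) m a b : bilin f ->
  (forall m a b, cg_plus a -> cg_plus b -> f (act m a) b = f m (a * b)) ->
  cg_plus b -> f (act m a) b = f m (a * b).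
Proof.
move=> [fl fr] cf bp; rewrite -(subrK (cg_aug a)%:A a) -/(aug_part a).
rewrite actDr (linD (fl b)) mulrDl (linD (fr m)) cf //; last exact: aug_part_plus.
by rewrite act_scale -scalerAl mul1r (linZ (fl b)) (linZ (fr m)).
Qed.

Lemma plus_cocycle1 (f : V -> A -> k) : bilin f ->
  (forall i u w m a b, (0 < u)%N -> (0 < w)%N -> m \in G i -> a \in 'P_u -> b \in 'P_w ->
     f (act m a) b = f m (a * b)) ->
  forall m a b, cg_plus a -> cg_plus b -> f (act m a) b = f m (a * b).
Proof.
move=> [fl fr] cf m a b ap bp; apply/eqP; rewrite -subr_eq0; apply/eqP.
apply: (lin_grading_eq0 (f := fun m => f (act m a) b - f m (a * b)) gV) => [|i {}m mi].
  by apply: lin_sub => //; exact: (lin_actl (V := V) a (fl b)).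
apply: (lin_plus_eq0 (f := fun a => f (act m a) b - f m (a * b)) _ _ ap) => [|u a1 u0 au].
  by apply: lin_sub; [exact: (lin_actr (V := V) m (fl b))|exact: (lin_mulAr b (fr _))].
apply: (lin_plus_eq0 (f := fun b => f (act m a1) b - f m (a1 * b)) _ _ bp) => [|w b1 w0 bw].
  by apply: lin_sub => //; exact: (lin_mulAl a1 (fr _)).
by rewrite (cf i u w) // subrr.
Qed.

Variables (p q : nat) (x : 'I_p -> V) (r : 'I_q -> 'I_p -> A).
Hypothesis gen : forall m, exists a : 'I_p -> A, m = \sum_i act (x i) (a i).
Hypothesis rel : forall a : 'I_p -> A, \sum_i act (x i) (a i) = 0 ->
  exists b : 'I_q -> A, forall i, a i = \sum_l r l i * b l.
Hypothesis relr : forall l, \sum_i act (x i) (r l i) = 0.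

(* If f pairs to zero with the relations r_l, then sum_i x_i a_i |->
   sum_i f(x_i, a_i^+) is well defined, and f is its coboundary. *)
Lemma fp_cocycle1_trivial (f : V -> A -> k) : bilin f ->
  (forall m a b, cg_plus a -> cg_plus b -> f (act m a) b = f m (a * b)) ->
  (forall l, \sum_i f (x i) (aug_part (r l i)) = 0) ->
  exists2 s : V -> k, lin s & forall m a, cg_plus a -> f m a = s (act m a).
Proof.
move=> fb cf f0; have [fl fr] := fb.
have /choice[al hal] := gen.
pose S (a : 'I_p -> A) := \sum_i f (x i) (aug_part (a i)).
have S_lin c a b : S (fun i => c *: a i + b i) = c * S a + S b.
  rewrite /S mulr_sumr -big_split; apply: eq_bigr => i _ /=.
  by rewrite aug_partP (linD (fr _)) (linZ (fr _)).
have S0 a : \sum_i act (x i) (a i) = 0 -> S a = 0.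
  move=> /rel[b hb]; rewrite /S.
  (* Summed over [i], the first terms vanish because [r l] is a relation among the [x i], the second
     ones by the assumption on [f]. *)
  have E i : f (x i) (aug_part (a i)) = \sum_l (f (act (x i) (r l i)) (aug_part (b l))
      + cg_aug (b l) * f (x i) (aug_part (r l i))).
    rewrite hb (lin_sum (lin_aug_part (fr (x i)))); apply: eq_bigr => l _.
    rewrite aug_partM (linD (fr _)) (linZ (fr _)).
    by rewrite (cocycle1_scalar _ _ fb cf) //; exact: aug_part_plus.
  under eq_bigr do rewrite E.
  rewrite exchange_big big1 //= => l _; rewrite big_split /= -mulr_sumr f0 mulr0 addr0.
  by rewrite -(lin_sum (fl _)) relr (lin0 (fl _)).
have Sact a : S a = S (al (\sum_i act (x i) (a i))).
  apply/eqP; rewrite -subr_eq0 addrC; apply/eqP.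
  rewrite -mulN1r -S_lin; apply: S0.
  set m := \sum_i act (x i) (a i).
  under eq_bigr do rewrite actr scaleN1r.
  by rewrite big_split /= sumrN -hal addNr.
exists (fun m => S (al m)) => [c m m'|m a ap].
  rewrite -S_lin [RHS]Sact; congr (S (al _)); rewrite {1}(hal m) {1}(hal m') scaler_sumr.
  by rewrite -big_split; apply: eq_bigr => i _; rewrite actr.
have -> : act m a = \sum_i act (x i) (al m i * a).
  by rewrite {1}(hal m) act_suml; apply: eq_bigr => i _; rewrite actM.
rewrite -Sact {1}(hal m) (lin_sum (fl a)); apply: eq_bigr => i _.
rewrite (aug_part_id (cg_plus_mull _ ap)).
exact: cocycle1_scalar.
Qed.

(** The obstruction space is [k^q], one coordinate for each relation of the presentation, whether
    homogeneous or not. *)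
Lemma fp_mod_exact1 : exists D, forall j, (D <= j)%N -> mod_exact1 V 0 j.
Proof.
pose dom j : set (V * A) := [set u | exists i w, [/\ (0 < w)%N, (i + w)%N = j,
  u.1 \in G i & u.2 \in 'P_w]].
pose Z : set (V * A -> k) := [set f | bilin (fun m a => f (m, a)) /\
  forall m a b, cg_plus a -> cg_plus b -> f (act m a, b) = f (m, a * b)].
pose good j : set (V * A -> k) := [set f | exists2 s : V -> k, lin s &
  forall u, dom j u -> f u = s (act u.1 u.2)].
have [|||j0 hj0] := @finitely_many_degrees k (V * A)%type dom q Z good
  (fun f l => \sum_i f (x i, aug_part (r l i))).
- move=> n f c hf; split.
    split=> [|m a b ap bp]; first by apply: bilin_comb => i; case: (hf i).
    by apply: eq_bigr => i _; have [_ h] := hf i; rewrite h.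
  move=> l; rewrite exchange_big; apply: eq_bigr => i _ /=.
  by rewrite mulr_sumr.
- move=> f j [fb cf] f0; have [s sl hs] := fp_cocycle1_trivial fb cf f0.
  exists s => // -[m a] [i [w [w0 e mi aw]]] /=; apply: hs.
  by case: w w0 aw {e} => // w _; exact: cg_plus_hom.
- move=> j f g c [s sl hs] hg; exists (fun v => c * s v); first exact: lin_scale.
  by move=> u du; rewrite hg // hs.
exists j0 => j hj f fb cf.
have hb := hom2_bilin BV BA j fb.
have hE i u m a : (0 < u)%N -> m \in G i -> a \in 'P_u ->
    hom2 BV BA f j m a = if (i + u == j)%N then f m a else 0.
  by move=> u0 mi au; exact: hom2E.
have [||s sl hs] := hj0 j (fun u => hom2 BV BA f j u.1 u.2) hj.
- split=> //=; apply: plus_cocycle1 => // i u w m a b u0 w0 mi au bw.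
  rewrite (hE (i + u)%N w) ?(hE i (u + w)%N) //; [|by rewrite addn_gt0 u0|exact: cg_mul|exact: act_in].
  by rewrite addnA; case: eqP => // e; exact: (cf i u w).
- move=> i [m a] [i' [w [w0 e mi aw]]] ne /=; rewrite (hE i' w) //.
  by case: eqP => // e'; case: ne; rewrite -e -e'.
- exists s => // i u m a _ u0 e mi au.
  rewrite -(hs (m, a)) /=; last by exists i, u.
  by rewrite (hE i u) // e eqxx.
Qed.

End FinitePresentationModule.

Section FreeModule.
Variables (R : nzRingType) (K : choiceType) (W : lmodType R) (h : K -> W).

Definition free_ext (p : {malg R[K]}) : W := \sum_(x <- msupp p) p@_x *: h x.

Lemma free_extEw (p : {malg R[K]}) (t : seq K) : uniq t -> {subset msupp p <= t} ->
  free_ext p = \sum_(x <- t) p@_x *: h x.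
Proof.
move=> ut st; apply/esym; rewrite (bigID (fun x => x \in msupp p)) /=.
rewrite [X in _ + X]big1 ?addr0 => [|x /mcoeff_outdom->]; last by rewrite scale0r.
rewrite -big_filter; apply: perm_big; apply: uniq_perm; rewrite ?filter_uniq ?fset_uniq //.
move=> x; rewrite mem_filter; apply: andb_idr; exact: st.
Qed.

Fact free_ext_is_linear : linear free_ext.
Proof.
move=> c p q; set t := undup (enum_fset (msupp (c *: p + q)) ++ msupp p ++ msupp q).
have ut : uniq t by exact: undup_uniq.
rewrite !(@free_extEw _ t ut); try by move=> x hx; rewrite mem_undup !mem_cat hx ?orbT.
rewrite scaler_sumr -big_split /=; apply: eq_bigr => x _.
by rewrite mcoeffD mcoeffZ scalerDl scalerA.
Qed.

HB.instance Definition _ := GRing.isLinear.Build R {malg R[K]} W _ free_ext free_ext_is_linear.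

Lemma free_extU (c : R) x : free_ext << c *g x >> = c *: h x.
Proof.
rewrite (@free_extEw _ [:: x]) // => [|y]; first by rewrite big_seq1 mcoeffUU.
by move/(fsubsetP (msuppU_le (k := x))); rewrite !inE.
Qed.

Lemma malgU_scale (c : R) (x : K) : << c *g x >> = c *: << x >> :> {malg R[K]}.
Proof. by apply/malgP => y; rewrite mcoeffZ !mcoeffU mulr_natr. Qed.

Lemma malg_sumE (p : {malg R[K]}) : p = \sum_(x <- msupp p) p@_x *: << x >>.
Proof. by rewrite [LHS]monalgE; apply: eq_bigr => x _; exact: malgU_scale. Qed.

End FreeModule.

Lemma malg_lin_ext (k : fieldType) (K : choiceType) (f g : {malg k[K]} -> k) :
  lin f -> lin g -> (forall x, f << x >> = g << x >>) -> f =1 g.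
Proof.
move=> fl gl h p; rewrite [p]malg_sumE !lin_sum //; apply: eq_bigr => x _.
by rewrite !linZ // h.
Qed.

Lemma malg_scalerAr (k : comNzRingType) (K : monomType) (c : k) (p q : {malg k[K]}) :
  p * (c *: q) = c *: (p * q).
Proof.
rewrite -!mul_malgC !mulrA; congr (_ * q).
rewrite [p]monalgE mulr_suml mulr_sumr; apply: eq_bigr => x _.
by rewrite !malgM_def !fgmulUU mulm1 mul1m mulrC.
Qed.

(** * Cocycles on a finitely presented algebra *)

Section FinitePresentationAlgebra.
Variables (k : fieldType) (A : cgAlgebra k) (n : nat).
Local Notation "'P_ i" := (cg_piece A i) (at level 8, i at level 2, format "''P_' i").
Local Notation F := {malg k[{fmonom 'I_n}]}.
Variable phi : F -> A.
Hypothesis phi1 : phi 1 = 1.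
Hypothesis phiM : forall p q, phi (p * q) = phi p * phi q.
Hypothesis phiP : forall c p q, phi (c *: p + q) = c *: phi p + phi q.

Definition word (w : seq 'I_n) : F := << FMonom w >>.

Lemma word0 : word [::] = 1.
Proof. by congr << _ >>; apply/eqP; rewrite -val_eqE /= fm1. Qed.

Lemma word_cat w1 w2 : word (w1 ++ w2) = word w1 * word w2.
Proof.
rewrite malgM_def fgmulUU mulr1; congr << _ >>.
by apply/eqP; rewrite -val_eqE /= fmM.
Qed.

Lemma word_cons i w : word (i :: w) = word [:: i] * word w.
Proof. by rewrite -word_cat. Qed.

Lemma wordE (m : {fmonom 'I_n}) : << m >> = word m :> F.
Proof. by rewrite /word fmK. Qed.

Definition letter (i : 'I_n) : A := phi (word [:: i]).

Lemma phi0 : phi 0 = 0.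
Proof. by have := phiP (-1) 0 0; rewrite scaler0 addr0 scaleN1r addNr. Qed.

Lemma phi_cons i w : phi (word (i :: w)) = letter i * phi (word w).
Proof. by rewrite word_cons phiM. Qed.

Lemma phi_cat w1 w2 : phi (word (w1 ++ w2)) = phi (word w1) * phi (word w2).
Proof. by rewrite word_cat phiM. Qed.

Lemma phi_lin (f : A -> k) : lin f -> lin (fun p => f (phi p)).
Proof. by move=> fl c p q; rewrite phiP fl. Qed.

(** By induction on words, as the positive part of l w is l^+ w plus the augmentation of l times
    w^+. Letters may have nonzero augmentation because [phi] is not graded. *)
Lemma letters_generate : (forall a, exists p, a = phi p) ->
  forall a, exists b : 'I_n -> A, aug_part a = \sum_i aug_part (letter i) * b i.
Proof.
move=> surj a; have [p ->] := surj a.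
rewrite [p]malg_sumE; elim: (enum_fset _) => [|m s [b hb]].
  exists (fun=> 0); rewrite big_nil phi0 big1 => [|i _]; last by rewrite mulr0.
  by have := aug_partP (-1) (0 : A) 0; rewrite scaler0 addr0 scaleN1r addNr.
have [c hc] : exists c : 'I_n -> A,
    aug_part (phi << m >>) = \sum_i aug_part (letter i) * c i.
  rewrite wordE; elim: (fmonom_val m) => [|i w [c hc]].
    exists (fun=> 0); rewrite word0 phi1 aug_part1 big1 // => i _.
    by rewrite mulr0.
  exists (fun j => (j == i)%:R * phi (word w) + cg_aug (letter i) *: c j).
  rewrite phi_cons aug_partM' hc scaler_sumr.
  rewrite [RHS](eq_bigr (fun j => aug_part (letter j) * ((j == i)%:R * phi (word w))
    + cg_aug (letter i) *: (aug_part (letter j) * c j))) => [|j _]; last first.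
    by rewrite mulrDr scalerAr.
  rewrite big_split /= [in RHS](bigD1 i) //= eqxx mul1r; congr (_ + _).
  rewrite big1 ?addr0 // => j /negbTE->.
  by rewrite mul0r mulr0.
exists (fun i => p@_m *: c i + b i); rewrite big_cons phiP aug_partP hb hc scaler_sumr -big_split /=.
by apply: eq_bigr => i _; rewrite mulrDr scalerAr.
Qed.

Section Cocycle.
Variable f : A -> A -> k.
Hypothesis fb : bilin f.
Hypothesis cf : forall a b c, cg_plus a -> cg_plus b -> cg_plus c -> f (a * b) c = f a (b * c).

(* phi lifts to the square-zero extension of A defined by the cocycle f; the
   k-component of the lift is [lift]. *)
Fixpoint lift_word (w : seq 'I_n) : k :=
  if w is i :: w' then
    f (aug_part (letter i)) (aug_part (phi (word w'))) + cg_aug (letter i) * lift_word w'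
  else 0.

Definition lift : F -> k := free_ext (W := k^o) (fun m => lift_word (fmonom_val m)).

Lemma lift_lin : lin lift.
Proof. by move=> c p q; rewrite /lift linearP. Qed.

Lemma lift_wordE w : lift (word w) = lift_word w.
Proof. by rewrite /lift /word free_extU; exact: mul1r. Qed.

Lemma cocycle2_scalar a b c : cg_plus a -> cg_plus c -> f (a * b) c = f a (b * c).
Proof.
have [fl fr] := fb; move=> ap cp.
rewrite -(subrK (cg_aug b)%:A b) -/(aug_part b) mulrDr mulrDl (linD (fl c)) (linD (fr a)).
rewrite cf //; last exact: aug_part_plus.
by rewrite -scalerAr mulr1 -scalerAl mul1r (linZ (fl _)) (linZ (fr _)).
Qed.

(** The product rule (a, s)(b, t) = (a b, f a^+ b^+ + aug(a) t + aug(b) s) of the square-zero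
    extension. On words it follows by induction on the first one; associativity is the cocycle
    identity. *)
Lemma liftM p q : lift (p * q) = f (aug_part (phi p)) (aug_part (phi q))
  + cg_aug (phi p) * lift q + cg_aug (phi q) * lift p.
Proof.
have [fl fr] := fb.
have al : lin (fun p => cg_aug (phi p)) by apply: phi_lin; exact: cg_aug_lin.
have word_word w1 w2 : lift (word w1 * word w2)
    = f (aug_part (phi (word w1))) (aug_part (phi (word w2)))
    + cg_aug (phi (word w1)) * lift (word w2) + cg_aug (phi (word w2)) * lift (word w1).
  rewrite -word_cat !lift_wordE; elim: w1 => [|i w1 ih] /=.
    by rewrite word0 phi1 aug_part1 (lin0 (fl _)) cg_aug1 mul1r mulr0 addr0 add0r.
  rewrite ih phi_cat phi_cons cg_augM.
  move: (phi (word w1)) (phi (word w2)) (letter i) (lift_word w1) (lift_word w2).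
  move=> a b l s t; rewrite [aug_part (a * b)]aug_partM [aug_part (l * a)]aug_partM'.
  rewrite (linD (fr _)) (linZ (fr _)) (linD (fl (aug_part b)) (aug_part l * a)) (linZ (fl _)).
  by rewrite cocycle2_scalar; [ring|exact: aug_part_plus|exact: aug_part_plus].
pose rhs p q := f (aug_part (phi p)) (aug_part (phi q))
  + cg_aug (phi p) * lift q + cg_aug (phi q) * lift p.
have rl q0 : lin (fun p => rhs p q0).
  apply: lin_add; last by apply: lin_scale; exact: lift_lin.
  apply: lin_add; last by apply: lin_mulr.
  by apply: (phi_lin (f := fun a => f (aug_part a) _)); exact: (lin_aug_part (fl _)).
have rr p0 : lin (rhs p0).
  apply: lin_add; last exact: lin_mulr.
  apply: lin_add; last by apply: lin_scale; exact: lift_lin.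
  by apply: (phi_lin (f := fun a => f _ (aug_part a))); exact: (lin_aug_part (fr _)).
rewrite -/(rhs p q).
have ll q0 : lin (fun p => lift (p * q0)).
  by move=> c p1 p2; rewrite mulrDl -scalerAl lift_lin.
have lr p0 : lin (fun q => lift (p0 * q)).
  by move=> c p1 p2; rewrite mulrDr malg_scalerAr lift_lin.
apply: (malg_lin_ext (ll q) (rl q)) => m1.
apply: (malg_lin_ext (lr << m1 >>) (rr << m1 >>)) => m2.
by rewrite !wordE word_word.
Qed.

Variables (m : nat) (r : 'I_m -> F).
Hypothesis surj : forall a, exists p, a = phi p.
Hypothesis ker : forall p, phi p = 0 <-> ideal_gen r p.

(** By [liftM], vanishing on the relations propagates to the ideal they generate, so [lift] descends
    to a functional [g] on [A]. On positive elements the augmentation terms drop out of [liftM],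
    leaving f a b = g (a b). *)
Lemma fp_cocycle2_trivial : (forall l, lift (r l) = 0) ->
  exists2 g : A -> k, lin g & forall a b, cg_plus a -> cg_plus b -> f a b = g (a * b).
Proof.
have [fl fr] := fb; move=> r0.
have al0 : aug_part (0 : A) = 0.
  by have := aug_partP (-1) (0 : A) 0; rewrite scaler0 addr0 scaleN1r addNr.
have ker0 p : phi p = 0 -> lift p = 0.
  move=> /ker[s ->]; rewrite (lin_sum lift_lin) big1 // => -[[a l] b] _ /=.
  have rl : phi (r l) = 0.
    by apply/ker; exists [:: (1, l, 1)]; rewrite big_seq1 /= mul1r mulr1.
  have e0 : lift (a * r l) = 0.
    by rewrite liftM rl al0 (lin0 (fr _)) r0 (lin0 (@cg_aug_lin k A)) mulr0 mul0r !addr0.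
  by rewrite liftM phiM rl mulr0 al0 (lin0 (fl _)) e0 (lin0 (@cg_aug_lin k A)) mulr0 mul0r !addr0.
have /choice[al hal] := surj.
have lift_eq p q : phi p = phi q -> lift p = lift q.
  move=> e; apply/eqP; rewrite -subr_eq0 -(linB lift_lin); apply/eqP/ker0.
  by rewrite addrC -scaleN1r phiP e scaleN1r addNr.
exists (fun a => lift (al a)) => [c a b|a b ap bp].
  by rewrite -lift_lin; apply: lift_eq; rewrite phiP -!hal.
rewrite (lift_eq _ (al a * al b)); last by rewrite phiM -!hal.
by rewrite liftM -!hal !aug_part_id // !cg_aug_plus // !mul0r !addr0.
Qed.

End Cocycle.

Variables (m : nat) (r : 'I_m -> F).
Hypothesis surj : forall a, exists p, a = phi p.
Hypothesis ker : forall p, phi p = 0 <-> ideal_gen r p.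
Variable BA : graded_basis (cg_piece A).

Lemma plus_cocycle2 (f : A -> A -> k) : bilin f ->
  (forall i u w a b c, (0 < i)%N -> (0 < u)%N -> (0 < w)%N ->
     a \in 'P_i -> b \in 'P_u -> c \in 'P_w -> f (a * b) c = f a (b * c)) ->
  forall a b c, cg_plus a -> cg_plus b -> cg_plus c -> f (a * b) c = f a (b * c).
Proof.
move=> [fl fr] cf a b c ap bp cp; apply/eqP; rewrite -subr_eq0; apply/eqP.
apply: (lin_plus_eq0 (f := fun a => f (a * b) c - f a (b * c)) _ _ ap) => [|i a1 i0 ai].
  by apply: lin_sub => //; exact: (lin_mulAr b (fl c)).
apply: (lin_plus_eq0 (f := fun b => f (a1 * b) c - f a1 (b * c)) _ _ bp) => [|u b1 u0 bu].
  by apply: lin_sub; [exact: (lin_mulAl a1 (fl c))|exact: (lin_mulAr c (fr _))].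
apply: (lin_plus_eq0 (f := fun c => f (a1 * b1) c - f a1 (b1 * c)) _ _ cp) => [|w c1 w0 cw].
  by apply: lin_sub => //; exact: (lin_mulAl b1 (fr _)).
by rewrite (cf i u w) // subrr.
Qed.

Lemma lift_comb N (f : 'I_N -> A -> A -> k) (c : 'I_N -> k) p :
  lift (fun a b => \sum_i c i * f i a b) p = \sum_i c i * lift (f i) p.
Proof.
have hl : lin (fun p => \sum_i c i * lift (f i) p).
  by apply: lin_big => i _; apply: lin_scale; exact: lift_lin.
apply: (malg_lin_ext (lift_lin _) hl) => x.
rewrite wordE; under [RHS]eq_bigr do rewrite lift_wordE; rewrite lift_wordE.
elim: (fmonom_val x) => [|l w ih] /=; first by rewrite big1 // => i _; rewrite mulr0.
by rewrite ih mulr_sumr -big_split; apply: eq_bigr => i _ /=; ring.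
Qed.

(** The obstruction of a cocycle consists of the values of its lift on the [m] relations. *)
Lemma fp_alg_exact2 : exists d, forall t, (d <= t)%N -> alg_exact2 A t.
Proof.
pose dom j : set (A * A) := [set u | exists i w, [/\ (0 < i)%N, (0 < w)%N, (i + w)%N = j,
  u.1 \in 'P_i & u.2 \in 'P_w]].
pose Z : set (A * A -> k) := [set f | bilin (fun a b => f (a, b)) /\
  forall a b c, cg_plus a -> cg_plus b -> cg_plus c -> f (a * b, c) = f (a, b * c)].
pose good j : set (A * A -> k) := [set f | exists2 g : A -> k, lin g &
  forall u, dom j u -> f u = g (u.1 * u.2)].
have [|||j0 hj0] := @finitely_many_degrees k (A * A)%type dom m Z good
  (fun f l => lift (fun a b => f (a, b)) (r l)).
- move=> N f c hf; split; last by move=> l; exact: (lift_comb (fun i a b => f i (a, b))).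
  split=> [|a b d ap bp dp]; first by apply: bilin_comb => i; case: (hf i).
  by apply: eq_bigr => i _; have [_ h] := hf i; rewrite h.
- move=> f j [fb cf] f0; have [g gl hg] := fp_cocycle2_trivial fb cf surj ker f0.
  exists g => // -[a b] [i [w [i0 w0 e ai bw]]] /=; apply: hg.
    by case: i i0 ai {e} => // i _; exact: cg_plus_hom.
  by case: w w0 bw {e} => // w _; exact: cg_plus_hom.
- move=> j f g c [s sl hs] hg; exists (fun v => c * s v); first exact: lin_scale.
  by move=> u du; rewrite hg // hs.
exists j0 => j hj f fb cf.
have hb := hom2_bilin BA BA j fb.
have hE i u a b : (0 < u)%N -> a \in 'P_i -> b \in 'P_u ->
    hom2 BA BA f j a b = if (i + u == j)%N then f a b else 0.
  by move=> u0 ai bu; exact: hom2E.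
have [||g gl hg] := hj0 j (fun u => hom2 BA BA f j u.1 u.2) hj.
- split=> //=; apply: plus_cocycle2 => // i u w a b c i0 u0 w0 ai bu cw.
  rewrite (hE (i + u)%N w) ?(hE i (u + w)%N) //;
    [|by rewrite addn_gt0 u0|exact: cg_mul|exact: cg_mul].
  by rewrite addnA; case: eqP => // e; exact: (cf i u w).
- move=> i [a b] [i' [w [i0 w0 e ai bw]]] ne /=; rewrite (hE i' w) //.
  by case: eqP => // e'; case: ne; rewrite -e -e'.
- exists g => // i u a b i0 u0 e ai bu.
  rewrite -(hg (a, b)) /=; last by exists i, u.
  by rewrite (hE i u) // e eqxx.
Qed.

End FinitePresentationAlgebra.

(** * Free resolutions and Tor *)

Section Kernel.
Variables (R : nzRingType) (U W : lmodType R) (f : {linear U -> W}).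

Definition lker_pred : {pred U} := fun u => f u == 0.

Fact lker_submod_closed : submod_closed lker_pred.
Proof.
split=> [|c x y]; first by rewrite unfold_in raddf0.
by rewrite !unfold_in => /eqP hx /eqP hy; rewrite linearP hx hy scaler0 addr0.
Qed.

HB.instance Definition _ := GRing.isSubmodClosed.Build R U lker_pred lker_submod_closed.

(** The kernel is made a module in its own right because the resolution covers it again. *)
Record lkernel : predArgType := LKernel { lkval : U; lkvalP : lkval \in lker_pred }.

HB.instance Definition _ := [isSub for lkval].
HB.instance Definition _ := [Choice of lkernel by <:].
HB.instance Definition _ := [SubChoice_isSubLmodule of lkernel by <:].

Lemma lkval_is_linear : linear lkval.
Proof. by move=> c x y; exact: (@linearP R lkernel U *:%R val c x y). Qed.

HB.instance Definition _ := GRing.isLinear.Build R lkernel U _ lkval lkval_is_linear.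

Lemma lkval0 (x : lkernel) : f (lkval x) = 0.
Proof. by apply/eqP; exact: lkvalP. Qed.

Lemma lkval_inj : injective lkval.
Proof. exact: val_inj. Qed.

Lemma lkval_0 : lkval 0 = 0.
Proof. exact: raddf0. Qed.

Lemma lkernel_ex (u : U) : f u = 0 -> exists x : lkernel, lkval x = u.
Proof. by move=> /eqP h; exists (LKernel (h : u \in lker_pred)). Qed.

End Kernel.

Section Resolution.
Variables (k : fieldType) (A : cgAlgebra k).
Implicit Types X Y : lmodType A^c.

(** Free on all elements of [X]: no generators are chosen, so the construction iterates uniformly
    and any function on [X] extends to the cover. *)
Definition cover_mod X : lmodType A^c := {malg A^c[X]}.
Definition mod_cover X : {linear cover_mod X -> X} := free_ext (R := A^c) (K := X) (W := X) id.
Definition syzygy X : lmodType A^c := lkernel (mod_cover X).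

Lemma coverU X (a : A^c) (x : X) : mod_cover X (<< a *g x >> : cover_mod X) = a *: x.
Proof. exact: free_extU. Qed.

Definition cover_diff X : {linear cover_mod (syzygy X) -> cover_mod X} :=
  (@lkval _ _ _ (mod_cover X)) \o mod_cover (syzygy X).

Lemma cover_surj X x : exists p, x = mod_cover X p.
Proof. by exists << x >>; rewrite coverU scale1r. Qed.

Lemma cover_exact X p : mod_cover X p = 0 <-> exists q, p = cover_diff X q.
Proof.
split=> [/lkernel_ex[x <-]|[q ->]]; last exact: lkval0.
by exists << x >>; rewrite /= coverU scale1r.
Qed.

Lemma cover_diff0 X q : cover_diff X q = 0 <-> mod_cover (syzygy X) q = 0.
Proof.
split=> [h|/= ->]; last exact: lkval_0.
by apply: lkval_inj; rewrite lkval_0.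
Qed.

Lemma cover_projective X : projective (cover_mod X).
Proof.
move=> Y Z g f gsurj.
have /choice[h hh] x : exists y, g y = f << x >>.
  by have [y ->] := gsurj (f << x >>); exists y.
exists (free_ext (R := A^c) h) => p; rewrite {2}[p]malg_sumE [in LHS]/= /free_ext !linear_sum.
by apply: eq_bigr => x _; rewrite !linearZ /= hh.
Qed.

Fixpoint iter_syzygy X (n : nat) : lmodType A^c :=
  if n is m.+1 then syzygy (iter_syzygy X m) else X.

Definition cover_resolution X : proj_resolution X :=
  @ProjResolution k A X (fun n => cover_mod (iter_syzygy X n))
    (fun n => cover_diff (iter_syzygy X n)) (mod_cover X)
    (fun n => @cover_projective _) (@cover_surj X) (@cover_exact X)
    (fun n p => iff_trans (@cover_diff0 _ p) (@cover_exact _ p)).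

End Resolution.

Section Reduction.
Variables (k : fieldType) (A : cgAlgebra k).
Implicit Types X Y : lmodType A^c.

Definition red_mod X : lmodType k := {malg k[X]}.

(* The class of p (x) 1 in the tensor product of a free module with k. *)
Definition red X (p : cover_mod X) : red_mod X :=
  [malg x in msupp p => cg_aug (p@_x : A)].

Lemma cg_aug0 : cg_aug (0 : A) = 0.
Proof. exact: lin0 (@cg_aug_lin k A). Qed.

Lemma redE X (p : cover_mod X) x : (red p)@_x = cg_aug (p@_x : A).
Proof. by rewrite mcoeffE; case: msuppP => // _; rewrite cg_aug0. Qed.

Lemma redD X (p q : cover_mod X) : red (p + q) = red p + red q.
Proof. by apply/malgP => x; rewrite mcoeffD !redE mcoeffD cg_augD. Qed.

Lemma redZ X (a : A) (p : cover_mod X) : red ((a : A^c) *: p) = cg_aug a *: red p.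
Proof.
apply/malgP => x; rewrite mcoeffZ !redE mcoeffZ.
by rewrite [(a : A^c) * _](erefl : _ = (p@_x : A) * a) cg_augM mulrC.
Qed.

Lemma redU X (a : A) (x : X) : red (<< (a : A^c) *g x >> : cover_mod X) = cg_aug a *: << x >>.
Proof.
apply/malgP => y; rewrite redE mcoeffZ !mcoeffU; case: eqP => _; rewrite ?mulr1 //.
by rewrite mulr0 cg_aug0.
Qed.

Lemma cover_ind X (P : cover_mod X -> Prop) : P 0 ->
  (forall p q, P p -> P q -> P (p + q)) ->
  (forall (a : A^c) x, P << a *g x >>) -> forall p, P p.
Proof.
move=> P0 PD PU p; rewrite [p]monalgE; elim/big_ind: _ => // x _; exact: PU.
Qed.

Definition red_map X (p : cover_mod X) (x : trivL A) : red_mod X := (x : k) *: red p.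

Fact red_map_balanced X : balanced (@red_map X).
Proof.
split=> [p p' x|p x x'|p a x|p c x]; rewrite /red_map.
- by rewrite redD scalerDr.
- exact: scalerDl.
- by rewrite redZ scalerA; congr (_ *: _); exact: mulrC.
- by rewrite scalerA; congr (_ *: _); rewrite /GRing.scale /= /trivL_scale cg_aug_scalar.
Qed.

Fact red_map_exists X (W : lmodType k) (b : cover_mod X -> trivL A -> W) : balanced b ->
  exists f : {linear red_mod X -> W}, forall p x, f (red_map p x) = b p x.
Proof.
move=> [bDl bDr bA bZ].
exists (free_ext (R := k) (fun y => b << y >> (1 : k))) => p x; move: p.
apply: cover_ind => [|p q hp hq|a y].
- have r0 : red (0 : cover_mod X) = 0.
    by apply/malgP => y; rewrite redE mcoeff0 cg_aug0 mcoeff0.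
  rewrite /red_map r0 scaler0 raddf0; apply: (addrI (b 0 x)).
  by rewrite -bDl !addr0.
- by rewrite /red_map redD scalerDr raddfD bDl -hp -hq.
- have -> : b << a *g y >> x = b << y >> ((a : A) *: x) by rewrite malgU_scale bA.
  rewrite /red_map redU scalerA -malgU_scale /= free_extU -bZ; congr (b _ _).
  rewrite -[RHS]/(cg_aug a * (x : k)).
  by rewrite -[LHS]/(cg_aug (((x : k) * cg_aug a)%:A : A) * 1) cg_aug_scalar mulr1 mulrC.
Qed.

Fact red_map_unique X (W : lmodType k) (f g : {linear red_mod X -> W}) :
  (forall p x, f (red_map p x) = g (red_map p x)) -> f =1 g.
Proof.
move=> h p; rewrite [p]malg_sumE !linear_sum; apply: eq_bigr => x _; rewrite !linearZ.
have := h << x >> (1 : k); rewrite /red_map scale1r.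
by rewrite (redU 1 x) cg_aug1 scale1r => ->.
Qed.

Definition red_tensor X : tensor_product (cover_mod X) (trivL A) :=
  TensorProduct (@red_map_balanced X) (@red_map_exists X) (@red_map_unique X).

Definition red_diff X : {linear red_mod (syzygy X) -> red_mod X} :=
  free_ext (R := k) (fun w : syzygy X => red (lkval w)).

Lemma red_diffE X (p : cover_mod (syzygy X)) : red_diff X (red p) = red (cover_diff X p).
Proof.
move: p; apply: cover_ind => [|p q hp hq|a w].
- have r0 Y : red (0 : cover_mod Y) = 0.
    by apply/malgP => y; rewrite redE mcoeff0 cg_aug0 mcoeff0.
  by rewrite r0 !raddf0 r0.
- have rD u v : red_diff X (u + v) = red_diff X u + red_diff X v by exact: raddfD.
  have cD u v : cover_diff X (u + v) = cover_diff X u + cover_diff X v by exact: raddfD.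
  by rewrite redD rD hp hq cD redD.
- rewrite redU -malgU_scale /red_diff /= free_extU coverU linearZ /=.
  by rewrite redZ.
Qed.

Definition cover_tor X : tor_complex X (trivL A).
Proof.
apply: (@TorComplex k A X (trivL A) (cover_resolution X)
  (fun n => red_tensor (iter_syzygy X n)) (fun n => red_diff (iter_syzygy X n))).
move=> n p x; rewrite /= /red_map; rewrite linearZ /=; congr (_ *: _).
exact: red_diffE.
Defined.

(** Finite dimension of Tor_2 of [X] with the trivial module, read off from [cover_tor X]. *)
Definition findim_homology X : Prop :=
  exists (N : nat) (e : 'I_N -> red_mod (syzygy (syzygy X))),
    (forall i, red_diff (syzygy X) (e i) = 0) /\
    forall z, red_diff (syzygy X) z = 0 -> exists (c : 'I_N -> k) w,
      z - \sum_i c i *: e i = red_diff (syzygy (syzygy X)) w.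

Lemma findim_Tor2 X : findim_Tor 2 X (trivL A) -> findim_homology X.
Proof.
move=> /(_ (cover_tor X))[N [e [he hz]]]; exists N, e; split=> // z /hz[c [w _ hw]].
by exists c, w.
Qed.

(** Dimension shifting, which is a matter of unfolding here: the resolution of [X] from place 1 on
    is that of [syzygy X]. *)
Lemma findim_Tor3 X : findim_Tor 3 X (trivL A) -> findim_homology (syzygy X).
Proof.
move=> /(_ (cover_tor X))[N [e [he hz]]]; exists N, e; split=> // z /hz[c [w _ hw]].
by exists c, w.
Qed.

End Reduction.

Lemma lin_aug_split (k : fieldType) (A : cgAlgebra k) (f : A -> k) (a : A) : lin f ->
  f a = f (aug_part a) + cg_aug a * f 1.
Proof. by move=> fl; rewrite -(linZ fl) -(linD fl) /aug_part subrK. Qed.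

Section RightAction.
Variables (k : fieldType) (A : cgAlgebra k).
Implicit Types X Y : lmodType A^c.

Definition ract X (x : restr X) (a : A) : restr X := (a : A^c) *: (x : X).

Lemma ract1 X (x : restr X) : ract x 1 = x.
Proof. exact: (@scale1r A^c X x). Qed.

Lemma ractM X (x : restr X) a b : ract (ract x a) b = ract x (a * b).
Proof. exact: (@scalerA A^c X b a x). Qed.

Lemma restr_scaleE X (c : k) (x : restr X) : c *: x = ract x c%:A.
Proof. by []. Qed.

Lemma ractD X (x y : restr X) a : ract (x + y) a = ract x a + ract y a.
Proof. exact: (@scalerDr A^c X a x y). Qed.

Lemma ractP X a c (x y : restr X) : ract (c *: x + y) a = c *: ract x a + ract y a.
Proof.
by rewrite !restr_scaleE ractD !ractM -scalerAl mul1r -scalerAr mulr1.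
Qed.

Lemma ractrP X (x : restr X) c a b : ract x (c *: a + b) = c *: ract x a + ract x b.
Proof.
rewrite restr_scaleE ractM -scalerAr mulr1.
exact: (@scalerDl A^c X x (c *: a) b).
Qed.

Lemma lin_ractl X (f : restr X -> k) a : lin f -> lin (fun x => f (ract x a)).
Proof. by move=> hf c x y; rewrite ractP hf. Qed.

Lemma lin_ractr X (f : restr X -> k) x : lin f -> lin (fun a => f (ract x a)).
Proof. by move=> hf c a b; rewrite ractrP hf. Qed.

Lemma restr_linear X Y (f : {linear X -> Y}) (c : k) (x y : restr X) :
  f (c *: x + y) = (c *: (f x : restr Y) + (f y : restr Y)) :> restr Y.
Proof. exact: (@linearP A^c X Y *:%R f c%:A x y). Qed.

Lemma lkval_restr X (c : k) (u v : restr (syzygy X)) :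
  lkval (c *: u + v : syzygy X) =
  c *: (lkval (u : syzygy X) : restr (cover_mod X)) + (lkval (v : syzygy X) : restr (cover_mod X)).
Proof. exact: (restr_linear (@lkval _ _ _ (mod_cover X))). Qed.

Lemma red_linear X (c : k) (p q : restr (cover_mod X)) :
  red (c *: p + q : restr (cover_mod X)) = c *: red (p : cover_mod X) + red (q : cover_mod X).
Proof. by rewrite redD restr_scaleE redZ cg_aug_scalar. Qed.

Lemma malgU_ract X (x : X) (a b : A) :
  ract (<< (a : A^c) *g x >> : cover_mod X) b = (<< (a * b : A^c) *g x >> : cover_mod X).
Proof.
by rewrite /ract malgU_scale scalerA -malgU_scale.
Qed.

Lemma malgU_restr X (x : X) c (a b : A) :
  (<< (c *: a + b : A^c) *g x >> : cover_mod X) =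
  c *: ((<< (a : A^c) *g x >> : cover_mod X) : restr (cover_mod X))
    + ((<< (b : A^c) *g x >> : cover_mod X) : restr (cover_mod X)).
Proof.
rewrite restr_scaleE malgU_ract -scalerAr mulr1.
exact: (monalgUD x (c *: a : A^c) (b : A^c)).
Qed.

Section Extension.
Variables (X : lmodType A^c) (h : restr X -> A -> k).
Hypothesis hl : forall x, lin (h x).

(** The cover is a direct sum of copies of [A] indexed by [x], and [h x] is the [k]-linear
    functional prescribed on copy [x]. *)
Definition kext (p : restr (cover_mod X)) : k :=
  \sum_(x <- msupp (p : cover_mod X)) h x (p : cover_mod X)@_x.

Lemma kextEw (p : restr (cover_mod X)) (t : seq X) : uniq t ->
  {subset msupp (p : cover_mod X) <= t} -> kext p = \sum_(x <- t) h x (p : cover_mod X)@_x.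
Proof.
move=> ut st; apply/esym; rewrite (bigID (fun x => x \in msupp (p : cover_mod X))) /=.
rewrite [X in _ + X]big1 ?addr0 => [|x /mcoeff_outdom->]; last by rewrite (lin0 (hl x)).
rewrite -big_filter; apply: perm_big; apply: uniq_perm; rewrite ?filter_uniq ?fset_uniq //.
move=> x; rewrite mem_filter; apply: andb_idr; exact: st.
Qed.

Lemma kext_lin : lin kext.
Proof.
move=> c p q; set t := undup (enum_fset (msupp (c *: p + q : cover_mod X)) ++
  msupp (p : cover_mod X) ++ msupp (q : cover_mod X)).
have ut : uniq t by exact: undup_uniq.
rewrite !(@kextEw _ t ut); try by move=> x hx; rewrite mem_undup !mem_cat hx ?orbT.
rewrite mulr_sumr -big_split /=; apply: eq_bigr => x _; rewrite -hl; congr (h x _).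
rewrite [LHS](mcoeffD x ((c%:A : A^c) *: (p : cover_mod X)) q) mcoeffZ.
congr (_ + _); rewrite -[LHS]/(((p : cover_mod X)@_x : A) * c%:A).
by rewrite -scalerAr mulr1.
Qed.

Lemma kextU (a : A) (x : X) : kext (<< (a : A^c) *g x >> : cover_mod X) = h x a.
Proof.
rewrite (@kextEw _ [:: x]) // => [|y]; first by rewrite big_seq1 mcoeffUU.
by move/(fsubsetP (msuppU_le (k := x))); rewrite !inE.
Qed.

End Extension.

Lemma cover_lin_ext X (f g : restr (cover_mod X) -> k) : lin f -> lin g ->
  (forall (a : A) x, f (<< (a : A^c) *g x >> : cover_mod X) = g (<< (a : A^c) *g x >> : cover_mod X)) ->
  f =1 g.
Proof.
move=> fl gl h p; apply: (cover_ind (X := X) (P := fun p => f p = g p)) => //.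
  by rewrite [LHS](lin0 fl) [RHS](lin0 gl).
by move=> p1 q hp hq; rewrite [LHS](linD fl) [RHS](linD gl) hp hq.
Qed.

End RightAction.

(** * Comparison of the bar complex with the free resolution *)

Section Obstruction.
Variables (k : fieldType) (A : cgAlgebra k) (X : lmodType A^c).
Variable f : restr X -> A -> A -> k.
Hypothesis ft : trilin f.

(** [obs0], [obs1], [obs2] pull [f] back along the comparison map from the free resolution to the
    bar resolution: a second syzygy w = sum of [u] a_u, with u = sum of [x] a_(u,x), goes to the sum
    of x (x) a_(u,x)^+ (x) a_u^+. Thus [obs2] is the functional that [f] induces on the complex
    computing Tor_2. *)
Definition obs0 (p : restr (cover_mod X)) (b : A) : k :=
  kext (fun x a => f x (aug_part a) b) p.

Definition obs1 (q : restr (cover_mod (syzygy X))) : k :=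
  kext (fun u a => obs0 (lkval u) (aug_part a)) q.

Definition obs2 (z : red_mod (syzygy (syzygy X))) : k :=
  \sum_(w <- msupp z) z@_w * obs1 (lkval w).

Lemma obs0_bilin : bilin obs0.
Proof.
have [f1 f2 f3] := ft; split=> [b|p].
  by apply: kext_lin => x; exact: (lin_aug_part (f2 _ _)).
by apply: lin_big => x _; exact: f3.
Qed.

Lemma obs0U (a : A) (x : X) (b : A) :
  obs0 (<< (a : A^c) *g x >> : cover_mod X) b = f x (aug_part a) b.
Proof.
have [f1 f2 f3] := ft.
by rewrite /obs0 (kextU (h := fun x a => f x (aug_part a) b)) // => y; exact: (lin_aug_part (f2 _ _)).
Qed.

Lemma obs1_lin : lin obs1.
Proof. by apply: kext_lin => u; apply: lin_aug_part; case: obs0_bilin. Qed.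

Lemma obs1U (a : A) (u : syzygy X) :
  obs1 (<< (a : A^c) *g u >> : cover_mod (syzygy X)) = obs0 (lkval u) (aug_part a).
Proof.
rewrite /obs1 (kextU (h := fun u a => obs0 (lkval (u : syzygy X)) (aug_part a))) // => v.
by apply: lin_aug_part; case: obs0_bilin.
Qed.

Lemma obs2_ext z : obs2 z = free_ext (R := k) (K := syzygy (syzygy X)) (W := k^o) (fun w => obs1 (lkval w)) z.
Proof. by []. Qed.

Lemma obs2_lin : lin obs2.
Proof. by move=> c y z; rewrite !obs2_ext linearP. Qed.

Lemma obs2U (w : syzygy (syzygy X)) : obs2 << w >> = obs1 (lkval w).
Proof. by rewrite obs2_ext free_extU; exact: mul1r. Qed.

Hypothesis cf : forall m a b c, cg_plus a -> cg_plus b -> cg_plus c ->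
  f (ract m a) b c - f m (a * b) c + f m a (b * c) = 0.

Lemma aug_split (a : A) : a = aug_part a + (cg_aug a)%:A.
Proof. by rewrite /aug_part subrK. Qed.

(** Pulled back to the free cover, the cocycle is the coboundary of [obs0]. On a generator [x] c
    this is the cocycle identity for the positive part of [c]; the scalar part supplies the term f x
    a b. *)
Lemma obs0_coboundary (p : restr (cover_mod X)) a b : cg_plus a -> cg_plus b ->
  f (mod_cover X p) a b = obs0 (ract p a) b - obs0 p (a * b).
Proof.
have [f1 f2 f3] := ft; have [ol or_] := obs0_bilin; move=> ap bp; move: p.
apply: cover_lin_ext => [c x y||c x].
- by rewrite restr_linear f1.
- by apply: lin_sub => //; exact: (lin_ractl a (ol b)).
rewrite malgU_ract !obs0U (aug_part_id (cg_plus_mull _ ap)) coverU.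
rewrite -[(c : A^c) *: x]/(ract (x : restr X) c) {1 2}(aug_split c).
have -> : ract (x : restr X) (aug_part c + (cg_aug c)%:A)
    = cg_aug c *: (x : restr X) + ract (x : restr X) (aug_part c).
  have := ractrP (x : restr X) 1 (aug_part c) (cg_aug c)%:A; rewrite !scale1r => ->.
  by rewrite addrC restr_scaleE.
rewrite f1 mulrDl (linD (f2 _ _)) -scalerAl mul1r (linZ (f2 _ _)).
have := cf x (aug_part_plus c) ap bp.
move: (f (ract _ _) _ _) (f x (aug_part c * a) b) (f x _ (a * b)) (f x a b) => F1 F2 F3 F4 e.
have -> : F1 = F2 - F3 by rewrite -[LHS]subr0 -e; ring.
ring.
Qed.

(** A syzygy maps to 0 in [X], so [obs0_coboundary] makes [obs0] a cocycle with one algebra argument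
    on [syzygy X]. *)
Lemma obs0_kernel (u : syzygy X) a b : cg_plus b ->
  obs0 (ract (lkval u : restr (cover_mod X)) a) b = obs0 (lkval u) (a * b).
Proof.
have [f1 f2 f3] := ft; have [ol or_] := obs0_bilin; move=> bp.
rewrite (aug_split a); set e := cg_aug a.
have -> : ract (lkval u : restr (cover_mod X)) (aug_part a + e%:A)
    = e *: (lkval u : restr (cover_mod X)) + ract (lkval u : restr (cover_mod X)) (aug_part a).
  have := ractrP (lkval u : restr (cover_mod X)) 1 (aug_part a) e%:A; rewrite !scale1r => ->.
  by rewrite addrC restr_scaleE.
rewrite ol mulrDl -scalerAl mul1r addrC [RHS](linD (or_ _)) (linZ (or_ _)); congr (_ + _).
apply/eqP; rewrite -subr_eq0; apply/eqP.
rewrite -(obs0_coboundary _ (aug_part_plus a) bp) lkval0.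
exact: (lin0 (f1 _ _)).
Qed.

Lemma obs1_ract (q : restr (cover_mod (syzygy X))) a : cg_plus a ->
  obs1 (ract q a) = obs0 (cover_diff X q) a.
Proof.
have [ol or_] := obs0_bilin; move=> ap; move: q.
apply: cover_lin_ext => [||c u].
- exact: (lin_ractl a obs1_lin).
- by move=> c x y; rewrite restr_linear ol.
rewrite malgU_ract obs1U (aug_part_id (cg_plus_mull _ ap)) /= coverU linearZ /=.
by rewrite -[_ *: _]/(ract (lkval u : restr (cover_mod X)) c) obs0_kernel.
Qed.

(** On second syzygies [obs1] is a module map to the trivial module, which is why it passes to the
    tensor product with [k]. *)
Lemma obs1_kernel (w : syzygy (syzygy X)) a :
  obs1 (ract (lkval w : restr (cover_mod (syzygy X))) a) = cg_aug a * obs1 (lkval w).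
Proof.
have [ol or_] := obs0_bilin.
have e0 b : cg_plus b -> obs1 (ract (lkval w : restr (cover_mod (syzygy X))) b) = 0.
  move=> bp; rewrite obs1_ract //= lkval0.
  by rewrite (lkval_0 (mod_cover X)); exact: (lin0 (ol _)).
have := lin_ractr (lkval w : restr (cover_mod (syzygy X))) obs1_lin => rl.
refine (etrans (lin_aug_split a rl) _).
refine (etrans (congr1 (+%R^~ _) (e0 _ (aug_part_plus a))) _).
by refine (etrans (add0r _) _); congr (_ * _); exact: (congr1 obs1 (ract1 _)).
Qed.

Lemma obs2_boundary (t : red_mod (syzygy (syzygy (syzygy X)))) :
  obs2 (red_diff (syzygy (syzygy X)) t) = 0.
Proof.
have red_obs (P : restr (cover_mod (syzygy (syzygy X)))) :
    obs2 (red (P : cover_mod _)) = obs1 (lkval (mod_cover (syzygy (syzygy X)) P)).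
  move: P; apply: cover_lin_ext => [c p q|c p q|a w].
  - by rewrite red_linear obs2_lin.
  - by rewrite restr_linear -obs1_lin; congr obs1; exact: restr_linear.
  rewrite redU (linZ obs2_lin) obs2U coverU linearZ /=.
  by rewrite -obs1_kernel.
rewrite [t]malg_sumE linear_sum (lin_sum obs2_lin) big1 // => s _.
rewrite linearZ (linZ obs2_lin) /= free_extU scale1r red_obs lkval0.
by rewrite lkval_0 (lin0 obs1_lin) mulr0.
Qed.

Hypothesis kill : forall z, red_diff (syzygy X) z = 0 -> obs2 z = 0.

(** [obs0] is a primitive of [f] on the free cover, and it is corrected by a functional [sig] until
    it descends to [X]. The correction does not change the coboundary, since its two contributions
    are both [sig] at p a b. *)
Lemma obstruction_trivial : exists2 g : restr X -> A -> k, bilin g &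
  forall m a b, cg_plus a -> cg_plus b -> f m a b = g (ract m a) b - g m (a * b).
Proof.
have [f1 f2 f3] := ft; have [ol or_] := obs0_bilin.
(* A functional that kills the cycles factors through the differential. *)
have [|Lam Lam_lin hLam] := lin_factor _ obs2_lin kill.
  by move=> c x y; exact: linearP.
have r1l : lin (fun q : restr (cover_mod (syzygy X)) => Lam (red (q : cover_mod _))).
  by move=> c p q; rewrite red_linear Lam_lin.
have s1l : lin (fun q => obs1 q - Lam (red (q : cover_mod (syzygy X)))).
  by apply: lin_sub => //; exact: obs1_lin.
(* Subtracting [Lam] makes [obs1] vanish on second syzygies, so it factors through [cover_diff X].
   On positive multiples of a generator the subtracted term is 0, so [sig] agrees with [obs0] on
   products of a syzygy with a positive element. *)
have [||sig sig_lin hsig] := lin_factor (phi := fun q : restr (cover_mod (syzygy X)) =>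
    (cover_diff X q : restr (cover_mod X))) _ s1l.
- by move=> c x y; exact: restr_linear.
- move=> q hq; have /lkernel_ex[w <-] := (cover_diff0 q).1 hq.
  by rewrite -obs2U hLam /= free_extU scale1r subrr.
have sigE (u : syzygy X) b : cg_plus b ->
    sig (ract (lkval u : restr (cover_mod X)) b) = obs0 (lkval u) b.
  move=> bp; have := hsig (<< (b : A^c) *g u >> : cover_mod (syzygy X)).
  rewrite obs1U redU (cg_aug_plus bp) scale0r (lin0 Lam_lin) subr0 (aug_part_id bp) => ->.
  by rewrite /= coverU linearZ.
pose psi (p : restr (cover_mod X)) b := obs0 p b - sig (ract p b).
have pl b : lin (fun p => psi p b).
  by apply: lin_sub => //; exact: (lin_ractl b sig_lin).
have psi_eq (p q : restr (cover_mod X)) b : cg_plus b -> mod_cover X p = mod_cover X q ->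
    psi p b = psi q b.
  move=> bp e; apply/eqP; rewrite -subr_eq0 -(linB (pl b)); apply/eqP.
  have /lkernel_ex[u eu] : mod_cover X (p - q : cover_mod X) = 0 by refine (etrans (raddfB (mod_cover X) _ _) _); apply/eqP; rewrite subr_eq0; apply/eqP.
  by rewrite /psi -eu sigE // subrr.
pose one (m : restr X) : restr (cover_mod X) := (<< (m : X) >> : cover_mod X).
have cover_one m : mod_cover X (one m) = m by rewrite coverU; exact: scale1r.
exists (fun m b => psi (one m) (aug_part b)).
  split=> [b c x y|m c a b].
    rewrite -pl; apply: psi_eq; first exact: aug_part_plus.
    by rewrite cover_one restr_linear !cover_one.
  rewrite aug_partP /psi or_ ractrP sig_lin; ring.
move=> m a b ap bp.
rewrite !aug_part_id //; last exact: cg_plus_mull.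
rewrite (psi_eq _ (ract (one m) a)) //; last first.
  by rewrite cover_one [RHS]linearZ /= coverU scale1r.
rewrite /psi ractM -{1}(cover_one m) obs0_coboundary //; ring.
Qed.

End Obstruction.

Section ObstructionLinearity.
Variables (k : fieldType) (A : cgAlgebra k).

Lemma kext_comb (X : lmodType A^c) N (c : 'I_N -> k) (h : 'I_N -> restr X -> A -> k) p :
  kext (fun x a => \sum_i c i * h i x a) p = \sum_i c i * kext (h i) p.
Proof.
rewrite /kext exchange_big /=; apply: eq_bigr => x _.
by rewrite mulr_sumr.
Qed.

Variable X : lmodType A^c.

Lemma obs2_comb N (c : 'I_N -> k) (f : 'I_N -> restr X -> A -> A -> k) z :
  obs2 (fun x a b => \sum_i c i * f i x a b) z = \sum_i c i * obs2 (f i) z.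
Proof.
have e0 p b : obs0 (fun x a b => \sum_i c i * f i x a b) p b = \sum_i c i * obs0 (f i) p b.
  exact: kext_comb.
have e1 q : obs1 (fun x a b => \sum_i c i * f i x a b) q = \sum_i c i * obs1 (f i) q.
  rewrite -(kext_comb c (fun i (u : restr (syzygy X)) a => obs0 (f i) (lkval u) (aug_part a))).
  by apply: eq_bigr => u _; exact: e0.
rewrite /obs2; under eq_bigr do rewrite e1 mulr_sumr.
rewrite exchange_big; apply: eq_bigr => i _ /=.
by rewrite mulr_sumr; apply: eq_bigr => w _; rewrite mulrCA.
Qed.

Variables (N : nat) (e : 'I_N -> red_mod (syzygy (syzygy X))).
Hypothesis he : forall z, red_diff (syzygy X) z = 0 -> exists (c : 'I_N -> k) w,
  z - \sum_i c i *: e i = red_diff (syzygy (syzygy X)) w.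

(** Boundaries are killed anyway, so vanishing on the finitely many representatives [e] gives
    vanishing on all cycles. *)
Lemma findim_cocycle_trivial (f : restr X -> A -> A -> k) : trilin f ->
  (forall m a b c, cg_plus a -> cg_plus b -> cg_plus c ->
     f (ract m a) b c - f m (a * b) c + f m a (b * c) = 0) ->
  (forall l, obs2 f (e l) = 0) ->
  exists2 g : restr X -> A -> k, bilin g &
    forall m a b, cg_plus a -> cg_plus b -> f m a b = g (ract m a) b - g m (a * b).
Proof.
move=> ft cf f0; apply: obstruction_trivial => // z /he[c [w hw]].
have ol := obs2_lin f.
rewrite -(subrK (\sum_i c i *: e i) z) (linD ol) hw obs2_boundary // add0r.
by rewrite (lin_sum ol) big1 // => i _; rewrite (linZ ol) f0 mulr0.
Qed.

End ObstructionLinearity.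

(** * From finite-dimensional Tor to vanishing in high degrees *)

Section TorExactness.
Variables (k : fieldType) (A : cgAlgebra k).
Local Notation "'P_ i" := (cg_piece A i) (at level 8, i at level 2, format "''P_' i").
Variable BA : graded_basis (cg_piece A).

Lemma cg_plus_piece i a : (0 < i)%N -> a \in 'P_i -> cg_plus a.
Proof. by case: i => // i _; exact: cg_plus_hom. Qed.

Section Module.
Variables (X : lmodType A^c) (G : nat -> {pred restr X}).
Hypothesis actG : forall i j (x : restr X) a, x \in G i -> a \in 'P_j -> ract x a \in G (i + j)%N.
Hypothesis gG : grading G.
Variable BV : graded_basis G.

Definition ract_action : graded_action A :=
  @GradedAction k A (restr X) G (@ract k A X) (@ractP k A X) (@ractrP k A X)
    (@ractM k A X) actG.

Lemma plus_cocycle_module2 (f : restr X -> A -> A -> k) : trilin f ->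
  (forall i u v w m a b c, (0 < u)%N -> (0 < v)%N -> (0 < w)%N ->
     m \in G i -> a \in 'P_u -> b \in 'P_v -> c \in 'P_w ->
     f (ract m a) b c - f m (a * b) c + f m a (b * c) = 0) ->
  forall m a b c, cg_plus a -> cg_plus b -> cg_plus c ->
    f (ract m a) b c - f m (a * b) c + f m a (b * c) = 0.
Proof.
move=> [f1 f2 f3] cf m a b c ap bp cp.
apply: (lin_grading_eq0 (f := fun m => f (ract m a) b c - f m (a * b) c + f m a (b * c)) gG).
  apply: lin_add => //; apply: lin_sub => //; exact: (lin_ractl a (f1 b c)).
move=> i {}m mi.
apply: (lin_plus_eq0 (f := fun a => f (ract m a) b c - f m (a * b) c + f m a (b * c)) _ _ ap).
  apply: lin_add => //; apply: lin_sub; first exact: (lin_ractr m (f1 b c)).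
  exact: (lin_mulAr b (f2 _ _)).
move=> u a1 u0 au.
apply: (lin_plus_eq0 (f := fun b => f (ract m a1) b c - f m (a1 * b) c + f m a1 (b * c)) _ _ bp).
  apply: lin_add; last exact: (lin_mulAr c (f3 _ _)).
  by apply: lin_sub => //; exact: (lin_mulAl a1 (f2 _ _)).
move=> v b1 v0 bv.
apply: (lin_plus_eq0 (f := fun c => f (ract m a1) b1 c - f m (a1 * b1) c + f m a1 (b1 * c)) _ _ cp).
  by apply: lin_add; [apply: lin_sub|exact: (lin_mulAl b1 (f3 _ _))].
by move=> w c1 w0 cw; exact: (cf i u v w).
Qed.

Lemma findim_mod_exact2 : findim_homology X ->
  exists D, forall j, (D <= j)%N -> mod_exact2 ract_action 0 j.
Proof.
move=> [N [e [_ he]]].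
pose dom j : set (restr X * A * A) := [set u | exists i v w, [/\ (0 < v)%N, (0 < w)%N,
  (i + v + w)%N = j & [/\ u.1.1 \in G i, u.1.2 \in 'P_v & u.2 \in 'P_w]]].
pose Z : set (restr X * A * A -> k) := [set f | trilin (fun m a b => f (m, a, b)) /\
  forall m a b c, cg_plus a -> cg_plus b -> cg_plus c ->
    f (ract m a, b, c) - f (m, a * b, c) + f (m, a, b * c) = 0].
pose good j : set (restr X * A * A -> k) := [set f | exists2 g : restr X -> A -> k, bilin g &
  forall u, dom j u -> f u = g (ract u.1.1 u.1.2) u.2 - g u.1.1 (u.1.2 * u.2)].
have [|||j0 hj0] := @finitely_many_degrees k (restr X * A * A)%type dom N Z good
  (fun f l => obs2 (fun m a b => f (m, a, b)) (e l)).
- move=> n f c hf; split; last by move=> l; exact: (obs2_comb c (fun i m a b => f i (m, a, b))).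
  split=> [|m a b d ap bp dp]; first by apply: trilin_comb => i; case: (hf i).
  rewrite -sumrB -big_split big1 //= => i _; have [_ h] := hf i.
  by rewrite -mulrBr -mulrDr h // mulr0.
- move=> f j [fb cf] f0; have [g gb_ hg] := findim_cocycle_trivial he fb cf f0.
  exists g => // -[[m a] b] [i [v [w [v0 w0 _ [/= mi av bw]]]]]; apply: hg.
    exact: cg_plus_piece av.
  exact: cg_plus_piece bw.
- move=> j f g c [s [sl sr] hs] hg; exists (fun m a => c * s m a).
    by split=> [a|m]; apply: lin_scale.
  by move=> u du; rewrite hg // hs // mulrBr.
exists j0 => j hj f ft cf.
have ht := hom3_trilin BV BA BA j ft.
have hE i v w m a b : (0 < w)%N -> m \in G i -> a \in 'P_v -> b \in 'P_w ->
    hom3 BV BA BA f j m a b = if (i + v + w == j)%N then f m a b else 0.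
  by move=> w0 mi av bw; exact: hom3E.
have [||g gb_ hg] := hj0 j (fun u => hom3 BV BA BA f j u.1.1 u.1.2 u.2) hj.
- split=> //=; apply: plus_cocycle_module2 => // i u v w m a b c u0 v0 w0 mi au bv cw.
  rewrite (hE (i + u)%N v w (ract m a)) ?(hE i (u + v)%N w m (a * b)) ?(hE i u (v + w)%N m a) //;
    try exact: cg_mul; try exact: actG; last by rewrite addn_gt0 v0.
  rewrite !addnA; case: eqP => [ej|_]; last by rewrite subr0 addr0.
  exact: (cf i u v w).
- move=> i [[m a] b] [i' [v [w [v0 w0 ei [/= mi av bw]]]]] ne; rewrite (hE i' v w) //.
  by case: eqP => // e'; case: ne; rewrite -ei -e'.
- exists g => // i u w m a b _ u0 w0 ej mi au bw.
  rewrite -(hg (m, a, b)) /=; last by exists i, u, w.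
  by rewrite (hE i u w) // ej eqxx.
Qed.

End Module.

(** Dimension shifting on cochains: a cochain in three algebra arguments becomes one on the first
    syzygy of the trivial module, sending a sum of [t] a to the sum of t f(a^+, b, c). *)
Definition triv_cochain (f : A -> A -> A -> k) (u : restr (syzygy (trivR A))) (b c : A) : k :=
  kext (X := trivR A) (fun t a => (t : k) * f (aug_part a) b c) (lkval (u : syzygy (trivR A))).

Lemma triv_cochain_coboundary (f : A -> A -> A -> k) : trilin f ->
  (forall a b c d, cg_plus a -> cg_plus b -> cg_plus c -> cg_plus d ->
     f (a * b) c d - f a (b * c) d + f a b (c * d) = 0) ->
  trilin (triv_cochain f) /\
  forall m a b c, cg_plus a -> cg_plus b -> cg_plus c ->
    triv_cochain f (ract m a) b c - triv_cochain f m (a * b) c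
      + triv_cochain f m a (b * c) = 0.
Proof.
move=> [f1 f2 f3] cf.
have hl b c (t : restr (trivR A)) : lin (fun a => (t : k) * f (aug_part a) b c).
  by apply: lin_scale; exact: (lin_aug_part (f1 b c)).
pose T b c := kext (X := trivR A) (fun t a => (t : k) * f (aug_part a) b c).
have T1 b c : lin (T b c) by apply: kext_lin.
split; first split=> [b c d x y|u c|u b].
- rewrite /triv_cochain -[kext _ (lkval x)]/(T b c _) -[kext _ (lkval y)]/(T b c _) -T1.
  by congr (T b c _); exact: (restr_linear (@lkval _ _ _ (mod_cover (trivR A)))).
- by apply: lin_big => t _; apply: lin_scale; exact: f2.
- by apply: lin_big => t _; apply: lin_scale; exact: f3.
move=> m a b c ap bp cp.
(* On the whole cover the coboundary is f a b c times the image of [p] in the trivial module, which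
   is 0 on syzygies. *)
have key (p : restr (cover_mod (trivR A))) :
    T b c (ract p a) - T (a * b) c p + T a (b * c) p = (mod_cover (trivR A) p : k) * f a b c.
  move: p; apply: cover_lin_ext.
  - apply: lin_add => //; apply: lin_sub => //; exact: (lin_ractl a (T1 b c)).
  - move=> d x y; rewrite restr_linear /=.
    rewrite -[X in X * _]/(cg_aug (d%:A : A) * (mod_cover (trivR A) x : k)
      + (mod_cover (trivR A) y : k)).
    by rewrite cg_aug_scalar mulrDl mulrA.
  - move=> d t; rewrite malgU_ract /T !kextU // coverU.
    rewrite -[(d : A^c) *: t]/(cg_aug d * (t : k)) (aug_part_id (cg_plus_mull _ ap)).
    rewrite (lin_aug_split d (lin_mulAr a (f1 b c))) mul1r.
    have := cf _ _ _ _ (aug_part_plus d) ap bp cp.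
    move: (f (aug_part d * a) b c) (f (aug_part d) (a * b) c) (f (aug_part d) a (b * c)).
    move=> F1 F2 F3 E; have -> : F1 = F2 - F3 by rewrite -[LHS]subr0 -E; ring.
    by move: (t : k) => t'; ring.
have := key (lkval (m : syzygy (trivR A))); rewrite lkval0 => E.
by rewrite -[RHS](mul0r (f a b c)); exact: E.
Qed.

Lemma plus_cocycle3 (f : A -> A -> A -> k) : trilin f ->
  (forall i u v w m a b c, (0 < i)%N -> (0 < u)%N -> (0 < v)%N -> (0 < w)%N ->
     m \in 'P_i -> a \in 'P_u -> b \in 'P_v -> c \in 'P_w ->
     f (m * a) b c - f m (a * b) c + f m a (b * c) = 0) ->
  forall m a b c, cg_plus m -> cg_plus a -> cg_plus b -> cg_plus c ->
    f (m * a) b c - f m (a * b) c + f m a (b * c) = 0.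
Proof.
move=> [f1 f2 f3] cf m a b c mp ap bp cp.
apply: (lin_plus_eq0 (f := fun m => f (m * a) b c - f m (a * b) c + f m a (b * c)) _ _ mp).
  by apply: lin_add => //; apply: lin_sub => //; exact: (lin_mulAr a (f1 b c)).
move=> i m1 i0 mi.
apply: (lin_plus_eq0 (f := fun a => f (m1 * a) b c - f m1 (a * b) c + f m1 a (b * c)) _ _ ap).
  apply: lin_add => //; apply: lin_sub; first exact: (lin_mulAl m1 (f1 b c)).
  exact: (lin_mulAr b (f2 _ _)).
move=> u a1 u0 au.
apply: (lin_plus_eq0 (f := fun b => f (m1 * a1) b c - f m1 (a1 * b) c + f m1 a1 (b * c)) _ _ bp).
  apply: lin_add; last exact: (lin_mulAr c (f3 _ _)).
  by apply: lin_sub => //; exact: (lin_mulAl a1 (f2 _ _)).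
move=> v b1 v0 bv.
apply: (lin_plus_eq0 (f := fun c => f (m1 * a1) b1 c - f m1 (a1 * b1) c + f m1 a1 (b1 * c)) _ _ cp).
  by apply: lin_add; [apply: lin_sub|exact: (lin_mulAl b1 (f3 _ _))].
by move=> w c1 w0 cw; exact: (cf i u v w).
Qed.

Lemma findim_alg_exact3 : findim_homology (syzygy (trivR A)) ->
  exists d, forall t, (d <= t)%N -> alg_exact3 A t.
Proof.
move=> [N [e [_ he]]].
pose dom j : set (A * A * A) := [set u | exists i v w, [/\ (0 < i)%N, (0 < v)%N, (0 < w)%N,
  (i + v + w)%N = j & [/\ u.1.1 \in 'P_i, u.1.2 \in 'P_v & u.2 \in 'P_w]]].
pose Z : set (A * A * A -> k) := [set f | trilin (fun m a b => f (m, a, b)) /\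
  forall m a b c, cg_plus m -> cg_plus a -> cg_plus b -> cg_plus c ->
    f (m * a, b, c) - f (m, a * b, c) + f (m, a, b * c) = 0].
pose good j : set (A * A * A -> k) := [set f | exists2 g : A -> A -> k, bilin g &
  forall u, dom j u -> f u = g (u.1.1 * u.1.2) u.2 - g u.1.1 (u.1.2 * u.2)].
have [|||j0 hj0] := @finitely_many_degrees k (A * A * A)%type dom N Z good
  (fun f l => obs2 (triv_cochain (fun m a b => f (m, a, b))) (e l)).
- move=> n f c hf; split.
    split=> [|m a b d mp ap bp dp]; first by apply: trilin_comb => i; case: (hf i).
    rewrite -sumrB -big_split big1 //= => i _; have [_ h] := hf i.
    by rewrite -mulrBr -mulrDr h // mulr0.
  move=> l; rewrite -(obs2_comb c (fun i => triv_cochain (fun m a b => f i (m, a, b)))).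
  congr (obs2 _ (e l)); apply: funext => u; apply: funext => b; apply: funext => d.
  rewrite /triv_cochain -kext_comb; congr (kext _ _); apply: funext => t; apply: funext => a.
  by rewrite mulr_sumr; apply: eq_bigr => i _; rewrite mulrCA.
- move=> f j [fb cf] f0.
  have [Fb cF] := triv_cochain_coboundary fb cf.
  have [g [gl gr] hg] := findim_cocycle_trivial he Fb cF f0.
  (* The map a |-> [1] a^+ sends the augmentation ideal into the syzygy, compatibly with the right
     action; composing [g] with it gives the primitive on [A]. *)
  have /choice[u hu] a : exists u : syzygy (trivR A),
      lkval u = << (aug_part a : A^c) *g (1 : k) >>.
    apply: lkernel_ex; rewrite coverU -[LHS]/(cg_aug (aug_part a) * 1).
    by rewrite cg_aug_plus ?mul0r //; exact: aug_part_plus.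
  have uM a b : cg_plus a -> ract (u a : restr (syzygy (trivR A))) b = u (a * b).
    move=> ap; apply: (@lkval_inj _ _ _ (mod_cover (trivR A))).
    rewrite hu (aug_part_id (cg_plus_mulr _ ap)) /ract linearZ /= hu (aug_part_id ap).
    exact: (malgU_ract (X := trivR A)).
  have uP c a b : u (c *: a + b) = (c *: (u a : restr (syzygy (trivR A))) + (u b : restr _)) :> restr (syzygy (trivR A)).
    apply: (@lkval_inj _ _ _ (mod_cover (trivR A))).
    refine (etrans _ (esym (lkval_restr c (u a) (u b)))).
    rewrite !hu aug_partP; exact: (malgU_restr (X := trivR A)).
  exists (fun a b => g (u a) b); first by split=> [b c x y|a]; [rewrite uP gl|exact: gr].
  move=> [[a b] c] [i [v [w [i0 v0 w0 _ [/= ai bv cw]]]]].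
  have ap := cg_plus_piece i0 ai; have bp := cg_plus_piece v0 bv.
  have cp := cg_plus_piece w0 cw.
  rewrite -(uM a b ap) -(hg (u a) b c bp cp) /triv_cochain hu kextU => [|t].
    by rewrite mul1r !aug_part_id.
  by apply: lin_scale; case: fb => f1 _ _; exact: (lin_aug_part (f1 _ _)).
- move=> j f g c [s [sl sr] hs] hg; exists (fun m a => c * s m a).
    by split=> [a|m]; apply: lin_scale.
  by move=> u du; rewrite hg // hs // mulrBr.
exists j0 => j hj f ft cf.
have ht := hom3_trilin BA BA BA j ft.
have hE i v w m a b : (0 < w)%N -> m \in 'P_i -> a \in 'P_v -> b \in 'P_w ->
    hom3 BA BA BA f j m a b = if (i + v + w == j)%N then f m a b else 0.
  by move=> w0 mi av bw; exact: hom3E.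
have [||g gb_ hg] := hj0 j (fun u => hom3 BA BA BA f j u.1.1 u.1.2 u.2) hj.
- split=> //=; apply: plus_cocycle3 => // i u v w m a b c i0 u0 v0 w0 mi au bv cw.
  rewrite (hE (i + u)%N v w (m * a)) ?(hE i (u + v)%N w m (a * b)) ?(hE i u (v + w)%N m a) //;
    try exact: cg_mul; last by rewrite addn_gt0 v0.
  rewrite !addnA; case: eqP => [ej|_]; last by rewrite subr0 addr0.
  exact: (cf i u v w).
- move=> i [[m a] b] [i' [v [w [i0 v0 w0 ei [/= mi av bw]]]]] ne; rewrite (hE i' v w) //.
  by case: eqP => // e'; case: ne; rewrite -ei -e'.
- exists g => // i u w m a b i0 u0 w0 ej mi au bw.
  rewrite -(hg (m, a, b)) /=; last by exists i, u, w.
  by rewrite (hE i u w) // ej eqxx.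
Qed.

End TorExactness.

(** * Hilbert functions *)

Section Dimk.
Variables (k : fieldType) (V : lmodType k) (W : {pred V}).

Lemma dimkP : (exists n, has_dim W n) -> has_dim W (dimk W).
Proof. by move=> h; exact: (@xgetPex _ 0%N [set n | has_dim W n]). Qed.

Lemma dimk0 : submod_closed W -> (forall w, w \in W -> w = 0) -> dimk W = 0%N.
Proof.
move=> hW W0; have h0 : has_dim W 0.
  apply: (has_dim_intro (e := fun _ : 'I_0 => 0 : V)) => [[]|w /W0->|c _ []] //.
  by exists (fun=> 0); rewrite big_ord0.
have [e [eW _ fr]] := has_dim_basis hW (dimkP (ex_intro _ _ h0)).
case: (dimk W) e eW fr => // n e eW fr.
have e0 : \sum_(i < n.+1) (i == ord0)%:R *: e i = 0 :> V.
  by rewrite big1 // => i _; rewrite (W0 _ (eW i)) scaler0.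
by have /eqP := fr _ e0 ord0; rewrite eqxx oner_eq0.
Qed.

End Dimk.

(** Multiplication by 1 - X^P takes differences at distance [P]; they vanish from degree [a + P] on,
    which leaves a polynomial numerator. *)
Lemma periodic_rational (f : nat -> nat) (a P : nat) : (0 < P)%N ->
  (forall n, (a <= n)%N -> f n = f (n + P)%N) -> rational_series f.
Proof.
move=> P0 hf; pose q : {poly rat} := 1 - 'X^P.
exists (\poly_(n < a + P) \sum_(i < n.+1) q`_i * (f (n - i)%N)%:R), q.
have qE i : q`_i = (i == 0%N)%:R - (i == P)%:R by rewrite coefB coef1 coefXn.
split=> [|n].
  apply/eqP => /(congr1 (fun p : {poly rat} => p`_0)); rewrite qE coef0 eqxx.
  by rewrite eq_sym (gtn_eqF P0) subr0 => /eqP; rewrite oner_eq0.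
rewrite coef_poly; case: ltnP => // le.
have Pn : (P < n.+1)%N by lia.
under eq_bigr do rewrite qE mulrBl; rewrite sumrB.
rewrite (bigD1 ord0) //= mul1r subn0 big1 => [|i ne]; last first.
  by rewrite -val_eqE in ne; rewrite (negbTE ne) mul0r.
rewrite (bigD1 (Ordinal Pn)) //= eqxx mul1r big1 => [|i ne]; last first.
  by rewrite -val_eqE in ne; rewrite (negbTE ne) mul0r.
rewrite !addr0 (hf (n - P)%N); last lia.
by rewrite subnK ?subrr //; lia.
Qed.

Section ShiftedGrading.
Variables (k : fieldType) (A : cgAlgebra k) (M : grModule A).
Local Notation "'P_ i" := (cg_piece A i) (at level 8, i at level 2, format "''P_' i").

Lemma bounded_generators (p : nat) (x : 'I_p -> restr M) :
  exists (s : int) (J : finType) (z : J -> restr M) (e : J -> nat),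
    (forall j, z j \in gm_piece M (s + (e j)%:Z)) /\
    forall a : 'I_p -> A, exists b : J -> A,
      \sum_i ract (x i) (a i) = \sum_j ract (z j) (b j).
Proof.
have /choice[d hd] i : exists d : {t : seq int & int -> restr M},
    (forall l, projT2 d l \in gm_piece M l) /\ x i = \sum_(l <- projT1 d) projT2 d l.
  have [f [hf [t [_ _ e]]]] := decomposition_ex (gm_grading M) (x i).
  by exists (existT _ t f).
pose J : finType := {i : 'I_p & 'I_(size (projT1 (d i)))}.
pose deg (j : J) : int := (projT1 (d (tag j)))`_(tagged j).
(* A crude lower bound for all degrees of the homogeneous components of the generators. *)
pose s : int := - (\sum_j `|deg j|%N)%:Z.
have le j : s <= deg j.
  rewrite /s (bigD1 j) //=; lia.
exists s, J, (fun j => projT2 (d (tag j)) (deg j)), (fun j => `|deg j - s|%N).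
split=> [j|a].
  have -> : s + `|deg j - s|%N%:Z = deg j by have := le j; lia.
  by have [h _] := hd (tag j); exact: h.
exists (fun j => a (tag j)).
rewrite (sum_sigma (fun i (l : 'I_(size (projT1 (d i)))) =>
  ract (projT2 (d i) (projT1 (d i))`_l) (a i))).
apply: eq_bigr => i _; have [_ ->] := hd i.
rewrite (big_nth 0) big_mkord.
exact: (big_morph (fun y => ract y (a i)) (fun y z => ractD y z (a i)) (@scaler0 A^c M (a i))).
Qed.

End ShiftedGrading.

Lemma nat_grading (k : fieldType) (V : lmodType k) (G : int -> {pred V}) (s : int) :
  grading G -> (forall i m, i < s -> m \in G i -> m = 0) ->
  grading (fun l : nat => G (s + l%:Z)).
Proof.
move=> [sub dec ind] low; split=> [l|v|t f ut hf e l lt]; first exact: sub.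
  have [t [f [hf ->]]] := dec v.
  exists [seq `|i - s|%N | i <- t & s <= i], (fun l => f (s + l%:Z)); split=> //.
  rewrite big_map big_filter (bigID (fun i => s <= i)) /= [X in _ + X]big1 ?addr0.
    by apply: eq_bigr => i le; congr f; lia.
  by move=> i; rewrite -ltNge => lt; exact: low lt (hf i).
pose F (i : int) := if s <= i then f `|i - s|%N else 0.
have FE j : F (s + j%:Z) = f j.
  by rewrite /F ifT; [congr f; lia|lia].
have us : uniq [seq s + j%:Z | j <- t] by rewrite map_inj_uniq // => x y; lia.
rewrite -FE; apply: (ind _ F us) => [i||].
- rewrite /F; case: ifP => le; last by case: (sub i).
  by have := hf `|i - s|%N; congr (_ \in G _); lia.
- by rewrite big_map -[RHS]e; apply: eq_bigr => j _.
- exact: map_f.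
Qed.

Section BoundedBelow.
Variables (k : fieldType) (A : cgAlgebra k) (M : grModule A).
Variables (s : int) (J : finType) (z : J -> restr M) (e : J -> nat).
Hypothesis hz : forall j, z j \in gm_piece M (s + (e j)%:Z).
Hypothesis gen : forall m : restr M, exists b : J -> A, m = \sum_j ract (z j) (b j).

Lemma piece_below i m : i < s -> m \in gm_piece M i -> m = 0.
Proof.
move=> lt mi; have [pr [_ prl prid prne]] := projections (gm_grading M).
have pr0 : pr i 0 = 0 by apply: prid; exact: (piece0 (gm_grading M)).
have prD x y : pr i (x + y) = pr i x + pr i y by rewrite -[x]scale1r prl !scale1r.
have [b hb] := gen m; rewrite -(prid i m mi) hb (big_morph _ prD pr0) big1 // => j _.
have [t [f [hf ->]]] := cg_decomp (b j).
have r0 : ract (z j) 0 = 0 by exact: (@scale0r A^c M (z j)).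
have rD (x y : A) : ract (z j) (x + y) = ract (z j) x + ract (z j) y.
  exact: (@scalerDl A^c M (z j) x y).
rewrite (big_morph _ rD r0) (big_morph _ prD pr0) big1 // => u _.
apply: (prne _ _ _ (gm_act (hz j) (hf u))).
by apply/eqP => h; lia.
Qed.

Lemma generated_grading : grading (fun l : nat => gm_piece M (s + l%:Z)).
Proof. by apply: nat_grading; [exact: gm_grading|exact: piece_below]. Qed.

End BoundedBelow.

Lemma gm_act_nat (k : fieldType) (A : cgAlgebra k) (M : grModule A) (s : int) (i j : nat)
    (x : restr M) a : x \in gm_piece M (s + i%:Z) -> a \in cg_piece A j ->
  ract x a \in gm_piece M (s + (i + j)%N%:Z).
Proof. by move=> hx ha; rewrite PoszD addrA; exact: gm_act. Qed.

Lemma fp_module_relations (k : fieldType) (A : cgAlgebra k) (M : lmodType A^c) : fp_module M ->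
  exists (p q : nat) (x : 'I_p -> restr M) (r : 'I_q -> 'I_p -> A),
  [/\ forall m : restr M, exists a : 'I_p -> A, m = \sum_i ract (x i) (a i),
      forall a : 'I_p -> A, \sum_i ract (x i) (a i) = 0 ->
        exists b : 'I_q -> A, forall i, a i = \sum_l r l i * b l
    & forall l, \sum_i ract (x i) (r l i) = 0].
Proof.
move=> [p [q [g [h [gs gk]]]]].
pose x i : restr M := g (delta_mx 0 i); pose r l i : A := h (delta_mx 0 l) 0 i.
have gE (v : 'rV[A^c]_p) : g v = \sum_i ract (x i) (v 0 i) :> restr M.
  rewrite {1}[v]row_sum_delta linear_sum; apply: eq_bigr => i _.
  exact: (linearZ_LR g (v 0 i) (delta_mx 0 i)).
(* Scaling by [w 0 l] in the converse ring is multiplication on the right in [A], hence the order of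
   the factors. *)
have hE (w : 'rV[A^c]_q) i : h w 0 i = \sum_l r l i * (w 0 l : A) :> A.
  rewrite {1}[w]row_sum_delta linear_sum summxE; apply: eq_bigr => l _.
  by rewrite linearZ mxE.
exists p, q, x, r; split=> [m|a ha|l].
- by have [v ->] := gs m; exists (fun i => v 0 i); exact: gE.
- pose v : 'rV[A^c]_p := \row_i a i.
  have va i : v 0 i = a i by rewrite mxE.
  have /gk[w hw] : g v = 0.
    by rewrite -[RHS]ha gE; apply: eq_bigr => i _; rewrite va.
  by exists (fun l => w 0 l) => i; rewrite -va hw hE.
- by rewrite -[LHS](gE (h (delta_mx 0 l))); apply/gk; exists (delta_mx 0 l).
Qed.

Lemma sum_hilbert_le (f : int -> nat) (C : nat) (s : int) :
  (forall n : nat, (0 < n)%N -> forall m : nat, (\sum_(i < m) f (n%:Z - i%:Z)%R <= C * n)%N) ->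
  exists C', forall n, (0 < n)%N -> (\sum_(i < n.+1) f (s + i%:Z)%R <= C' * n)%N.
Proof.
move=> hf; exists (C * (absz s).+1)%N => n n0.
(* Counting down from [N >= s + n], the first [b] terms are dropped and the next [n + 1] are the
   wanted ones; [N <= (absz s).+1 * n] because [n] is positive. *)
pose N := (n + absz s)%N; pose b := absz (N%:Z - (s + n%:Z))%R.
have N0 : (0 < N)%N by rewrite /N; lia.
have eb : N%:Z - b%:Z = s + n%:Z by rewrite /b /N; lia.
have le : (C * N <= C * (absz s).+1 * n)%N.
  by rewrite -mulnA leq_mul2l; apply/orP; right; rewrite /N; nia.
apply: leq_trans le; apply: leq_trans (hf N N0 (b + n.+1)%N).
rewrite big_split_ord /=; apply: leq_trans (leq_addl _ _).
rewrite (reindex_inj rev_ord_inj) /=; apply: eq_leq; apply: eq_bigr => i _.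
by congr f; have := ltn_ord i; rewrite subSS; move: eb; clear; lia.
Qed.

Lemma periodic_from (f : nat -> nat) (a b : nat) : (a < b)%N ->
  (forall I, f (a + I)%N = f (b + I)%N) -> forall n, (a <= n)%N -> f n = f (n + (b - a))%N.
Proof. by move=> lt h n le; rewrite -{1}(subnKC le) h; congr f; lia. Qed.

Lemma shifted_periodic (f : int -> nat) (s : int) (a P : nat) : (0 < P)%N ->
  (forall i, i < s -> f i = 0%N) ->
  (forall n, (a <= n)%N -> f (s + n%:Z) = f (s + (n + P)%N%:Z)) ->
  rational_Laurent f /\ eventually_periodic f.
Proof.
move=> P0 f0 hf; split; first by exists s; split=> //; exact: periodic_rational P0 hf.
(* Beyond this bound [n - s] is at least [a]; the successor makes the bound positive. *)
exists P, (a + absz s).+1; split=> // n hn.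
have e : n%:Z = s + (absz (n%:Z - s))%:Z by lia.
rewrite e hf; last by lia.
by congr f; lia.
Qed.

Lemma fp_algebra_exact (k : fieldType) (A : cgAlgebra k) : fp_algebra A ->
  exists (J : finType) (y : J -> A) (e : J -> nat), aug_generators y e /\
    (graded_basis (cg_piece A) -> exists d, forall t, (d <= t)%N -> alg_exact2 A t).
Proof.
move=> [n [m [r [phi [surj ker]]]]].
have phi1 : phi 1 = 1 by exact: rmorph1.
have phiM p q : phi (p * q) = phi p * phi q by exact: rmorphM.
have phiP c p q : phi (c *: p + q) = c *: phi p + phi q by exact: linearP.
have [J [y [e hy]]] := fg_aug_generators (letters_generate phi1 phiM phiP surj).
exists J, y, e; split=> // BA.
exact: (fp_alg_exact2 phi1 phiM phiP surj ker BA).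
Qed.

Theorem theorem1p5 (k : fieldType) (A : cgAlgebra k) (M : grModule A)
    (fpA : fp_algebra A) (fpM : fp_module M) (gkM : GKdim1 M)
    (hab : finite_set [set: k] \/
           (findim_Tor 2 M (trivL A) /\ findim_Tor 3 (trivR A) (trivL A))) :
  rational_Laurent (hilbert M) /\ eventually_periodic (hilbert M).
Proof.
have [J [y [e [hy hA2]]]] := fp_algebra_exact fpA.
have [p [q [x [r [gen rel relr]]]]] := fp_module_relations fpM.
have [s [I [z [f [hz hxz]]]]] := bounded_generators x.
have genz (m : restr M) : exists b : I -> A, m = \sum_i ract (z i) (b i).
  by have [a ->] := gen m; exact: hxz.
have gG := generated_grading hz genz; have low := piece_below hz genz.
(* The module regraded by natural numbers: its piece [i] is M_(s+i), and nothing lies below degree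
   [s]. *)
pose V := ract_action (@gm_act_nat k A M s).
have dimA i := aug_generators_has_dim hy i.
have [hdA hdAE] := choice dimA.
have [BA _] := graded_basis_ex (cg_grading A) hdAE.
have dimV i : has_dim (gm_piece M (s + i%:Z)) (hilbert M (s + i%:Z)).
  apply: dimkP; exact: (generators_has_dim (V := V) hy gG hz genz i).
have [BV hBV] := graded_basis_ex gG dimV.
have [[C hC] _] := gkM.
have [C' hC'] := sum_hilbert_le s hC.
have [d1 T1] := aug_generators_exact1 hy; have [d2 T2] := hA2 BA.
have [D0 M0] := generators_exact0 (V := V) gG hz genz.
have [D1 M1] := fp_mod_exact1 (V := V) (@ract1 k A M) gG BV BA gen rel relr.
have growth n : (0 < n)%N -> (\sum_(i < n.+1) @gdim k (restr M) _ BV i <= C' * n)%N.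
  by move=> n0; rewrite hBV; exact: hC'.
have [a [b [ab per]]] : exists a b, (a < b)%N /\
    forall i, @gdim k (restr M) _ BV (a + i)%N = gdim BV (b + i)%N.
  case: hab => [kfin|[tor2 tor3]].
    (* The window length exceeds all degrees where exactness over [A] may fail; the successor makes
       it positive. *)
    apply: (@periodic_finite_field k A V BV BA C' (maxn d1 d2).+1 (maxn D0 D1)) => //.
    - by move=> t ht; apply: T1; lia.
    - by move=> t ht; apply: T2; lia.
    - by move=> j hj; apply: M0; lia.
    - by move=> j hj; apply: M1; lia.
  have [d3 T3] := findim_alg_exact3 BA (findim_Tor3 tor3).
  have [D2 M2] := findim_mod_exact2 BA (@gm_act_nat k A M s) gG BV (findim_Tor2 tor2).
  apply: (@periodic_exact2 k A V BV BA C' (maxn d1 (maxn d2 d3)).+1 (maxn D0 (maxn D1 D2))) => //.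
  - by move=> t ht; apply: T1; lia.
  - by move=> t ht; apply: T2; lia.
  - by move=> j hj; apply: M0; lia.
  - by move=> j hj; apply: M1; lia.
  - by move=> t ht; apply: T3; lia.
  - by move=> j hj; apply: M2; lia.
rewrite hBV in per.
apply: (@shifted_periodic _ s a (b - a)); first by rewrite subn_gt0.
- by move=> i lt; apply: dimk0 (piece_sub (gm_grading M) i) _ => m; exact: low.
- exact: periodic_from ab per.
Qed.
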